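(* Consider the Popularity Adjusted Block Model described in the context. Assume $\boldsymbol\Theta$ has exactly $K^2$ nonzero singular values $\sigma_{1,n}\ge\dots\ge\sigma_{K^2,n}$ with $\sigma_{1,n}/\sigma_{K^2,n}\le C_1\sqrt{\log n}$ for some constant $C_1>0$. Suppose: (A1) there is a constant $C\ge1$ with $\frac{n}{CK}\le n_k(\boldsymbol c^\ast)\le\frac{Cn}{K}$ for all $k\in[K]$; (A2) $n\rho_n^2/K^2\ge C(\log n)^2$ for a large constant $C>0$; and there are sequences $\phi_{1,n}\in(0,1]$ and $\phi_{2,n}$ such that: (A3) with $\mathcal G_i=\{j\in[n]:\boldsymbol c^\ast(j)=\boldsymbol c^\ast(i),\ |\tau_{ij}|\ge\phi_{1,n}\}$ and $\mathcal H=\{i\in[n]:|\mathcal G_i|\ge n_{\boldsymbol c^\ast(i)}(\boldsymbol c^\ast)(1-\tilde\eta_{n,0})\}$, one has $|[n]\setminus\mathcal H|\le\tilde\eta_{n,1}n$ for sequences $\tilde\eta_{n,1}=o((n\rho_n^2)^{-1}(\log n)^2)$ and $\tilde\eta_{n,0}=o((n\rho_n^2)^{-1/2}\log n)$; (A4) with $\mathcal I=\{i\in[n]:D_{\boldsymbol P_{\boldsymbol c^\ast(i)}}^{1/2}(\boldsymbol\lambda_{i\cdot},\boldsymbol\lambda_{i\cdot})\ge\phi_{2,n}\}$, one has $|\mathcal I|>n(1-\tilde\eta_{n,2})$ for some $\tilde\eta_{n,2}=o((\log n)^2(n\rho_n^2)^{-1})$, and $\max_{i\in[n]}D_{\boldsymbol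 P_{\boldsymbol c^\ast(i)}}(\boldsymbol\lambda_{i\cdot},\boldsymbol\lambda_{i\cdot})\lesssim K^2/n$; and moreover, for a large constant $C_2>0$, $$\frac{K}{\sqrt n}\gtrsim\phi_{1,n}\phi_{2,n}\ge C_2\frac{\rho_nK\sqrt{\log n}}{\sigma_{K^2,n}}.$$ If the TCSC algorithm is run with $d_n=\phi_{1,n}/2$ and $\hat{\boldsymbol c}^{(0)}$ is its output, then there exist a constant $C>0$ and a sequence $\tilde\eta_n=o(1)$ such that $$\mathbb P\{\ell(\boldsymbol c^\ast,\hat{\boldsymbol c}^{(0)})\le\tilde\eta_n\}\ge1-Cn^{-4}.$$
   Context: Notation: $[m]=\{1,\dots,m\}$. PABM: integers $n$, $K\ge2$, label vector $\boldsymbol c^\ast\in[K]^n$, popularity matrix $\boldsymbol\Lambda=(\lambda_{ik})\in[0,1]^{n\times K}$ with rows $\boldsymbol\lambda_{i\cdot}$. Edge probabilities $\theta_{ij}=\lambda_{i\boldsymbol c^\ast(j)}\lambda_{j\boldsymbol c^\ast(i)}$, $\boldsymbol\Theta=(\theta_{ij})_{n\times n}$. Adjacency matrix $\boldsymbol A$ symmetric, $A_{ii}=0$, $A_{ij}\sim\mathrm{Bernoulli}(\theta_{ij})$ independently for $i<j$. $n_k(\boldsymbol c)=|\{i:\boldsymbol c(i)=k\}|$. $\boldsymbol\Lambda^{(k,\cdot)}$ = rows of $\boldsymbol\Lambda$ with $\boldsymbol c^\ast(i)=k$; $\boldsymbol P_k=(\boldsymbol\Lambda^{(k,\cdot)\top}\boldsymbol\Lambda^{(k,\cdot)})^{-1}$,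 $D_{\boldsymbol P_k}(\boldsymbol x,\boldsymbol y)=\boldsymbol x^\top\boldsymbol P_k\boldsymbol y$. $\boldsymbol\Xi\in\mathbb R^{n\times K^2}$: orthonormal eigenvectors of $\boldsymbol\Theta$ for its $K^2$ nonzero eigenvalues, rows $\boldsymbol\xi_{i\cdot}$; $\tau_{ij}=|\cos(\boldsymbol\xi_{i\cdot},\boldsymbol\xi_{j\cdot})|$, $\cos(\boldsymbol x,\boldsymbol y)=\boldsymbol x^\top\boldsymbol y/(\|\boldsymbol x\|\|\boldsymbol y\|)$. Loss: $\ell(\boldsymbol c^\ast,\hat{\boldsymbol c})=\min_{\pi}\frac1n\sum_{i}\mathbb I\{\boldsymbol c^\ast(i)\ne\pi(\hat{\boldsymbol c}(i))\}$ over permutations $\pi$ of $[K]$. Asymptotics as $n\to\infty$; $\boldsymbol\Lambda=\rho_n\boldsymbol\Lambda_0$, $\boldsymbol\Lambda_0\in(0,1)^{n\times K}$, $\rho_n\in(0,1]$; $x_n\lesssim y_n$ ($x_n\gtrsim y_n$) means $x_n\le Cy_n$ ($x_n\ge Cy_n$) for a constant $C>0$. TCSC algorithm (input $\boldsymbol A$, $K$, threshold $d_n$, fixed $\varepsilon>0$): let $\hat{\boldsymbol\Xi}$ be the $n\times K^2$ matrix of eigenvectors of $\boldsymbol A$ for its $K^2$ eigenvalues of largest absolute value, rows $\hat{\boldsymbol\xi}_{i\cdot}$; $\hat\tau_{ij}=|\cos(\hat{\boldsymbol\xi}_{i\cdot},\hat{\boldsymbol\xi}_{j\cdot})|$; $\tilde{\boldsymbol\tau}_i=(\mathbb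 I\{\hat\tau_{ij}\ge d_n\})_{j\in[n]}\in\{0,1\}^n$; output any $\hat{\boldsymbol c}^{(0)}\in[K]^n$ satisfying $\sum_{k}\min_{\boldsymbol\nu_k\in\mathbb R^n}\sum_{i:\hat{\boldsymbol c}^{(0)}(i)=k}\|\tilde{\boldsymbol\tau}_i-\boldsymbol\nu_k\|^2\le(1+\varepsilon)\min_{\tilde{\boldsymbol c}\in[K]^n}\sum_k\min_{\boldsymbol\nu_k}\sum_{i:\tilde{\boldsymbol c}(i)=k}\|\tilde{\boldsymbol\tau}_i-\boldsymbol\nu_k\|^2$. *)

(* Defs.v *)
From HB Require Import structures.
From mathcomp Require Import all_boot all_order all_algebra all_fingroup.
From mathcomp Require Import boolp classical_sets reals topology normedtype sequences exp.

Set Implicit Arguments.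
Unset Strict Implicit.
Unset Printing Implicit Defensive.

Import Order.TTheory GRing.Theory Num.Theory.
Local Open Scope ring_scope.

Section PABM.
Variable R : realType.

(* Euclidean inner product / norm / cosine of row vectors;
   convention: division by 0 gives 0 (MathComp's x / 0 = 0). *)
Definition dotr (m : nat) (x y : 'rV[R]_m) : R := \sum_j x 0 j * y 0 j.
Definition vnorm (m : nat) (x : 'rV[R]_m) : R := Num.sqrt (dotr x x).
Definition cosr (m : nat) (x y : 'rV[R]_m) : R := dotr x y / (vnorm x * vnorm y).

Definition Theta (n K : nat) (c : 'I_n -> 'I_K) (L : 'M[R]_(n, K)) : 'M[R]_n :=
  \matrix_(i, j) (L i (c j) * L j (c i)).

Definition nk (n K : nat) (c : 'I_n -> 'I_K) (k : 'I_K) : nat := #|[set i | c i == k]|.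

Definition gramk (n K : nat) (c : 'I_n -> 'I_K) (L : 'M[R]_(n, K)) (k : 'I_K) : 'M[R]_K :=
  \sum_(i | c i == k) (row i L)^T *m row i L.
Definition Pk (n K : nat) (c : 'I_n -> 'I_K) (L : 'M[R]_(n, K)) (k : 'I_K) : 'M[R]_K :=
  invmx (gramk c L k).
Definition DP (n K : nat) (c : 'I_n -> 'I_K) (L : 'M[R]_(n, K)) (k : 'I_K)
  (x y : 'rV[R]_K) : R := (x *m Pk c L k *m y^T) 0 0.

Definition eigdecomp (n m : nat) (M : 'M[R]_n) (X : 'M[R]_(n, m)) (d : 'I_m -> R) :=
  X^T *m X = 1%:M /\ M *m X = X *m diag_mx (\row_j d j).

(* X collects orthonormal eigenvectors of the symmetric M for its m eigenvalues
   of largest absolute value: every eigenvector orthogonal to the columns of X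
   has an eigenvalue of absolute value at most each selected one. *)
Definition top_eig (n m : nat) (M : 'M[R]_n) (X : 'M[R]_(n, m)) (d : 'I_m -> R) :=
  eigdecomp M X d /\
  forall (v : 'cV[R]_n) (lam : R), v != 0 -> M *m v = lam *: v -> X^T *m v = 0 ->
    forall j, `|lam| <= `|d j|.

(* largest and smallest of the |d j| (singular values of a symmetric matrix) *)
Definition smax (m : nat) (d : 'I_m -> R) : R := \big[Num.max/0]_j `|d j|.
Definition smin (m : nat) (d : 'I_m -> R) : R := \big[Num.min/smax d]_j `|d j|.

Definition tauX (n m : nat) (X : 'M[R]_(n, m)) (i j : 'I_n) : R :=
  `|cosr (row i X) (row j X)|.

Definition ttau (n m : nat) (X : 'M[R]_(n, m)) (dn : R) (i : 'I_n) : 'rV[R]_n :=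
  \row_j (if dn <= tauX X i j then 1 else 0).

Definition clcost (n K : nat) (V : 'I_n -> 'rV[R]_n) (c : 'I_n -> 'I_K) (k : 'I_K) : R :=
  inf [set x | exists nu : 'rV[R]_n,
         x = \sum_(i | c i == k) \sum_j (V i 0 j - nu 0 j) ^+ 2].
Definition kobj (n K : nat) (V : 'I_n -> 'rV[R]_n) (c : 'I_n -> 'I_K) : R :=
  \sum_k clcost V c k.
Definition kmeans_approx (n K : nat) (eps : R) (V : 'I_n -> 'rV[R]_n) (c : 'I_n -> 'I_K) :=
  kobj V c <= (1 + eps) * inf [set x | exists c' : 'I_n -> 'I_K, x = kobj V c'].

Definition loss (n K : nat) (c ch : 'I_n -> 'I_K) : R :=
  \big[Num.min/1]_(pi : {perm 'I_K})
     (#|[set i | c i != pi (ch i)]|%:R / n%:R).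

(* Random adjacency matrices: A is encoded as a boolean function on pairs;
   probability of the Bernoulli model (symmetric, zero diagonal, independent
   upper-triangular entries with means T i j). *)
Definition adjm (n : nat) (A : {ffun 'I_n * 'I_n -> bool}) : 'M[R]_n :=
  \matrix_(i, j) (A (i, j))%:R.
Definition admissible (n : nat) (A : {ffun 'I_n * 'I_n -> bool}) : bool :=
  [forall i, forall j, A (i, j) == A (j, i)] && [forall i, ~~ A (i, i)].
Definition weight (n : nat) (T : 'M[R]_n) (A : {ffun 'I_n * 'I_n -> bool}) : R :=
  (admissible A)%:R *
  \prod_(i : 'I_n) \prod_(j : 'I_n | (i < j)%N) (if A (i, j) then T i j else 1 - T i j).
Definition Prob (n : nat) (T : 'M[R]_n) (E : {ffun 'I_n * 'I_n -> bool} -> Prop) : R :=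
  \sum_(A : {ffun 'I_n * 'I_n -> bool}) weight T A * (`[< E A >])%:R.

Definition littleo (f g : nat -> R) : Prop :=
  forall e : R, 0 < e -> \forall n \near \oo%classic, `|f n| <= e * `|g n|.

End PABM.
Arguments adjm {R n} A.
Arguments loss {R n K} c ch.

(* Main.v *)
(* Let P be the projection onto the range of Theta.  Its (i, j) entry is
   D_{P_k}(lambda_i, lambda_j) inside community k and 0 across communities, so
   tau_ij vanishes across communities, and the cosines are those of the rows of P.
   Let P' be the projection onto the selected eigenvectors of A = Theta + E.  With
   r = rho K sqrt(log n) / sigma_{K^2}, the point is that every row of P' - P has
   norm O(r), hence at most phi_1 phi_2 / 16; thresholding at phi_1 / 2 is then
   exact on all pairs of nodes covered by (A3) and (A4), and the comparison of
   the k-means objective with that of the true communities bounds the loss.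

   The bound on the operator norm of E, of order rho sqrt(n log n), comes from
   E tr E^(2p) with p of order log n: a closed walk contributes only if it uses
   each edge at least twice, hence visits at most p + 1 vertices.  The row bound
   follows from P' - P = (1 - P) P' - P (1 - P') and (1 - P) P' = (1 - P) E G with
   G the pseudo-inverse of A on the range of P', once row i of E P' is controlled.
   There P' is replaced by the projection P'_i for Theta plus E deprived of its
   i-th row and column: it is independent of row i of E, which allows a Chernoff
   bound, and Davis-Kahan bounds P' - P'_i.  The largest row norms of P' and P'_i
   enter these estimates with small coefficients, so the bounds close up. *)

Require Import Defs.
From HB Require Import structures.
From mathcomp Require Import all_boot all_order all_algebra all_fingroup.
From mathcomp Require Import boolp classical_sets reals topology normedtype sequences exp.
From mathcomp Require Import ring lra zify.
Import Order.TTheory GRing.Theory Num.Theory.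
Local Open Scope ring_scope.

Set Implicit Arguments.
Unset Strict Implicit.
Unset Printing Implicit Defensive.

(** * Frobenius and operator norms *)

Section FrobeniusNorm.
Variable R : realType.

(** The eigenbasis of A is not unique and the algorithm may use any one, so the estimates concern
    projections: their rows have the same norms and inner products as the rows of any basis of the
    same space. A direct Davis-Kahan bound is too weak: it controls P' - P by |E| / sigma_{K^2},
    whereas the rows of P have norm at most of order K / sqrt n. To gain this factor, row i of E has
    to be independent of the matrix that it multiplies. That sigma_{K^2} dominates the noise comes
    from the two bounds on phi_1 phi_2: together they give sigma_{K^2} >= (C_2 / C_phi) rho sqrt(n
    log n), a large multiple of the bound on |E|. (A2) enters as 14 K log n <= rho sqrt n, so that
    the linear term of the Chernoff bound is at most the bound on |E| times the largest row norm.
    Finally K may grow with n, and labels can be matched only if the badly placed nodes are fewer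
    than the smallest community, of size about n / K; hence K times the error rate, not just the
    rate, is shown to vanish. *)

Definition fdot m n (A B : 'M[R]_(m, n)) : R := \sum_i \sum_j A i j * B i j.
Definition fnorm2 m n (A : 'M[R]_(m, n)) : R := fdot A A.
Definition fnorm m n (A : 'M[R]_(m, n)) : R := Num.sqrt (fnorm2 A).

Lemma fdot_tr m n (A B : 'M[R]_(m, n)) : fdot A B = \tr (A^T *m B).
Proof.
rewrite /fdot exchange_big /mxtrace; apply: eq_bigr => j _.
by rewrite mxE; apply: eq_bigr => i _; rewrite mxE.
Qed.

Lemma fdotC m n (A B : 'M[R]_(m, n)) : fdot A B = fdot B A.
Proof. by apply: eq_bigr => i _; apply: eq_bigr => j _; rewrite mulrC. Qed.

Lemma fdotDl m n (A B C : 'M[R]_(m, n)) : fdot (A + B) C = fdot A C + fdot B C.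
Proof.
by rewrite !fdot_tr linearD mulmxDl linearD.
Qed.

Lemma fdotZl m n a (A B : 'M[R]_(m, n)) : fdot (a *: A) B = a * fdot A B.
Proof. by rewrite !fdot_tr linearZ -scalemxAl linearZ. Qed.

Lemma fdotNl m n (A B : 'M[R]_(m, n)) : fdot (- A) B = - fdot A B.
Proof. by rewrite -scaleN1r fdotZl mulN1r. Qed.

Lemma fdotDr m n (A B C : 'M[R]_(m, n)) : fdot C (A + B) = fdot C A + fdot C B.
Proof. by rewrite fdotC fdotDl !(fdotC C). Qed.

Lemma fdotZr m n a (A B : 'M[R]_(m, n)) : fdot A (a *: B) = a * fdot A B.
Proof. by rewrite fdotC fdotZl fdotC. Qed.

Lemma fdotNr m n (A B : 'M[R]_(m, n)) : fdot A (- B) = - fdot A B.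
Proof. by rewrite fdotC fdotNl fdotC. Qed.

Lemma fdot_mull m n p (M : 'M[R]_(m, n)) (V : 'M[R]_(n, p)) W :
  fdot (M *m V) W = fdot V (M^T *m W).
Proof. by rewrite !fdot_tr trmx_mul -mulmxA. Qed.

Lemma fdot_mulr m n p (M : 'M[R]_(n, p)) (V : 'M[R]_(m, n)) W :
  fdot (V *m M) W = fdot V (W *m M^T).
Proof. by rewrite !fdot_tr trmx_mul -mulmxA mxtrace_mulC -!mulmxA. Qed.

Lemma fdot_trmx m n (A B : 'M[R]_(m, n)) : fdot A^T B^T = fdot A B.
Proof.
rewrite /fdot exchange_big; apply: eq_bigr => i _; apply: eq_bigr => j _.
by rewrite !mxE.
Qed.

Lemma fnorm2_ge0 m n (A : 'M[R]_(m, n)) : 0 <= fnorm2 A.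
Proof.
by apply: sumr_ge0 => i _; apply: sumr_ge0 => j _; rewrite -expr2 sqr_ge0.
Qed.

Lemma fnorm_ge0 m n (A : 'M[R]_(m, n)) : 0 <= fnorm A.
Proof. exact: sqrtr_ge0. Qed.

Lemma fnorm_sqr m n (A : 'M[R]_(m, n)) : fnorm A ^+ 2 = fnorm2 A.
Proof. by rewrite sqr_sqrtr ?fnorm2_ge0. Qed.

Lemma fnorm2_eq0 m n (A : 'M[R]_(m, n)) : fnorm2 A = 0 -> A = 0.
Proof.
move=> A0; apply/matrixP => i j; rewrite mxE.
have A1 : \sum_j A i j * A i j = 0.
  apply: (psumr_eq0P _ A0) => // i' _.
  by apply: sumr_ge0 => k _; rewrite -expr2 sqr_ge0.
have : A i j * A i j = 0.
  by apply: (psumr_eq0P _ A1) => // k _; rewrite -expr2 sqr_ge0.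
by move/eqP; rewrite mulf_eq0 orbb => /eqP.
Qed.

Lemma fnorm_eq0 m n (A : 'M[R]_(m, n)) : fnorm A = 0 -> A = 0.
Proof. by move=> h; apply: fnorm2_eq0; rewrite -fnorm_sqr h expr0n. Qed.

Lemma fnorm_gt0 m n (A : 'M[R]_(m, n)) : A != 0 -> 0 < fnorm A.
Proof.
by move=> A0; rewrite lt_neqAle fnorm_ge0 andbT eq_sym; apply: contra A0 => /eqP/fnorm_eq0 ->.
Qed.

Lemma fnorm0 m n : fnorm (0 : 'M[R]_(m, n)) = 0.
Proof. by rewrite /fnorm -(scale0r 0) /fnorm2 fdotZl mul0r sqrtr0. Qed.

Lemma fnorm_trmx m n (A : 'M[R]_(m, n)) : fnorm A^T = fnorm A.
Proof. by rewrite /fnorm /fnorm2 fdot_trmx. Qed.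

Lemma fnormZ m n a (A : 'M[R]_(m, n)) : fnorm (a *: A) = `|a| * fnorm A.
Proof.
by rewrite /fnorm /fnorm2 fdotZl fdotZr mulrA -expr2 sqrtrM ?sqr_ge0 // sqrtr_sqr.
Qed.

Lemma fnormN m n (A : 'M[R]_(m, n)) : fnorm (- A) = fnorm A.
Proof. by rewrite -scaleN1r fnormZ normrN1 mul1r. Qed.

Lemma fnorm_le m n p q (A : 'M[R]_(m, n)) (B : 'M[R]_(p, q)) t :
  0 <= t -> (fnorm A <= t * fnorm B) = (fnorm2 A <= t ^+ 2 * fnorm2 B).
Proof.
move=> t0; rewrite -!fnorm_sqr -exprMn ler_pXn2r // nnegrE ?fnorm_ge0 //.
by rewrite mulr_ge0 ?fnorm_ge0.
Qed.

Lemma fdot_le m n (A B : 'M[R]_(m, n)) : fdot A B <= fnorm A * fnorm B.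
Proof.
have [->|B0] := eqVneq B 0.
  by rewrite -(scale0r 0) fdotZr mul0r mulr_ge0 ?fnorm_ge0.
have := fnorm2_ge0 (fnorm B *: A - fnorm A *: B).
rewrite /fnorm2 !(fdotDl, fdotDr, fdotNl, fdotNr, fdotZl, fdotZr) -/(fnorm2 A) -/(fnorm2 B).
rewrite -!fnorm_sqr (fdotC B A).
have b0 := fnorm_gt0 B0; have := fnorm_ge0 A; rewrite le_eqVlt => /orP[/eqP a0 _|a0].
  rewrite -a0; rewrite (fnorm_eq0 (esym a0)) -(scale0r 0) fdotZl !mul0r //.
move=> h.
have h2 : 0 <= 2 * (fnorm A * fnorm B) * (fnorm A * fnorm B - fdot A B).
  by apply: le_trans h _; rewrite le_eqVlt; apply/orP; left; apply/eqP; ring.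
by move: h2; rewrite pmulr_rge0 ?subr_ge0 // !mulr_gt0.
Qed.

Lemma normr_ip_le m n (A B : 'M[R]_(m, n)) : `|fdot A B| <= fnorm A * fnorm B.
Proof. by rewrite ler_norml fdot_le andbT lerNl -fdotNl -(fnormN A) fdot_le. Qed.

Lemma fnormD m n (A B : 'M[R]_(m, n)) : fnorm (A + B) <= fnorm A + fnorm B.
Proof.
rewrite -(@ler_pXn2r _ 2) ?nnegrE ?addr_ge0 ?fnorm_ge0 //.
rewrite fnorm_sqr /fnorm2 !(fdotDl, fdotDr) (fdotC B A) -/(fnorm2 A) -/(fnorm2 B) -!fnorm_sqr.
by have := fdot_le A B; lra.
Qed.

Lemma fnormB m n (A B : 'M[R]_(m, n)) : fnorm (A - B) <= fnorm A + fnorm B.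
Proof. by apply: (le_trans (fnormD _ _)); rewrite fnormN. Qed.

Lemma fnorm_dist m n (A B : 'M[R]_(m, n)) : fnorm A <= fnorm B + fnorm (A - B).
Proof. by have := fnormD B (A - B); rewrite addrC subrK. Qed.

Lemma fnorm2_row m n (A : 'M[R]_(m, n)) : fnorm2 A = \sum_i fnorm2 (row i A).
Proof.
apply: eq_bigr => i _; rewrite /fnorm2 /fdot big_ord1.
by apply: eq_bigr => j _; rewrite mxE.
Qed.

Lemma fnorm2_col m n (A : 'M[R]_(m, n)) : fnorm2 A = \sum_j fnorm2 (col j A).
Proof.
rewrite /fnorm2 -fdot_trmx -/(fnorm2 _) fnorm2_row; apply: eq_bigr => j _.
by rewrite -tr_col /fnorm2 fdot_trmx.
Qed.

Lemma fnorm_row_le m n (A : 'M[R]_(m, n)) i : fnorm (row i A) <= fnorm A.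
Proof.
rewrite ler_sqrt ?fnorm2_ge0 // (fnorm2_row A) (bigD1 i) //= lerDl.
by apply: sumr_ge0 => k _; apply: fnorm2_ge0.
Qed.

Lemma fnorm_entry_le m n (A : 'M[R]_(m, n)) i j : `|A i j| <= fnorm A.
Proof.
apply: le_trans (fnorm_row_le A i).
rewrite -sqrtr_sqr ler_sqrt ?fnorm2_ge0 // /fnorm2 /fdot big_ord1 (bigD1 j) //= !mxE.
by rewrite expr2 lerDl; apply: sumr_ge0 => k _; rewrite -expr2 sqr_ge0.
Qed.

Lemma fnorm_mul_le m n p (A : 'M[R]_(m, n)) (B : 'M[R]_(n, p)) :
  fnorm (A *m B) <= fnorm A * fnorm B.
Proof.
rewrite fnorm_le ?fnorm_ge0 // fnorm_sqr (fnorm2_row A) (fnorm2_col B) mulr_suml.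
apply: ler_sum => i _; rewrite mulr_sumr; apply: ler_sum => j _.
have -> : (A *m B) i j = fdot (row i A) (col j B)^T.
  by rewrite mxE /fdot big_ord1; apply: eq_bigr => k _; rewrite !mxE.
rewrite -expr2 -real_normK ?num_real // -!fnorm_sqr -exprMn.
rewrite ler_pXn2r ?nnegrE ?mulr_ge0 ?fnorm_ge0 //.
by rewrite -(fnorm_trmx (col j B)) normr_ip_le.
Qed.

Lemma fnorm_isol m n p (X : 'M[R]_(m, n)) (V : 'M[R]_(n, p)) :
  X^T *m X = 1%:M -> fnorm (X *m V) = fnorm V.
Proof. by move=> h; rewrite /fnorm /fnorm2 fdot_mull mulmxA h mul1mx. Qed.

Lemma fnorm_isor m n p (X : 'M[R]_(m, n)) (V : 'M[R]_(p, n)) :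
  X^T *m X = 1%:M -> fnorm (V *m X^T) = fnorm V.
Proof. by move=> h; rewrite -fnorm_trmx trmx_mul trmxK fnorm_isol // fnorm_trmx. Qed.

(** The ball rather than the sphere: the set contains 0 and is thus non-empty also for [n = 0]. *)
Definition opnorm m n (M : 'M[R]_(m, n)) : R :=
  sup [set x | exists v : 'cV[R]_n, fnorm v <= 1 /\ x = fnorm (M *m v)].

Let opnorm_set m n (M : 'M[R]_(m, n)) :=
  [set x | exists v : 'cV[R]_n, fnorm v <= 1 /\ x = fnorm (M *m v)]%classic.

Let opnorm_ub m n (M : 'M[R]_(m, n)) : has_ubound (opnorm_set M).
Proof.
exists (fnorm M) => _ [v [v1 ->]]; apply: (le_trans (fnorm_mul_le _ _)).
by rewrite ler_piMr ?fnorm_ge0.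
Qed.

Let opnorm_ne m n (M : 'M[R]_(m, n)) : (opnorm_set M !=set0)%classic.
Proof. by exists 0; exists 0; rewrite fnorm0 mulmx0 fnorm0 ler01. Qed.

Lemma opnorm_ge0 m n (M : 'M[R]_(m, n)) : 0 <= opnorm M.
Proof. by apply: (ub_le_sup (opnorm_ub M)); exists 0; rewrite fnorm0 mulmx0 fnorm0 ler01. Qed.

Lemma opnorm_cV m n (M : 'M[R]_(m, n)) (v : 'cV_n) : fnorm (M *m v) <= opnorm M * fnorm v.
Proof.
have [->|v0] := eqVneq v 0; first by rewrite mulmx0 !fnorm0 mulr0.
have p := fnorm_gt0 v0.
rewrite -ler_pdivrMr //; apply: (ub_le_sup (opnorm_ub M)).
exists ((fnorm v)^-1 *: v); rewrite -scalemxAr !fnormZ ger0_norm ?invr_ge0 ?fnorm_ge0 //.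
by rewrite mulVf ?gt_eqF // mulrC.
Qed.

Lemma opnorm_le m n (M : 'M[R]_(m, n)) t : 0 <= t ->
  (forall v : 'cV_n, fnorm (M *m v) <= t * fnorm v) -> opnorm M <= t.
Proof.
move=> t0 h; apply: (ge_sup (opnorm_ne M)) => _ [v [v1 ->]].
by apply: (le_trans (h v)); rewrite ler_piMr.
Qed.

Lemma opnormM m n p (M : 'M[R]_(m, n)) (V : 'M[R]_(n, p)) : fnorm (M *m V) <= opnorm M * fnorm V.
Proof.
rewrite fnorm_le ?opnorm_ge0 // (fnorm2_col (M *m V)) (fnorm2_col V) mulr_sumr.
apply: ler_sum => j _; rewrite -fnorm_le ?opnorm_ge0 // !colE -mulmxA; exact: opnorm_cV.
Qed.

Let opnorm_tr_le m n (M : 'M[R]_(m, n)) : opnorm M^T <= opnorm M.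
Proof.
apply: opnorm_le (opnorm_ge0 M) _ => v.
have [->|v0] := eqVneq (M^T *m v) 0; first by rewrite fnorm0 mulr_ge0 ?opnorm_ge0 ?fnorm_ge0.
have p := fnorm_gt0 v0.
rewrite -(ler_pM2r p) -expr2 fnorm_sqr {1}/fnorm2 fdot_mull trmxK.
apply: (le_trans (fdot_le _ _)).
by rewrite mulrAC mulrC ler_wpM2r ?fnorm_ge0 // opnormM.
Qed.

Lemma opnorm_tr m n (M : 'M[R]_(m, n)) : opnorm M^T = opnorm M.
Proof.
by apply/eqP; rewrite eq_le opnorm_tr_le -{1}(trmxK M) opnorm_tr_le.
Qed.

Lemma opnormMr m n p (M : 'M[R]_(m, n)) (U : 'M[R]_(p, m)) : fnorm (U *m M) <= opnorm M * fnorm U.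
Proof. by rewrite -fnorm_trmx trmx_mul -opnorm_tr -(fnorm_trmx U) opnormM. Qed.

Lemma opnorm_mul m n p (M : 'M[R]_(m, n)) (V : 'M[R]_(n, p)) :
  opnorm (M *m V) <= opnorm M * opnorm V.
Proof.
apply: opnorm_le => [|v]; first by rewrite mulr_ge0 ?opnorm_ge0.
rewrite -mulmxA; apply: (le_trans (opnormM _ _)).
by rewrite -mulrA ler_wpM2l ?opnorm_ge0 // opnormM.
Qed.

Lemma opnormD m n (A B : 'M[R]_(m, n)) : opnorm (A + B) <= opnorm A + opnorm B.
Proof.
apply: opnorm_le => [|v]; first by rewrite addr_ge0 ?opnorm_ge0.
by rewrite mulmxDl mulrDl; apply: (le_trans (fnormD _ _)); rewrite lerD ?opnormM.
Qed.

Lemma opnormN m n (A : 'M[R]_(m, n)) : opnorm (- A) = opnorm A.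
Proof.
have h m' n' (B : 'M[R]_(m', n')) : opnorm (- B) <= opnorm B.
  by apply: opnorm_le => [|v]; rewrite ?opnorm_ge0 // mulNmx fnormN opnormM.
by apply/eqP; rewrite eq_le h -{1}(opprK A) h.
Qed.

Lemma opnorm_le_nf m n (A : 'M[R]_(m, n)) : opnorm A <= fnorm A.
Proof. by apply: opnorm_le => [|v]; rewrite ?fnorm_ge0 // fnorm_mul_le. Qed.

Lemma fnorm2_diag_mul m p (d : 'rV[R]_m) (V : 'M[R]_(m, p)) :
  fnorm2 (diag_mx d *m V) = \sum_i d 0 i ^+ 2 * fnorm2 (row i V).
Proof.
rewrite fnorm2_row; apply: eq_bigr => i _.
have -> : row i (diag_mx d *m V) = d 0 i *: row i V.
  by apply/rowP => j; rewrite mul_diag_mx !mxE.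
by rewrite /fnorm2 fdotZl fdotZr mulrA expr2.
Qed.

Lemma fnorm_diag_le m p (d : 'rV[R]_m) (V : 'M[R]_(m, p)) s :
  0 <= s -> (forall j, `|d 0 j| <= s) -> fnorm (diag_mx d *m V) <= s * fnorm V.
Proof.
move=> s0 h; rewrite fnorm_le // fnorm2_diag_mul fnorm2_row mulr_sumr.
apply: ler_sum => i _; apply: ler_wpM2r; first exact: fnorm2_ge0.
by rewrite -(real_normK (num_real _)) ler_pXn2r ?nnegrE.
Qed.

Lemma fnorm_diag_ge m p (d : 'rV[R]_m) (V : 'M[R]_(m, p)) s :
  0 <= s -> (forall j, s <= `|d 0 j|) -> s * fnorm V <= fnorm (diag_mx d *m V).
Proof.
move=> s0 h; rewrite -[leRHS]mul1r -(ger0_norm s0) -fnormZ fnorm_le // expr1n mul1r.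
rewrite fnorm2_diag_mul fnorm2_row; apply: ler_sum => i _.
rewrite linearZ /= /fnorm2 fdotZl fdotZr mulrA -/(fnorm2 _) -expr2.
apply: ler_wpM2r; first exact: fnorm2_ge0.
by rewrite -[leRHS](real_normK (num_real _)) ler_pXn2r ?nnegrE.
Qed.

Lemma fnorm_mulr_diag_ge m p (d : 'rV[R]_m) (V : 'M[R]_(p, m)) s :
  0 <= s -> (forall j, s <= `|d 0 j|) -> s * fnorm V <= fnorm (V *m diag_mx d).
Proof.
by move=> *; rewrite -[leRHS]fnorm_trmx trmx_mul tr_diag_mx -(fnorm_trmx V) fnorm_diag_ge.
Qed.

End FrobeniusNorm.

(** * Spectral theory of symmetric matrices *)

Section Spectral.
Variable R : realType.

Lemma trmxZ m n a (A : 'M[R]_(m, n)) : (a *: A)^T = a *: A^T.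
Proof. by apply/matrixP => i j; rewrite !mxE. Qed.

Lemma ker_exists m n (M : 'M[R]_(m, n)) : (m < n)%N ->
  exists2 v : 'cV[R]_n, v != 0 & M *m v = 0.
Proof.
move=> mn.
have : kermx M^T != 0.
  rewrite -mxrank_eq0 mxrank_ker -lt0n subn_gt0.
  exact: leq_ltn_trans (rank_leq_col _) mn.
case/rowV0Pn => v /sub_kermxP vM v0; exists v^T.
  by apply: contra v0 => /eqP/(congr1 trmx); rewrite trmxK trmx0 => ->.
by rewrite -[M]trmxK -trmx_mul vM trmx0.
Qed.

(* Otherwise the semidefinite matrix [(opnorm N ^+ 2)%:M - N *m N] is invertible,
   hence bounded below, and [opnorm N] is not the least bound. *)
Lemma opnorm_eigen n (N : 'M[R]_n) : (0 < n)%N -> N^T = N ->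
  exists (v : 'cV[R]_n) lam, [/\ v != 0, N *m v = lam *: v & `|lam| = opnorm N].
Proof.
move=> n0 symN; set s := opnorm N.
have s0 : 0 <= s := opnorm_ge0 N.
pose B := (s ^+ 2)%:M - N *m N.
have BE (v : 'cV_n) : B *m v = s ^+ 2 *: v - N *m (N *m v).
  by rewrite mulmxBl mul_scalar_mx mulmxA.
have symB : B^T = B by rewrite linearB /= tr_scalar_mx trmx_mul symN.
have qE (v : 'cV_n) : fdot v (B *m v) = s ^+ 2 * fnorm2 v - fnorm2 (N *m v).
  by rewrite BE fdotDr fdotNr fdotZr -{1}symN -fdot_mull.
have q0 (v : 'cV_n) : 0 <= fdot v (B *m v).
  by rewrite qE subr_ge0 -fnorm_le // opnormM.
have Bsing : B \notin unitmx.
  apply/negP => uB; pose c := opnorm (invmx B).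
  have key (v : 'cV_n) : fnorm2 v <= c ^+ 2 * (s ^+ 2 * fdot v (B *m v)).
    apply: (@le_trans _ _ (c ^+ 2 * fnorm2 (B *m v))).
      by rewrite -fnorm_le ?opnorm_ge0 // -{1}(mulKmx uB v) opnormM.
    apply: ler_wpM2l; first exact: sqr_ge0.
    have [sz|sN0] := eqVneq s 0.
      have : fnorm2 (N *m v) <= s ^+ 2 * fnorm2 v by rewrite -fnorm_le // opnormM.
      rewrite sz expr0n /= !mul0r => h.
      have /fnorm2_eq0 Nv0 : fnorm2 (N *m v) = 0 by apply/le_anti; rewrite h fnorm2_ge0.
      by rewrite BE Nv0 sz expr0n /= scale0r mulmx0 subr0 -(scale0r 0) /fnorm2 fdotZl mul0r.
    have sp : 0 < s ^+ 2 by rewrite exprn_gt0 // lt_neqAle eq_sym sN0.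
    set w := B *m v.
    (* Both [B] and [s ^+ 2 - B = N *m N] are semidefinite; testing [B] at [s ^+ 2 *: v - B *m v]
       gives |B v|^2 <= s^2 <v, B v>. *)
    have := q0 (s ^+ 2 *: v - w).
    rewrite mulmxBr -scalemxAr -/w !(fdotDl, fdotDr, fdotNl, fdotNr, fdotZl, fdotZr).
    have -> : fdot v (B *m w) = fnorm2 w by rewrite -{1}symB -fdot_mull.
    rewrite -/(fnorm2 w) (qE w) => h.
    have Nw := fnorm2_ge0 (N *m w).
    have : 0 <= s ^+ 2 * (s ^+ 2 * fdot v w - fnorm2 w).
      have -> : s ^+ 2 * (s ^+ 2 * fdot v w - fnorm2 w) =
        (s ^+ 2 * (s ^+ 2 * fdot v w) - s ^+ 2 * fnorm2 w - (s ^+ 2 * fnorm2 w - (s ^+ 2 * fnorm2 w - fnorm2 (N *m w)))) + fnorm2 (N *m w) by ring.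
      rewrite addr_ge0 //; move: h; lra.
    by rewrite pmulr_rge0 // subr_ge0.
  have [v v0] : exists v : 'cV[R]_n, v != 0.
    by have [v v0 _] := @ker_exists 0 n 0 n0; exists v.
  have sv : 0 < fnorm2 v by rewrite -fnorm_sqr exprn_gt0 // fnorm_gt0.
  pose k := c ^+ 2 * s ^+ 2.
  have k0 : 0 < k.
    have kge : 0 <= k by rewrite mulr_ge0 // sqr_ge0.
    rewrite lt_neqAle kge andbT; apply/eqP => kz.
    by have := key v; rewrite mulrA -/k -kz mul0r leNgt sv.
  have bnd (u : 'cV_n) : fnorm2 (N *m u) <= (s ^+ 2 - k^-1) * fnorm2 u.
    have := key u; rewrite mulrA -/k qE -ler_pdivrMl //; lra.
  have t0 : 0 <= s ^+ 2 - k^-1.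
    have := le_trans (fnorm2_ge0 _) (bnd v); by rewrite pmulr_lge0.
  have : s <= Num.sqrt (s ^+ 2 - k^-1).
    apply: opnorm_le => [|u]; first exact: sqrtr_ge0.
    by rewrite fnorm_le ?sqrtr_ge0 // sqr_sqrtr // bnd.
  rewrite -[X in X <= _](ger0_norm s0) -sqrtr_sqr ler_sqrt //.
  have := invr_gt0 k; rewrite k0 => /idP; lra.
have : kermx B != 0.
  rewrite -mxrank_eq0 mxrank_ker -lt0n subn_gt0 ltn_neqAle rank_leq_row andbT.
  by rewrite -/(row_free B) row_free_unit.
case/rowV0Pn => u /sub_kermxP uB u0; pose v := u^T.
have v0 : v != 0.
  by apply: contra u0 => /eqP/(congr1 trmx); rewrite trmxK trmx0 => ->.
have Bv : s ^+ 2 *: v - N *m (N *m v) = 0.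
  by rewrite -BE -[B]symB -trmx_mul uB trmx0.
move/eqP: Bv; rewrite subr_eq0 => /eqP Bv.
(* As (N - s)(N + s) v = 0, either [v] is an eigenvector for [- s] or (N + s) v is one for [s]. *)
have [w0|w0] := eqVneq (N *m v + s *: v) 0.
  exists v, (- s); split => //; last by rewrite normrN ger0_norm.
  by rewrite scaleNr; apply/eqP; rewrite -addr_eq0 w0.
exists (N *m v + s *: v), s; split => //; last by rewrite ger0_norm.
by rewrite mulmxDr -Bv -scalemxAr scalerDr scalerA addrC expr2.
Qed.

(** Induction on [m]: the compression [N] of [M] to the complement of the vectors already chosen
    attains its operator norm at an eigenvector, which is the next one. That norm bounds every
    eigenvalue left over. *)
Lemma top_eig_exists n (M : 'M[R]_n) m : M^T = M -> (m <= n)%N ->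
  exists (X : 'M[R]_(n, m)) d, top_eig M X d.
Proof.
move=> symM; elim: m => [|m IH] mn.
  exists 0, (fun _ => 0); split; last by move=> ? ? ? ? ? [].
  by split; apply/matrixP => i [].
have [X [d [[XX MX] topX]]] := IH (ltnW mn).
pose D := diag_mx (\row_j d j); rewrite -/D in MX.
pose Q := 1%:M - X *m X^T; pose N := Q *m M *m Q.
have symQ : Q^T = Q by rewrite linearB /= trmx1 trmx_mul trmxK.
have symN : N^T = N by rewrite !trmx_mul symQ symM mulmxA.
have XQ : X^T *m Q = 0 by rewrite mulmxBr mulmx1 mulmxA XX mul1mx subrr.
have Qv (v : 'cV_n) : X^T *m v = 0 -> Q *m v = v.
  by move=> h; rewrite mulmxBl mul1mx -mulmxA h mulmx0 subr0.
have XM : X^T *m M = D *m X^T.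
  by rewrite -[X^T *m M]trmxK trmx_mul trmxK symM MX trmx_mul tr_diag_mx.
have Nv (v : 'cV_n) : X^T *m v = 0 -> N *m v = M *m v.
  move=> h; rewrite -!mulmxA (Qv v h) Qv // mulmxA XM -mulmxA h mulmx0 //.
have [v [lam [v0 Mv Xv lamE]]] : exists (v : 'cV[R]_n) lam,
    [/\ v != 0, M *m v = lam *: v, X^T *m v = 0 & `|lam| = opnorm N].
  have [v [lam [v0 Nvl lamE]]] := opnorm_eigen (leq_ltn_trans (leq0n _) mn) symN.
  (* If [N] vanishes, any vector of the complement is an eigenvector of [M] for 0. Otherwise the
     eigenvalue is nonzero, which forces the eigenvector into the range of [Q]. *)
  have [oz|onz] := eqVneq (opnorm N) 0.
    have [u u0 Xu] := ker_exists X^T mn.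
    exists u, 0; rewrite normr0 oz; split => //.
    rewrite -Nv // scale0r; apply: fnorm_eq0; apply/le_anti; rewrite fnorm_ge0 andbT.
    by apply: (le_trans (opnormM _ _)); rewrite oz mul0r.
  have Xv : X^T *m v = 0.
    have l0 : lam != 0 by rewrite -normr_eq0 lamE.
    have -> : v = lam^-1 *: (N *m v) by rewrite Nvl scalerA mulVf // scale1r.
    by rewrite -scalemxAr /N !mulmxA XQ !mul0mx scaler0.
  by exists v, lam; split => //; rewrite -Nv.
pose w : 'cV[R]_n := (fnorm v)^-1 *: v.
have ww : w^T *m w = 1%:M.
  have -> : w^T *m w = ((fnorm v)^-1 * (fnorm v)^-1) *: (v^T *m v).
    by rewrite /w trmxZ -scalemxAl -scalemxAr scalerA.
  apply/rowP => j; rewrite !ord1 mxE [in RHS]mxE eqxx mulr1n.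
  have -> : (v^T *m v) 0 0 = fnorm v ^+ 2 by rewrite fnorm_sqr /fnorm2 fdot_tr /mxtrace big_ord1.
  by rewrite -expr2 -exprMn mulVf ?expr1n // gt_eqF // fnorm_gt0.
have Xw : X^T *m w = 0 by rewrite /w -scalemxAr Xv scaler0.
have wX : w^T *m X = 0 by rewrite -[_ *m _]trmxK trmx_mul trmxK Xw trmx0.
have Mw : M *m w = lam *: w by rewrite /w -scalemxAr Mv !scalerA mulrC.
exists (row_mx w X : 'M_(n, 1 + m)).
exists (fun j : 'I_(1 + m) => match split j with inl _ => lam | inr k => d k end).
split; first split.
- rewrite (@tr_row_mx _ n 1 m w X) (@mul_col_row _ 1 m n 1 m) ww XX Xw wX -scalar_mx_block //.
- rewrite (@mul_mx_row _ n n 1 m M w X) Mw MX.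
  set dd := \row_j _.
  have ddE : dd = row_mx (\row__ lam : 'rV_1) (\row_j d j).
    by apply/rowP => j; rewrite !mxE; case: (@split 1 m j) => k; rewrite mxE.
  have -> : diag_mx dd = block_mx (diag_mx (\row__ lam : 'rV_1)) 0 0 D.
    by rewrite ddE; exact: (@diag_mx_row _ m 1).
  rewrite (@mul_row_block _ n 1 m 1 m) !mulmx0 addr0 add0r.
  have -> // : w *m diag_mx (\row__ lam : 'rV_1) = lam *: w.
  by apply/colP => i; rewrite !mxE big_ord1 !mxE eqxx mulr1n mulrC.
- move=> u mu u0 Mu; rewrite (@tr_row_mx _ n 1 m w X) (@mul_col_mx _ 1 m n 1) -(@col_mx0 _ 1 m 1) => e j.
  have [_ Xu] := @eq_col_mx _ 1 m 1 _ _ _ _ e.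
  case: (@split 1 m j) => [_|k]; last exact: (topX u).
  have := opnormM N u; rewrite Nv // Mu fnormZ lamE ler_pM2r // fnorm_gt0 //.
Qed.

End Spectral.

(** * Perturbation of eigenvalues and of spectral projections *)

Section Perturbation.
Variable R : realType.

Definition proj n m (X : 'M[R]_(n, m)) : 'M[R]_n := X *m X^T.

Lemma proj_tr n m (X : 'M[R]_(n, m)) : (proj X)^T = proj X.
Proof. by rewrite trmx_mul trmxK. Qed.

Lemma compl_tr n m (X : 'M[R]_(n, m)) : (1%:M - proj X)^T = 1%:M - proj X.
Proof. by rewrite linearB /= trmx1 proj_tr. Qed.

Lemma mul_compl n m (X : 'M[R]_(n, m)) : X^T *m X = 1%:M ->
  X^T *m (1%:M - proj X) = 0.
Proof. by move=> XX; rewrite mulmxBr mulmx1 mulmxA XX mul1mx subrr. Qed.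

Lemma fnorm2_pyth n p (U V : 'M[R]_(n, p)) : fdot U V = 0 -> fnorm2 (U + V) = fnorm2 U + fnorm2 V.
Proof. by move=> h; rewrite /fnorm2 fdotDl !fdotDr (fdotC V) h addr0 add0r. Qed.

Lemma fnorm2_proj n m p (X : 'M[R]_(n, m)) (V : 'M[R]_(n, p)) : X^T *m X = 1%:M ->
  fnorm2 V = fnorm2 (X^T *m V) + fnorm2 ((1%:M - proj X) *m V).
Proof.
move=> XX; have -> : fnorm2 (X^T *m V) = fnorm2 (proj X *m V).
  by rewrite -!fnorm_sqr /proj -mulmxA (fnorm_isol _ XX).
rewrite -fnorm2_pyth; last first.
  by rewrite /proj -mulmxA fdot_mull mulmxA mul_compl // mul0mx -(scale0r 0) fdotZr mul0r.
by rewrite -mulmxDl [X in fnorm2 (X *m _)]addrC subrK mul1mx.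
Qed.

Lemma opnorm_compl n m (X : 'M[R]_(n, m)) : X^T *m X = 1%:M -> opnorm (1%:M - proj X) <= 1.
Proof.
move=> XX; apply: opnorm_le => // v; rewrite fnorm_le // expr1n mul1r (fnorm2_proj v XX).
by rewrite lerDr fnorm2_ge0.
Qed.

Lemma fnorm_delta n p (i : 'I_n) (j : 'I_p) : fnorm (delta_mx i j : 'M[R]_(n, p)) = 1.
Proof.
rewrite /fnorm /fnorm2 /fdot (bigD1 i) //= (bigD1 j) //= big1 => [|k kj]; last first.
  by rewrite !mxE (negbTE kj) andbF mul0r.
rewrite big1 => [|k ki]; last by apply: big1 => l _; rewrite !mxE (negbTE ki) mul0r.
by rewrite !mxE !eqxx mul1r !addr0 sqrtr1.
Qed.

Lemma fnorm_row_opn n m (E : 'M[R]_(n, m)) i : fnorm (row i E) <= opnorm E.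
Proof.
by rewrite rowE; apply: (le_trans (opnormMr _ _)); rewrite fnorm_delta mulr1.
Qed.

Lemma fnorm_row_proj n m (X : 'M[R]_(n, m)) i : X^T *m X = 1%:M ->
  fnorm (row i (proj X)) = fnorm (row i X).
Proof. by move=> XX; rewrite row_mul fnorm_isor. Qed.

Lemma fnorm_mul_proj n m p (X : 'M[R]_(n, m)) (U : 'M[R]_(p, n)) : X^T *m X = 1%:M ->
  fnorm (U *m proj X) = fnorm (U *m X).
Proof. by move=> XX; rewrite mulmxA fnorm_isor. Qed.

Lemma eig_tr n m (A : 'M[R]_n) (X : 'M[R]_(n, m)) d : A^T = A -> eigdecomp A X d ->
  X^T *m A = diag_mx (\row_j d j) *m X^T.
Proof.
by move=> sA [_ AX]; rewrite -[LHS]trmxK trmx_mul trmxK sA AX trmx_mul tr_diag_mx.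
Qed.

(** Here [t0] is the operator norm of the compression of [A] to the complement of [X]. Unless it is
    zero it is attained at an eigenvector of [A], and then the maximality in [top_eig] compares it
    with each [d j]. *)
Lemma top_eig_compl n m (A : 'M[R]_n) (X : 'M[R]_(n, m)) d :
  A^T = A -> top_eig A X d ->
  exists t0 : R, [/\ 0 <= t0,
    forall p (U : 'M[R]_(n, p)), X^T *m U = 0 -> fnorm (A *m U) <= t0 * fnorm U,
    forall j, t0 <= `|d j| &
    t0 = 0 \/ exists (v : 'cV[R]_n) lam,
      [/\ v != 0, A *m v = lam *: v, X^T *m v = 0 & `|lam| = t0] ].
Proof.
move=> sA [ed top]; have [XX AX] := ed.
pose Q := 1%:M - proj X; pose N := Q *m A *m Q.
have sN : N^T = N by rewrite !trmx_mul compl_tr sA mulmxA.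
have QU p (U : 'M_(n, p)) : X^T *m U = 0 -> Q *m U = U.
  by move=> h; rewrite mulmxBl mul1mx /proj -mulmxA h mulmx0 subr0.
have NU p (U : 'M_(n, p)) : X^T *m U = 0 -> N *m U = A *m U.
  move=> h; rewrite -!mulmxA (QU _ _ h) QU // mulmxA (eig_tr sA ed) -mulmxA h mulmx0 //.
have bnd p (U : 'M_(n, p)) : X^T *m U = 0 -> fnorm (A *m U) <= opnorm N * fnorm U.
  by move=> h; rewrite -NU // opnormM.
have [o0|on0] := eqVneq (opnorm N) 0.
  by exists 0; split => //; [move=> p U; rewrite -o0; exact: bnd | left].
have n0 : (0 < n)%N.
  rewrite lt0n; apply: contra on0 => /eqP n00.
  apply/eqP/le_anti; rewrite opnorm_ge0 andbT; apply: opnorm_le => // v.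
  have -> : N *m v = 0 by apply/colP => i; have := ltn_ord i; rewrite {2}n00.
  by rewrite fnorm0 mul0r.
have [v [lam [v0 Nv lamE]]] := opnorm_eigen n0 sN.
have Xv : X^T *m v = 0.
  have l0 : lam != 0 by rewrite -normr_eq0 lamE.
  have -> : v = lam^-1 *: (N *m v) by rewrite Nv scalerA mulVf // scale1r.
  by rewrite -scalemxAr /N !mulmxA mul_compl // !mul0mx scaler0.
have Av : A *m v = lam *: v by rewrite -NU.
exists (opnorm N); split => //; first exact: opnorm_ge0.
  by move=> j; rewrite -lamE; apply: (top v).
by right; exists v, lam.
Qed.

Section Weyl.
Variables (n m : nat) (Th E : 'M[R]_n) (X : 'M[R]_(n, m)) (d : 'I_m -> R) (sg t : R).
Hypothesis symTh : Th^T = Th.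
Hypothesis eTh : eigdecomp Th X d.
Hypothesis ThX : Th *m proj X = Th.
Hypothesis sg_le : forall j, sg <= `|d j|.
Hypothesis sg_ge0 : 0 <= sg.
Hypothesis symE : E^T = E.
Hypothesis opE : opnorm E <= t.
Variables (Xh : 'M[R]_(n, m)) (mu : 'I_m -> R).
Hypothesis topA : top_eig (Th + E) Xh mu.

Let symA : (Th + E)^T = Th + E.
Proof. by rewrite linearD /= symTh symE. Qed.

Let t_ge0 : 0 <= t := le_trans (opnorm_ge0 E) opE.

(* Otherwise the span of [Xh] and of an eigenvector of large eigenvalue has
   dimension [m + 1], so it meets the kernel of [Th], where [Th + E] is small. *)
Lemma weyl_compl p (U : 'M[R]_(n, p)) : Xh^T *m U = 0 -> fnorm ((Th + E) *m U) <= t * fnorm U.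
Proof.
have [t0 [t00 bnd mu_ge ev]] := top_eig_compl symA topA.
have [ed _] := topA; have [XX AX] := ed.
suff t0t : t0 <= t.
  by move=> /bnd h; apply: (le_trans h); rewrite ler_wpM2r ?fnorm_ge0.
case: ev => [->//|[v [lam [v0 Av Xv lamE]]]].
have [w w0 Zw] := @ker_exists R m (1 + m) (X^T *m row_mx v Xh) (ltnSn m).
pose u0 := v *m usubmx w; pose u1 := Xh *m dsubmx w.
pose u := u0 + u1.
have uE : u = row_mx v Xh *m w by rewrite -[X in _ *m X](vsubmxK w) mul_row_col.
have o01 : fdot u0 u1 = 0.
  rewrite fdotC fdot_mull mulmxA Xv mul0mx -(scale0r 0) fdotZr mul0r //.
have Thu : Th *m u = 0 by rewrite -ThX uE -!mulmxA (mulmxA X^T) Zw !mulmx0.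
have su : fnorm2 u = fnorm2 u0 + fnorm2 u1 by rewrite fnorm2_pyth.
have su1 : fnorm2 u1 = fnorm2 (dsubmx w) by rewrite -fnorm_sqr fnorm_isol // fnorm_sqr.
have Au0 : (Th + E) *m u0 = lam *: u0 by rewrite mulmxA Av -scalemxAl.
have Au1 : (Th + E) *m u1 = Xh *m (diag_mx (\row_j mu j) *m dsubmx w).
  by rewrite /u1 mulmxA AX -mulmxA.
have sAu : t0 ^+ 2 * fnorm2 u <= fnorm2 ((Th + E) *m u).
  rewrite mulmxDr Au0 Au1 [X in _ <= X]fnorm2_pyth; last first.
    by rewrite fdotZl /u0 fdotC fdot_mull mulmxA Xv mul0mx -(scale0r 0) fdotZr mul0r mulr0.
  rewrite su mulrDr; apply: lerD.
    by rewrite -[X in _ <= X]fnorm_sqr fnormZ lamE exprMn fnorm_sqr.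
  rewrite -[X in _ <= X]fnorm_sqr fnorm_isol // su1 -fnorm_sqr -exprMn.
  rewrite ler_pXn2r ?nnegrE ?mulr_ge0 ?fnorm_ge0 //.
  by apply: fnorm_diag_ge => // j; rewrite mxE.
have un0 : 0 < fnorm u.
  apply: fnorm_gt0; apply: contra w0 => /eqP uz.
  have su0 : fnorm2 u0 = 0 /\ fnorm2 u1 = 0.
    have := su; rewrite uz -(scale0r 0) {1}/fnorm2 fdotZl mul0r => /esym/eqP.
    by rewrite paddr_eq0 ?fnorm2_ge0 // => /andP[/eqP -> /eqP ->].
  case: su0 => /fnorm2_eq0 u00; rewrite su1 => /fnorm2_eq0 w1.
  have w00 : usubmx w = 0.
    apply: fnorm2_eq0; have /eqP : fnorm u0 ^+ 2 = 0 by rewrite u00 fnorm0 expr0n.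
    rewrite fnorm_sqr /u0; have -> : fnorm2 (v *m usubmx w) = fnorm2 v * fnorm2 (usubmx w).
      have -> : v *m usubmx w = (usubmx w) 0 0 *: v.
        by apply/colP => k; rewrite !mxE big_ord1 !mxE mulrC.
      rewrite /fnorm2 fdotZl fdotZr mulrA [RHS]mulrC; congr (_ * _).
      by rewrite /fdot !big_ord1.
    by rewrite mulf_eq0 -fnorm_sqr expf_eq0 /= gt_eqF ?fnorm_gt0 //= => /eqP.
  by rewrite -(vsubmxK w) w00 w1 col_mx0.
have : t0 * fnorm u <= t * fnorm u.
  apply: (@le_trans _ _ (fnorm ((Th + E) *m u))).
    rewrite -(ler_pXn2r (ltn0Sn 1)) ?nnegrE ?mulr_ge0 ?fnorm_ge0 //.
    by rewrite exprMn !fnorm_sqr.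
  rewrite mulmxDl Thu add0r; apply: (le_trans (opnormM _ _)).
  by rewrite ler_wpM2r ?fnorm_ge0.
by rewrite ler_pM2r.
Qed.

(* The range of [X] has a nonzero vector orthogonal to all columns of [Xh] but
   the [j]-th one. *)
Lemma weyl_lower j : sg - t <= `|mu j|.
Proof.
have [t0 [t00 bnd mu_ge _]] := top_eig_compl symA topA.
have [ed _] := topA; have [XX AX] := ed; have [XX0 TX] := eTh.
have [w w0 Bw] := @ker_exists R m.-1 m (row' j (Xh^T) *m X)
  ltac:(by case: (m) j => [[]|] //=).
pose u := X *m w; pose y := Xh^T *m u.
have nu : fnorm u = fnorm w by rewrite fnorm_isol.
have un0 : 0 < fnorm u by rewrite nu fnorm_gt0.
have yk k : k != j -> y k 0 = 0.
  case: (unliftP j k) => [k' -> _|-> /eqP//].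
  have /matrixP/(_ k' 0) := Bw; rewrite -mulmxA -/u [in X in _ = X]mxE => <-.
  by rewrite !mxE; apply: eq_bigr => l _; rewrite !mxE.
have lo : (sg - t) * fnorm u <= fnorm ((Th + E) *m u).
  have h1 : sg * fnorm u <= fnorm (Th *m u).
    rewrite nu mulmxA TX -mulmxA fnorm_isol //.
    by apply: fnorm_diag_ge => // k; rewrite mxE.
  have h2 : fnorm (E *m u) <= t * fnorm u.
    by apply: (le_trans (opnormM _ _)); rewrite ler_wpM2r ?fnorm_ge0.
  have := fnormB ((Th + E) *m u) (E *m u); rewrite -mulmxBl addrK mulrBl; lra.
(* Along [Xh], the vector [u] has only its [j]-th coordinate, which is multiplied by [mu j]; its
   other component is stretched by at most [t0], itself at most |mu j|. *)
have hi : fnorm ((Th + E) *m u) <= `|mu j| * fnorm u.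
  rewrite fnorm_le // (fnorm2_proj u XX) -/y mulrDr.
  set Q := 1%:M - _.
  have -> : (Th + E) *m u = Xh *m (diag_mx (\row_j mu j) *m y) + (Th + E) *m (Q *m u).
    rewrite mulmxA -AX -mulmxA -mulmxDr; congr (_ *m _).
    by rewrite mulmxA -mulmxDl addrC subrK mul1mx.
  rewrite fnorm2_pyth; last first.
    rewrite fdot_mull mulmxA (eig_tr symA ed) -mulmxA (mulmxA Xh^T) mul_compl //.
    by rewrite mul0mx mulmx0 -(scale0r 0) fdotZr mul0r.
  apply: lerD.
    rewrite -[X in X <= _]fnorm_sqr fnorm_isol // fnorm_sqr fnorm2_diag_mul fnorm2_row mulr_sumr.
    apply: ler_sum => k _; rewrite mxE.
    have [->|kj] := eqVneq k j; first by rewrite -normrX ger0_norm ?sqr_ge0.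
    have -> : row k y = 0 by apply/rowP => l; rewrite mxE [RHS]mxE ord1 yk.
    by rewrite -fnorm_sqr fnorm0 expr0n !mulr0.
  rewrite -fnorm_le //; apply: le_trans (bnd _ _ _) _.
    by rewrite mulmxA mul_compl // mul0mx.
  by rewrite ler_wpM2r ?fnorm_ge0.
by rewrite -(ler_pM2r un0); apply: le_trans lo hi.
Qed.

End Weyl.

(* Davis-Kahan: [Y = Qa Xb] solves the Sylvester equation [A Y - Y Db = Qa (A - B) Xb]. *)
Section DavisKahan.
Variables (n m : nat) (A B : 'M[R]_n) (Xa Xb : 'M[R]_(n, m)).
Variables (da db : 'I_m -> R) (s t : R).
Hypothesis symA : A^T = A.
Hypothesis eA : eigdecomp A Xa da.
Hypothesis eB : eigdecomp B Xb db.
Hypothesis compA : forall p (U : 'M[R]_(n, p)), Xa^T *m U = 0 -> fnorm (A *m U) <= t * fnorm U.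
Hypothesis s_le : forall j, s <= `|db j|.
Hypothesis s_gt0 : 0 < s.

Let Qa := 1%:M - proj Xa.
Let Y := Qa *m Xb.
Let D := diag_mx (\row_j db j).

Let sylv : Y *m D = A *m Y - Qa *m ((A - B) *m Xb).
Proof.
have [XXa AX] := eA; have [_ BX] := eB.
have QA : Qa *m A = A *m Qa.
  rewrite /Qa mulmxBl mulmxBr mul1mx mulmx1 /proj mulmxA AX -!mulmxA.
  by rewrite (eig_tr symA eA).
by rewrite (mulmxBl A B) (mulmxBr Qa) BX /Y !mulmxA QA opprB addrCA subrr addr0.
Qed.

Let XaY : Xa^T *m Y = 0.
Proof. by have [XXa _] := eA; rewrite mulmxA mul_compl // mul0mx. Qed.

Lemma dk_nf : (s - t) * fnorm Y <= fnorm ((A - B) *m Xb).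
Proof.
have [XXa AX] := eA.
have h1 : s * fnorm Y <= fnorm (Y *m D).
  by apply: fnorm_mulr_diag_ge => [|j]; rewrite ?mxE // ltW.
have := compA XaY.
have h2 : fnorm (Qa *m ((A - B) *m Xb)) <= fnorm ((A - B) *m Xb).
  apply: (le_trans (opnormM _ _)).
  by rewrite ler_piMl ?fnorm_ge0 // opnorm_compl.
have := fnormB (A *m Y) (Qa *m ((A - B) *m Xb)).
rewrite -sylv mulrBl; lra.
Qed.

(** The Frobenius version would lose the factor |X| = K when applied to E X; this one bounds the
    angle by |E| alone. The Sylvester equation is applied to vectors, after writing
    [v = D *m v']. *)
Lemma dk_opn : 0 <= t -> (s - t) * opnorm Y <= opnorm (A - B).
Proof.
move=> t0; have [XXa AX] := eA; have [XXb _] := eB.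
have h1 : s * opnorm Y <= t * opnorm Y + opnorm (A - B).
  have db0 j : db j != 0 by rewrite -normr_gt0 (lt_le_trans s_gt0).
  rewrite mulrC -ler_pdivlMr //; apply: opnorm_le => [|v].
    by rewrite divr_ge0 ?(ltW s_gt0) // addr_ge0 ?opnorm_ge0 // mulr_ge0 ?opnorm_ge0.
  pose v' := diag_mx (\row_j (db j)^-1) *m v.
  have vE : v = D *m v'.
    rewrite mulmxA mulmx_diag.
    have -> : (\row_j ((\row_j db j) 0 j * (\row_j (db j)^-1) 0 j)) = const_mx 1.
      by apply/rowP => j; rewrite !mxE divff.
    by rewrite diag_const_mx mul1mx.
  have v'v : fnorm v' <= s^-1 * fnorm v.
    apply: fnorm_diag_le => [|j]; first by rewrite invr_ge0 ltW.
    by rewrite mxE normfV lef_pV2 ?posrE ?normr_gt0.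
  have XaYv : Xa^T *m (Y *m v') = 0 by rewrite mulmxA XaY mul0mx.
  have e1 := compA XaYv.
  have e2 : fnorm (Y *m v') <= opnorm Y * fnorm v' := opnormM _ _.
  have e3 : fnorm (Qa *m ((A - B) *m Xb) *m v') <= opnorm (A - B) * fnorm v'.
    rewrite -mulmxA; apply: (le_trans (opnormM _ _)).
    apply: (@le_trans _ _ (fnorm ((A - B) *m Xb *m v'))).
      by rewrite ler_piMl ?fnorm_ge0 // opnorm_compl.
    by rewrite -mulmxA; apply: (le_trans (opnormM _ _)); rewrite fnorm_isol.
  have -> : Y *m v = A *m (Y *m v') - Qa *m ((A - B) *m Xb) *m v'.
    by rewrite vE (mulmxA Y) sylv mulmxBl (mulmxA A Y).
  apply: (le_trans (fnormB _ _)).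
  have e4 : t * fnorm (Y *m v') <= t * (opnorm Y * fnorm v') by rewrite ler_wpM2l.
  have : (t * opnorm Y + opnorm (A - B)) * fnorm v' <= (t * opnorm Y + opnorm (A - B)) * (s^-1 * fnorm v).
    by rewrite ler_wpM2l // addr_ge0 ?opnorm_ge0 // mulr_ge0 ?opnorm_ge0.
  rewrite [X in _ <= X -> _]mulrA; rewrite mulrDl; lra.
by rewrite mulrBl; lra.
Qed.

(** Both projections have rank [m], so the square equals 2 (m - |Xa^T Xb|^2), and the parenthesis is
    |Y|^2 by Pythagoras. *)
Lemma fnorm2_proj_diff : fnorm2 (proj Xa - proj Xb) = 2 * fnorm2 Y.
Proof.
have [XXa _] := eA; have [XXb _] := eB.
have sI (Z : 'M[R]_(n, m)) : Z^T *m Z = 1%:M -> fnorm2 Z = m%:R.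
  by move=> h; rewrite /fnorm2 fdot_tr h mxtrace1.
have sP (Z : 'M[R]_(n, m)) : Z^T *m Z = 1%:M -> fnorm2 (proj Z) = m%:R.
  by move=> h; rewrite -fnorm_sqr fnorm_isor // fnorm_sqr sI.
have cross : fdot (proj Xa) (proj Xb) = fnorm2 (Xa^T *m Xb).
  by rewrite /proj fdot_mull mulmxA -fdot_mulr.
have := fnorm2_proj Xb XXa; rewrite -/Qa -/Y sI // => h.
rewrite {1}/fnorm2 !(fdotDl, fdotDr, fdotNl, fdotNr) (fdotC (proj Xb)) -/(fnorm2 _) -/(fnorm2 _).
by rewrite !sP // cross h; ring.
Qed.

End DavisKahan.

End Perturbation.

(** * Leave-one-out row perturbation *)

Section LeaveOneOut.
Variable R : realType.

Lemma rowB n m (A B : 'M[R]_(n, m)) i : row i (A - B) = row i A - row i B.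
Proof. by apply/rowP => j; rewrite !mxE. Qed.

Lemma rowN n m (A : 'M[R]_(n, m)) i : row i (- A) = - row i A.
Proof. by apply/rowP => j; rewrite !mxE. Qed.

Definition loo n (i : 'I_n) (E : 'M[R]_n) : 'M[R]_n :=
  \matrix_(k, l) if (k == i) || (l == i) then 0 else E k l.

Definition maxrow n m (X : 'M[R]_(n, m)) : R := \big[Num.max/0]_k fnorm (row k X).

Lemma maxrow_ge n m (X : 'M[R]_(n, m)) k : fnorm (row k X) <= maxrow X.
Proof. exact: le_bigmax. Qed.

Lemma maxrow_ge0 n m (X : 'M[R]_(n, m)) : 0 <= maxrow X.
Proof. exact: bigmax_ge_id. Qed.

Lemma maxrow_le n m (X : 'M[R]_(n, m)) b :
  0 <= b -> (forall k, fnorm (row k X) <= b) -> maxrow X <= b.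
Proof. by move=> b0 h; apply/bigmax_leP; split. Qed.

Lemma loo_tr n (i : 'I_n) (E : 'M[R]_n) : E^T = E -> (loo i E)^T = loo i E.
Proof.
move=> sE; apply/matrixP => k l; rewrite !mxE orbC.
by rewrite -[in LHS]sE mxE.
Qed.

Lemma opnorm_loo n (i : 'I_n) (E : 'M[R]_n) : opnorm (loo i E) <= opnorm E.
Proof.
pose Z := diag_mx (\row_k (k != i)%:R : 'rV[R]_n).
have -> : loo i E = Z *m E *m Z.
  apply/matrixP => k l; rewrite mul_mx_diag mul_diag_mx !mxE.
  by case: (k == i); case: (l == i); rewrite ?mul0r ?mulr0 ?mul1r ?mulr1.
have Z1 : opnorm Z <= 1.
  by apply: opnorm_le => // v; apply: fnorm_diag_le => // j; rewrite mxE normr_nat; case: (_ == _).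
apply: (le_trans (opnorm_mul _ _)); rewrite -[leRHS]mulr1.
apply: ler_pM; rewrite ?opnorm_ge0 //.
by apply: (le_trans (opnorm_mul _ _)); rewrite ler_piMl ?opnorm_ge0.
Qed.

(** The difference consists of row [i], diagonal entry included, and of column [i] without it. The
    row part keeps the product [row i E *m Z], on which independence can act; the column part sees
    only row [i] of [Z]. *)
Lemma loo_diff n m (i : 'I_n) (E : 'M[R]_n) (Z : 'M[R]_(n, m)) :
  fnorm ((E - loo i E) *m Z) <= fnorm (row i E *m Z) + fnorm (col i E) * fnorm (row i Z).
Proof.
pose c : 'cV[R]_n := \col_k if k == i then 0 else E k i.
have -> : (E - loo i E) *m Z = delta_mx i 0 *m (row i E *m Z) + c *m row i Z.
  apply/matrixP => k j; rewrite !mxE !big_ord1 !mxE.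
  have [->|ki] := eqVneq k i.
    rewrite mul1r mul0r addr0; apply: eq_bigr => l _.
    by rewrite !mxE eqxx /= subr0.
  rewrite mul0r add0r (bigD1 i) //= !mxE eqxx orbT subr0 big1 ?addr0 // => l li.
  by rewrite !mxE (negbTE ki) (negbTE li) subrr mul0r.
apply: (le_trans (fnormD _ _)); apply: lerD.
  by apply: (le_trans (fnorm_mul_le _ _)); rewrite fnorm_delta mul1r.
apply: (le_trans (fnorm_mul_le _ _)); rewrite ler_wpM2r ?fnorm_ge0 //.
rewrite ler_sqrt ?fnorm2_ge0 //; apply: ler_sum => k _; apply: ler_sum => j _.
by rewrite !mxE; case: (_ == _); rewrite ?mul0r // -expr2 sqr_ge0.
Qed.

Variables (n m : nat) (Th E : 'M[R]_n) (X : 'M[R]_(n, m)) (d : 'I_m -> R) (sg t : R).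
Hypothesis symTh : Th^T = Th.
Hypothesis eTh : eigdecomp Th X d.
Hypothesis ThX : Th *m proj X = Th.
Hypothesis sg_le : forall j, sg <= `|d j|.
Hypothesis sg_gt0 : 0 < sg.
Hypothesis symE : E^T = E.
Hypothesis opE : opnorm E <= t.
Hypothesis t_small : t <= sg / 100.
Variables (Xh : 'M[R]_(n, m)) (mu : 'I_m -> R).
Hypothesis topA : top_eig (Th + E) Xh mu.
Variables (Xb : 'I_n -> 'M[R]_(n, m)) (mub : 'I_n -> 'I_m -> R).
Hypothesis topB : forall i, top_eig (Th + loo i E) (Xb i) (mub i).
Variables (a m0 : R).
Hypothesis a_ge0 : 0 <= a.
Hypothesis row_le : forall i, fnorm (row i X) <= m0.
(** Together with [opE], the form in which the randomness of the noise enters: the Chernoff bound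
    for row [i] against a basis independent of it. *)
Hypothesis noise_le : forall i, fnorm (row i E *m Xb i) <= a + t * maxrow (Xb i).

Let t_ge0 : 0 <= t := le_trans (opnorm_ge0 E) opE.
Let symA : (Th + E)^T = Th + E.
Proof. by rewrite linearD /= symTh symE. Qed.
Let XX : X^T *m X = 1%:M. Proof. by case: eTh. Qed.
Let XXh : Xh^T *m Xh = 1%:M. Proof. by case: topA => -[]. Qed.
Let XXb i : (Xb i)^T *m Xb i = 1%:M. Proof. by case: (topB i) => -[]. Qed.
Let sgt : 99 / 100 * sg <= sg - t.
Proof. by move: t_small; lra. Qed.
Let mu_ge j : 99 / 100 * sg <= `|mu j|.
Proof.
exact: le_trans sgt (weyl_lower symTh eTh sg_le (ltW sg_gt0) symE opE topA j).
Qed.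

(** The gap in [dk_nf] is at least 98/100 sg; the factor sqrt 2 between [Y] and the difference of
    projections is rounded up to 3/2, and 3/2 * 100/98 to 8/5. *)
Let dist_loo i : sg * fnorm (proj Xh - proj (Xb i)) <= 8 / 5 * (a + 2 * t * maxrow (Xb i)).
Proof.
have eA : eigdecomp (Th + E) Xh mu by case: topA.
have eB : eigdecomp (Th + loo i E) (Xb i) (mub i) by case: (topB i).
have mub_ge j : 99 / 100 * sg <= `|mub i j|.
  apply: le_trans sgt _.
  apply: (weyl_lower symTh eTh sg_le (ltW sg_gt0) (loo_tr i symE) _ (topB i)).
  exact: le_trans (opnorm_loo _ _) opE.
have s0 : 0 < 99 / 100 * sg by move: sg_gt0; lra.
have cA := @weyl_compl _ _ _ _ _ _ _ symTh ThX symE opE _ _ topA.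
have h := dk_nf symA eA eB cA mub_ge s0.
have h2 : fnorm ((Th + E - (Th + loo i E)) *m Xb i) <= a + 2 * t * maxrow (Xb i).
  rewrite opprD addrACA subrr add0r; apply: le_trans (loo_diff _ _ _) _.
  have h3 : fnorm (col i E) * fnorm (row i (Xb i)) <= t * maxrow (Xb i).
    apply: ler_pM; rewrite ?fnorm_ge0 ?maxrow_ge //.
    by rewrite -fnorm_trmx tr_col symE; apply: le_trans (fnorm_row_opn _ _) opE.
  by have := noise_le i; move: h3; rewrite -mulrA; lra.
set Y := (1%:M - proj Xh) *m Xb i in h *.
have Y0 : 0 <= fnorm Y := fnorm_ge0 _.
have d2 : fnorm (proj Xh - proj (Xb i)) <= 3 / 2 * fnorm Y.
  rewrite fnorm_le ?divr_ge0 // (fnorm2_proj_diff eA eB).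
  by rewrite ler_wpM2r ?fnorm2_ge0 //; lra.
have h5 : 98 / 100 * sg * fnorm Y <= a + 2 * t * maxrow (Xb i).
  apply: le_trans h2; apply: le_trans h; rewrite ler_wpM2r //.
  by move: t_small; lra.
have h6 : sg * fnorm (proj Xh - proj (Xb i)) <= sg * (3 / 2 * fnorm Y).
  by rewrite ler_wpM2l // ltW.
have p0 : 0 <= a + 2 * t * maxrow (Xb i).
  by rewrite addr_ge0 // !mulr_ge0 // maxrow_ge0.
move: h5 h6 p0; set u := sg * fnorm Y; set w := a + _.
have -> : 98 / 100 * sg * fnorm Y = 98 / 100 * u by rewrite /u; ring.
have -> : sg * (3 / 2 * fnorm Y) = 3 / 2 * u by rewrite /u; ring.
lra.
Qed.

(** The two terms that begin with [proj X] inherit its row norm [m0], each at the price of [t]; the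
    remaining one, [E *m Gh], is the noise row, since [Gh] is at most 1 / s on the range of [Xh]. *)
Let row_diff i : 99 / 100 * sg * fnorm (row i (proj Xh - proj X)) <=
  2 * t * m0 + fnorm (row i E *m proj Xh).
Proof.
have eA : eigdecomp (Th + E) Xh mu by case: topA.
have m00 : 0 <= m0 := le_trans (fnorm_ge0 _) (row_le i).
set s := 99 / 100 * sg; have s0 : 0 < s by rewrite /s; move: sg_gt0; lra.
pose Q := 1%:M - proj X; pose Qh := 1%:M - proj Xh.
pose Dh := diag_mx (\row_j (mu j)^-1).
pose Gh := Xh *m Dh *m Xh^T.
have mu0 j : mu j != 0 by rewrite -normr_gt0 (lt_le_trans _ (mu_ge j)).
have [_ AX] := eA.
have PhE : proj Xh = (Th + E) *m Gh.
  rewrite /Gh !mulmxA AX -(mulmxA Xh) mulmx_diag.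
  have -> : (\row_j ((\row_j mu j) 0 j * (\row_j (mu j)^-1) 0 j)) = const_mx 1 :> 'rV[R]_m.
    by apply/rowP => j; rewrite !mxE divff.
  by rewrite diag_const_mx mulmx1.
have QTh : Q *m Th = 0.
  have := congr1 trmx ThX; rewrite trmx_mul proj_tr symTh => h.
  by rewrite mulmxBl mul1mx h subrr.
have QPh : Q *m proj Xh = E *m Gh - proj X *m (E *m Gh).
  by rewrite PhE mulmxA mulmxDr QTh add0r -mulmxA mulmxBl mul1mx.
have dec : proj Xh - proj X = (E *m Gh - proj X *m (E *m Gh)) - proj X *m Qh.
  by rewrite -QPh /Q /Qh mulmxBl mulmxBr mul1mx mulmx1 opprB addrA subrK.
have Gh_le p (U : 'M[R]_(p, n)) : s * fnorm (U *m Gh) <= fnorm (U *m Xh).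
  rewrite /Gh !mulmxA fnorm_isor // -[X in s * X]fnorm_trmx trmx_mul tr_diag_mx.
  rewrite -ler_pdivlMl // -(fnorm_trmx (U *m Xh)); apply: fnorm_diag_le => [|j].
    by rewrite invr_ge0 ltW.
  by rewrite mxE normfV lef_pV2 ?posrE ?normr_gt0 // mu_ge.
have p1 : s * fnorm (row i (E *m Gh)) <= fnorm (row i E *m proj Xh).
  by rewrite row_mul fnorm_mul_proj // Gh_le.
have p2 : s * fnorm (row i (proj X *m (E *m Gh))) <= t * m0.
  rewrite mulmxA row_mul; apply: (le_trans (Gh_le _ _)).
  rewrite -fnorm_mul_proj //; apply: (le_trans (opnormMr _ _)).
  apply: (@le_trans _ _ (1 * fnorm (row i (proj X *m E)))).
    rewrite ler_wpM2r ?fnorm_ge0 //; apply: opnorm_le => // v.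
    rewrite /proj -mulmxA fnorm_isol // fnorm_le // expr1n mul1r (fnorm2_proj v XXh).
    by rewrite lerDl fnorm2_ge0.
  rewrite mul1r row_mul; apply: (le_trans (opnormMr _ _)).
  by apply: ler_pM; rewrite ?opnorm_ge0 ?fnorm_ge0 // fnorm_row_proj.
have p3 : s * fnorm (row i (proj X *m Qh)) <= t * m0.
  rewrite row_mul row_mul -mulmxA.
  have -> : X^T *m Qh = (Qh *m X)^T by rewrite trmx_mul compl_tr.
  have cA := @weyl_compl _ _ _ _ _ _ _ symTh ThX symE opE _ _ topA.
  have := dk_opn symA eA eTh cA sg_le sg_gt0 t_ge0.
  rewrite addrAC subrr add0r -/Qh => h.
  have h' : s * opnorm (Qh *m X) <= t.
    by apply: le_trans opE; apply: le_trans h; rewrite ler_wpM2r ?opnorm_ge0.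
  apply: (@le_trans _ _ (s * (opnorm (Qh *m X) * m0))).
    rewrite ler_wpM2l ?(ltW s0) //; apply: (le_trans (opnormMr _ _)).
    by rewrite opnorm_tr ler_wpM2l ?opnorm_ge0.
  by rewrite mulrA ler_wpM2r.
rewrite dec rowB rowB.
apply: (@le_trans _ _ (s * (fnorm (row i (E *m Gh)) + fnorm (row i (proj X *m (E *m Gh)))
   + fnorm (row i (proj X *m Qh))))).
  rewrite ler_wpM2l ?(ltW s0) //; apply: (le_trans (fnormB _ _)).
  by rewrite lerD2r fnormB.
by rewrite !mulrDr; lra.
Qed.

Let noise_row i : fnorm (row i E *m proj Xh) <=
  a + t * maxrow (Xb i) + t * fnorm (proj Xh - proj (Xb i)).
Proof.
have -> : row i E *m proj Xh = row i E *m proj (Xb i) + row i E *m (proj Xh - proj (Xb i)).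
  by rewrite -mulmxDr addrC subrK.
apply: (le_trans (fnormD _ _)); apply: lerD; first by rewrite fnorm_mul_proj.
apply: (le_trans (fnorm_mul_le _ _)); rewrite ler_wpM2r ?fnorm_ge0 //.
exact: le_trans (fnorm_row_opn _ _) opE.
Qed.

(* [maxrow (Xb i)] is bounded through [maxrow Xh], and [maxrow Xh] through
   [row_diff]: the loop closes because [t / sg] is small. *)
Theorem row_perturbation i : sg * fnorm (row i (proj Xh - proj X)) <= 4 * (t * m0 + a).
Proof.
set M := maxrow Xh.
have m00 : 0 <= m0 := le_trans (fnorm_ge0 _) (row_le i).
have M0 : 0 <= M := maxrow_ge0 _.
pose r := t / sg.
have r0 : 0 <= r by rewrite divr_ge0 // ltW.
have r1 : r <= 1 / 100 by rewrite ler_pdivrMr //; move: t_small; lra.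
have tE : t = r * sg by rewrite mulfVK // gt_eqF.
have rmul x : 0 <= x -> r * x <= x / 100.
  by move=> x0; rewrite [X in _ <= X]mulrC ler_wpM2r //; lra.
(* [maxrow (Xb k)] returns on the right through [dist_loo], with coefficient at most 16/500, and is
   absorbed. *)
have looM k : t * maxrow (Xb k) <= 26 / 25 * (t * M) + a / 50.
  set Mk := maxrow (Xb k); have Mk0 : 0 <= Mk := maxrow_ge0 _.
  set dk := fnorm (proj Xh - proj (Xb k)).
  have dk0 : 0 <= dk := fnorm_ge0 _.
  have h1 : Mk <= M + dk.
    apply: maxrow_le => [|l]; first by rewrite addr_ge0.
    rewrite -fnorm_row_proj //; apply: (le_trans (fnorm_dist _ (row l (proj Xh)))).
    apply: lerD; first by rewrite fnorm_row_proj // maxrow_ge.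
    by rewrite -rowB -fnormN -rowN opprB fnorm_row_le.
  have h2 : sg * dk <= 8 / 5 * (a + 2 * t * Mk) := dist_loo k.
  have h3 : t * Mk <= t * M + t * dk by rewrite -mulrDr ler_wpM2l.
  have h4 : t * dk <= r * (8 / 5 * (a + 2 * t * Mk)).
    by rewrite tE -mulrA ler_wpM2l // -tE.
  have h5 : r * (8 / 5 * (a + 2 * t * Mk)) <= 8 / 5 * (a + 2 * t * Mk) / 100.
    by rewrite rmul //; have := mulr_ge0 t_ge0 Mk0; move: a_ge0; lra.
  have e : 2 * t * Mk = 2 * (t * Mk) by rewrite mulrA.
  rewrite e in h5 h4; move: h3 h4 h5 a_ge0.
  have := mulr_ge0 t_ge0 M0.
  set x := t * Mk; set y := t * M; set z := t * dk; set w := r * _; lra.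
have noiseM k : fnorm (row k E *m proj Xh) <= 11 / 10 * a + 11 / 10 * (t * M).
  have h1 := noise_row k; have h2 := looM k; have h3 := dist_loo k.
  have h4 : t * fnorm (proj Xh - proj (Xb k)) <=
            8 / 5 * (a + 2 * t * maxrow (Xb k)) / 100.
    have h4 : t * fnorm (proj Xh - proj (Xb k)) <= r * (8 / 5 * (a + 2 * t * maxrow (Xb k))).
      by rewrite tE -mulrA ler_wpM2l // -tE.
    apply: (le_trans h4); rewrite rmul //.
    by have := mulr_ge0 t_ge0 (maxrow_ge0 (Xb k)); move: a_ge0; lra.
  move: h1 h2 h4; rewrite -(mulrA 2); have := mulr_ge0 t_ge0 M0; move: a_ge0.
  set x := t * maxrow _; set y := t * M; set z := t * fnorm _; lra.
have rowM k : 99 / 100 * sg * fnorm (row k (proj Xh - proj X)) <=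
    2 * (t * m0) + 11 / 10 * a + 11 / 10 * (t * M).
  by have := row_diff k; have := noiseM k; rewrite -(mulrA 2); lra.
(* By [rowM], [M] reappears with coefficient at most 11/10 * 1/99, and is absorbed in the same
   way. *)
have tM : t * M <= 6 / 5 * (t * m0) + a / 50.
  set b := 2 * (t * m0) + 11 / 10 * a + 11 / 10 * (t * M).
  have b0 : 0 <= b.
    by rewrite /b; move: a_ge0 (mulr_ge0 t_ge0 M0) (mulr_ge0 t_ge0 m00); lra.
  have h : M <= m0 + (99 / 100 * sg)^-1 * b.
    have s0 : 0 < 99 / 100 * sg by move: sg_gt0; lra.
    apply: maxrow_le => [|k].
      by rewrite addr_ge0 // mulr_ge0 // invr_ge0 ltW.
    rewrite -fnorm_row_proj //; apply: (le_trans (fnorm_dist _ (row k (proj X)))).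
    apply: lerD; first by rewrite fnorm_row_proj.
    by rewrite -rowB ler_pdivlMl //; exact: rowM.
  have h2 : t * M <= t * m0 + 100 / 99 * (r * b).
    apply: le_trans (ler_wpM2l t_ge0 h) _; rewrite mulrDr lerD2l.
    rewrite le_eqVlt; apply/orP; left; apply/eqP; rewrite /r; field.
    by rewrite gt_eqF.
  have h3 := rmul _ b0.
  move: h2 h3; rewrite /b; move: a_ge0 (mulr_ge0 t_ge0 M0) (mulr_ge0 t_ge0 m00).
  set x := t * M; set y := t * m0; set z := r * _; lra.
have := rowM i; move: tM; set z := fnorm _ => tM.
have -> : 99 / 100 * sg * z = 99 / 100 * (sg * z) by rewrite mulrA.
move: a_ge0 tM (mulr_ge0 t_ge0 m00); lra.
Qed.

End LeaveOneOut.

(** * From eigenvectors to clusters *)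

Section Cosine.
Variable R : realType.

Lemma dotr_ip m (x y : 'rV[R]_m) : dotr x y = fdot x y.
Proof. by rewrite /fdot big_ord1. Qed.

Lemma cosrE m (x y : 'rV[R]_m) : cosr x y = fdot x y / (fnorm x * fnorm y).
Proof. by rewrite /cosr /vnorm !dotr_ip. Qed.

Lemma fdot_row_proj n m (X : 'M[R]_(n, m)) i j : X^T *m X = 1%:M ->
  fdot (row i (proj X)) (row j (proj X)) = fdot (row i X) (row j X).
Proof. by move=> XX; rewrite !row_mul fdot_mulr -!mulmxA trmxK XX mulmx1. Qed.

(** This removes the choice of an eigenbasis: no rotation aligning [Xh] with [X] is ever needed. *)
Lemma cosr_proj n m (X : 'M[R]_(n, m)) i j : X^T *m X = 1%:M ->
  cosr (row i (proj X)) (row j (proj X)) = cosr (row i X) (row j X).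
Proof. by move=> XX; rewrite !cosrE fdot_row_proj // !fnorm_row_proj. Qed.

Lemma proj_entry n m (X : 'M[R]_(n, m)) i j : proj X i j = fdot (row i X) (row j X).
Proof. by rewrite mxE -dotr_ip; apply: eq_bigr => k _; rewrite !mxE. Qed.

Lemma fnorm_normalize m (x : 'rV[R]_m) : x != 0 -> fnorm ((fnorm x)^-1 *: x) = 1.
Proof.
by move=> x0; rewrite fnormZ ger0_norm ?invr_ge0 ?fnorm_ge0 // mulVf // gt_eqF ?fnorm_gt0.
Qed.

Lemma normalize_perturb m (x x' : 'rV[R]_m) e : x != 0 -> e < 1 ->
  fnorm (x' - x) <= e * fnorm x ->
  x' != 0 /\ fnorm ((fnorm x')^-1 *: x' - (fnorm x)^-1 *: x) <= 2 * e.
Proof.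
move=> x0 e1 h; have px := fnorm_gt0 x0.
have x'0 : x' != 0.
  apply/eqP => x'0; move: h; rewrite x'0 sub0r fnormN.
  by rewrite leNgt -{2}(mul1r (fnorm x)) ltr_pM2r // e1.
split=> //; have px' := fnorm_gt0 x'0.
have -> : (fnorm x')^-1 *: x' - (fnorm x)^-1 *: x =
  (fnorm x)^-1 *: (x' - x) + ((fnorm x')^-1 - (fnorm x)^-1) *: x'.
  by rewrite scalerBr scalerBl [RHS]addrC addrA subrK.
apply: (le_trans (fnormD _ _)); rewrite !fnormZ.
have -> : `|(fnorm x')^-1 - (fnorm x)^-1| * fnorm x' = `|fnorm x - fnorm x'| * (fnorm x)^-1.
  have -> : (fnorm x')^-1 - (fnorm x)^-1 = (fnorm x - fnorm x') * ((fnorm x)^-1 * (fnorm x')^-1).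
    by field; rewrite !gt_eqF.
  rewrite normrM (ger0_norm (_ : 0 <= _ * _)) ?mulr_ge0 ?invr_ge0 ?ltW //.
  by rewrite !mulrA mulfVK // gt_eqF.
rewrite ger0_norm ?invr_ge0 ?(ltW px) // [X in X + _]mulrC -mulrDl ler_pdivrMr //.
have a1 := fnorm_dist x x'; have a2 := fnorm_dist x' x.
have a3 : fnorm (x - x') = fnorm (x' - x) by rewrite -fnormN opprB.
have : `|fnorm x - fnorm x'| <= fnorm (x' - x) by rewrite ler_norml; apply/andP; split; lra.
lra.
Qed.

(** Normalising a vector doubles its relative error, and there are two vectors. The bound [e < 1]
    keeps the perturbed vectors nonzero, so that the value of a division by 0 never matters. *)
Lemma cosr_perturb m (x y x' y' : 'rV[R]_m) e : x != 0 -> y != 0 -> e < 1 ->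
  fnorm (x' - x) <= e * fnorm x -> fnorm (y' - y) <= e * fnorm y ->
  `|cosr x' y' - cosr x y| <= 4 * e.
Proof.
move=> x0 y0 e1 hx hy.
have [x'0 ux] := normalize_perturb x0 e1 hx.
have [y'0 uy] := normalize_perturb y0 e1 hy.
have cE (a b : 'rV[R]_m) : cosr a b = fdot ((fnorm a)^-1 *: a) ((fnorm b)^-1 *: b).
  by rewrite cosrE fdotZl fdotZr mulrA -invfM mulrC.
rewrite !cE; set u' := _ *: x'; set v' := _ *: y'; set u := _ *: x; set v := _ *: y.
have -> : fdot u' v' - fdot u v = fdot (u' - u) v' + fdot u (v' - v).
  by rewrite fdotDl fdotNl fdotDr fdotNr addrA subrK.
apply: (le_trans (ler_normD _ _)).
have := normr_ip_le (u' - u) v'; have := normr_ip_le u (v' - v).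
have -> : fnorm v' = 1 by exact: fnorm_normalize.
have -> : fnorm u = 1 by exact: fnorm_normalize.
rewrite mul1r mulr1; move: ux uy; lra.
Qed.

End Cosine.

(** * Approximate k-means and the misclustering loss *)

Section KMeans.
Variables (R : realType) (n K : nat).

Lemma mean_min (I : finType) (P : pred I) (a : I -> R) (nu : R) :
  \sum_(i | P i) (a i - (#|P|%:R)^-1 * \sum_(k | P k) a k) ^+ 2 <=
  \sum_(i | P i) (a i - nu) ^+ 2.
Proof.
set m := _^-1 * _; have [/eqP P0|P0] := boolP (#|P| == 0)%N.
  by rewrite !big_pred0 // => i; apply/negbTE; have := card0_eq P0 i; rewrite -topredE /= => ->.
have sm : \sum_(i | P i) (a i - m) = 0.
  rewrite sumrB sumr_const -mulr_natl /m mulrA divff ?mul1r ?subrr //.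
  by rewrite pnatr_eq0.
have -> : \sum_(i | P i) (a i - nu) ^+ 2 =
  \sum_(i | P i) (a i - m) ^+ 2 + (m - nu) *+ 2 * \sum_(i | P i) (a i - m)
  + \sum_(i | P i) (m - nu) ^+ 2.
  rewrite mulr_sumr -!big_split /=; apply: eq_bigr => i _; ring.
by rewrite sm mulr0 addr0 lerDl sumr_ge0 // => i _; rewrite sqr_ge0.
Qed.

Definition centroid (V : 'I_n -> 'rV[R]_n) (c : 'I_n -> 'I_K) k : 'rV[R]_n :=
  \row_j ((#|[pred i | c i == k]|%:R)^-1 * \sum_(i | c i == k) V i 0 j).

Lemma fnorm2_subE (x y : 'rV[R]_n) : fnorm2 (x - y) = \sum_j (x 0 j - y 0 j) ^+ 2.
Proof.
by rewrite /fnorm2 /fdot big_ord1; apply: eq_bigr => j _; rewrite !mxE expr2.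
Qed.

Lemma clcost_ge (V : 'I_n -> 'rV[R]_n) (c : 'I_n -> 'I_K) k :
  \sum_(i | c i == k) fnorm2 (V i - centroid V c k) <= clcost V c k.
Proof.
apply: lb_le_inf; first by eexists; exists 0.
move=> _ [nu ->]; under eq_bigr do rewrite fnorm2_subE.
rewrite exchange_big [X in _ <= X]exchange_big; apply: ler_sum => j _.
under eq_bigr do rewrite mxE.
exact: (@mean_min _ [pred i | c i == k] (fun i => V i 0 j)).
Qed.

Lemma clcost_le (V : 'I_n -> 'rV[R]_n) (c : 'I_n -> 'I_K) k nu :
  clcost V c k <= \sum_(i | c i == k) fnorm2 (V i - nu).
Proof.
apply: ge_inf; last by exists nu; under eq_bigr do rewrite fnorm2_subE.
by exists 0 => _ [x ->]; do 2![apply: sumr_ge0 => ? _]; rewrite sqr_ge0.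
Qed.

Lemma sum_cluster (c : 'I_n -> 'I_K) (F : 'I_n -> 'I_K -> R) :
  \sum_k \sum_(i | c i == k) F i k = \sum_i F i (c i).
Proof.
rewrite (exchange_big_dep xpredT) //=; apply: eq_bigr => i _.
by rewrite (big_pred1 (c i)) // => k; rewrite /= eq_sym.
Qed.

Definition comm_row (c : 'I_n -> 'I_K) (i : 'I_n) : 'rV[R]_n := \row_j (c j == c i)%:R.

(** The true partition with community indicators as centres competes in the minimum on the right; on
    the left the centroids minimise each cluster cost. *)
Lemma kmeans_approx_le (V : 'I_n -> 'rV[R]_n) (cs ch : 'I_n -> 'I_K) eps : 0 <= eps ->
  kmeans_approx eps V ch ->
  \sum_i fnorm2 (V i - centroid V ch (ch i)) <=
    (1 + eps) * \sum_i fnorm2 (V i - comm_row cs i).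
Proof.
move=> e0 h; have kge c : \sum_i fnorm2 (V i - centroid V c (c i)) <= kobj V c.
  rewrite -(sum_cluster c (fun i k => fnorm2 (V i - centroid V c k))).
  by apply: ler_sum => k _; exact: clcost_ge.
apply: le_trans (kge ch) _; apply: le_trans h _; apply: ler_wpM2l; first lra.
apply: (@le_trans _ _ (kobj V cs)).
  apply: ge_inf; last by exists cs.
  exists 0 => _ [c ->]; apply: le_trans (kge c).
  by apply: sumr_ge0 => i _; exact: fnorm2_ge0.
rewrite -(sum_cluster cs (fun i k => fnorm2 (V i - \row_j (cs j == k)%:R))).
by apply: ler_sum => k _; exact: clcost_le.
Qed.

Lemma comm_row_sep (cs : 'I_n -> 'I_K) i j : cs i != cs j ->
  fnorm2 (comm_row cs i - comm_row cs j) = (nk cs (cs i))%:R + (nk cs (cs j))%:R.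
Proof.
move=> ij; rewrite fnorm2_subE.
have nkE k : (nk cs k)%:R = \sum_l (cs l == k)%:R :> R.
  by rewrite /nk -sum1_card big_mkcond /= natr_sum; apply: eq_bigr => l _; rewrite inE; case: ifP.
rewrite !nkE -big_split /=; apply: eq_bigr => l _; rewrite !mxE.
have [->|li] := eqVneq (cs l) (cs i).
  by rewrite (negbTE ij) subr0 expr1n addr0.
by case: (_ == _); rewrite ?subrr ?sub0r ?sqrrN ?expr1n ?expr0n ?add0r ?addr0.
Qed.

Lemma fnorm2_mid (x y z : 'rV[R]_n) : fnorm2 (x - y) <= 2 * fnorm2 (x - z) + 2 * fnorm2 (y - z).
Proof.
have h := fnorm2_ge0 ((x - z) + (y - z)).
have e : x - y = (x - z) - (y - z) by rewrite opprB addrA subrK.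
rewrite e; move: h; rewrite /fnorm2 !(fdotDl, fdotDr, fdotNl, fdotNr).
rewrite (fdotC z x) (fdotC y x) (fdotC z y); lra.
Qed.

Lemma sum_indicator_le (I : finType) (F : I -> R) b : (forall i, 0 <= F i) ->
  #|[set i | b <= F i]|%:R * b <= \sum_i F i.
Proof.
move=> F0; rewrite -sum1_card natr_sum mulr_suml.
rewrite [X in _ <= X](bigID (mem [set i | b <= F i])) /=.
rewrite -[X in X <= _]addr0; apply: lerD; last by apply: sumr_ge0.
by apply: ler_sum => i; rewrite inE mul1r.
Qed.

(** Every community exceeds [S], hence has a representative outside [S]. The labels that [ch] gives
    to the representatives are distinct, so they form a permutation, whose inverse is [pi]. *)
Lemma relabel (cs ch : 'I_n -> 'I_K) (S : {set 'I_n}) :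
  (forall i j, i \notin S -> j \notin S -> ch i = ch j -> cs i = cs j) ->
  (forall k, (#|S| < nk cs k)%N) ->
  exists pi : {perm 'I_K}, forall i, i \notin S -> cs i = pi (ch i).
Proof.
move=> inj big; have rep k : exists i, (i \notin S) && (cs i == k).
  have : ~~ ([set i | cs i == k] \subset S).
    by apply/negP => /subset_leq_card; rewrite leqNgt big.
  by case/subsetPn => i; rewrite inE => ik iS; exists i; rewrite iS.
pose r k := xchoose (rep k).
have rS k : r k \notin S by have /andP[] := xchooseP (rep k).
have rk k : cs (r k) = k by have /andP[_ /eqP] := xchooseP (rep k).
have sinj : injective (fun k => ch (r k)).
  by move=> k l /(inj _ _ (rS k) (rS l)); rewrite !rk.
pose s := perm sinj; exists (s^-1)%g => i iS.
have e : ch (r (s^-1%g (ch i))) = ch i by rewrite -[LHS](permE sinj) -/s permKV.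
by rewrite -(inj _ _ (rS _) iS e) rk.
Qed.

Lemma loss_le (cs ch : 'I_n -> 'I_K) (S : {set 'I_n}) (pi : {perm 'I_K}) :
  (forall i, i \notin S -> cs i = pi (ch i)) -> loss cs ch <= #|S|%:R / n%:R :> R.
Proof.
move=> h; rewrite /loss; apply: (@le_trans _ _ (#|[set i | cs i != pi (ch i)]|%:R / n%:R)).
  exact: bigmin_le_cond.
rewrite ler_wpM2r ?invr_ge0 ?ler0n // ler_nat; apply: subset_leq_card.
by apply/fintype.subsetP => i; rewrite inE; apply: contraR => /h ->.
Qed.

(** A node is bad if the indicator of its community is at squared distance at least [sep / 4] from
    its centroid. Two good nodes with the same centroid have indicators at squared distance below
    [sep], hence lie in one community. The squared distances sum to at most 2D + 2(1 + eps)D, and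
    Markov's inequality counts the bad nodes. *)
Theorem kmeans_loss (V : 'I_n -> 'rV[R]_n) (cs ch : 'I_n -> 'I_K) eps sep D :
  0 <= eps -> 0 < sep -> kmeans_approx eps V ch ->
  \sum_i fnorm2 (V i - comm_row cs i) <= D ->
  (forall k, sep <= 2 * (nk cs k)%:R) ->
  (forall k, 8 * (2 + eps) * D / sep < (nk cs k)%:R) ->
  loss cs ch <= 8 * (2 + eps) * D / sep / n%:R.
Proof.
move=> e0 sep0 happ hD hsep hsmall.
have h1 := kmeans_approx_le cs e0 happ.
pose F i := fnorm2 (comm_row cs i - centroid V ch (ch i)).
pose S := [set i | sep / 4 <= F i].
have F0 i : 0 <= F i by exact: fnorm2_ge0.
have hF : \sum_i F i <= 2 * (2 + eps) * D.
  apply: (@le_trans _ _ (\sum_i (2 * fnorm2 (V i - comm_row cs i) +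
     2 * fnorm2 (V i - centroid V ch (ch i))))).
    apply: ler_sum => i _; rewrite /F.
    have := fnorm2_mid (comm_row cs i) (centroid V ch (ch i)) (V i).
    have sC (x y : 'rV[R]_n) : fnorm2 (x - y) = fnorm2 (y - x).
      by rewrite -opprB /fnorm2 fdotNl fdotNr opprK.
    by rewrite (sC (comm_row cs i) (V i)) (sC (centroid _ _ _) (V i)).
  rewrite big_split /= -!mulr_sumr.
  have : (1 + eps) * \sum_i fnorm2 (V i - comm_row cs i) <= (1 + eps) * D.
    by apply: ler_wpM2l => //; lra.
  by move: h1 hD; lra.
have hS : #|S|%:R <= 8 * (2 + eps) * D / sep.
  have h3 := le_trans (sum_indicator_le (sep / 4) F0) hF.
  rewrite ler_pdivlMr //; move: h3; rewrite -/S; lra.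
have [] := @relabel cs ch S.
- move=> i j; rewrite !inE -!ltNge => Fi Fj cij; apply/eqP/negPn/negP => ij.
  have := comm_row_sep ij; have := fnorm2_mid (comm_row cs i) (comm_row cs j) (centroid V ch (ch i)).
  rewrite -/(F i) cij -/(F j); have := hsep (cs i); have := hsep (cs j); lra.
- by move=> k; rewrite -(ltr_nat R); apply: le_lt_trans hS (hsmall k).
move=> pi hpi; apply: (le_trans (loss_le hpi)).
by rewrite ler_wpM2r ?invr_ge0 ?ler0n.
Qed.

End KMeans.

(** * The projection onto the range of [Theta] *)

Section Popularity.
Variables (R : realType) (n K : nat) (c : 'I_n -> 'I_K) (L : 'M[R]_(n, K)).
Hypothesis gram_unit : forall k, gramk c L k \in unitmx.

Let P0 : 'M[R]_n :=
  \matrix_(i, j) (if c i == c j then DP c L (c i) (row i L) (row j L) else 0).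

Lemma gram_tr k : (gramk c L k)^T = gramk c L k.
Proof.
rewrite /gramk linear_sum; apply: eq_bigr => i _ /=.
by rewrite trmx_mul trmxK.
Qed.

Lemma Pk_tr k : (Pk c L k)^T = Pk c L k.
Proof. by rewrite /Pk trmx_inv gram_tr. Qed.

(** Matrix products with [P0] are sums over one community; they produce the Gram matrix, which [Pk]
    cancels. This yields both [P0_idem] and [P0_Theta]. *)
Lemma gram_sum k (u : 'rV[R]_K) (w : 'cV[R]_K) :
  \sum_(l | c l == k) (u *m (row l L)^T) 0 0 * (row l L *m w) 0 0 =
  (u *m gramk c L k *m w) 0 0.
Proof.
rewrite /gramk mulmx_sumr mulmx_suml summxE; apply: eq_bigr => l _.
by rewrite mulmxA -(mulmxA (u *m _)) [RHS]mxE big_ord1.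
Qed.

Lemma DPC k x y : DP c L k x y = DP c L k y x.
Proof.
have tr00 (M : 'M[R]_1) : M 0 0 = M^T 0 0 by rewrite mxE.
by rewrite /DP [RHS]tr00 !trmx_mul trmxK Pk_tr mulmxA.
Qed.

Let P0_tr : P0^T = P0.
Proof.
apply/matrixP => i j; rewrite !mxE eq_sym.
by case: eqVneq => // ->; rewrite DPC.
Qed.

Let P0_idem : P0 *m P0 = P0.
Proof.
apply/matrixP => i j; rewrite !mxE.
rewrite (bigID (fun l => c l == c i)) /= [X in _ + X]big1 ?addr0; last first.
  by move=> l li; rewrite !mxE eq_sym (negbTE li) mul0r.
under eq_bigr => l /eqP li do rewrite !mxE li eqxx.
case: eqVneq => [cij|cij]; last by rewrite big1 // => l _; rewrite mulr0.
under eq_bigr => l _ do rewrite /DP -(mulmxA (row l L)).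
rewrite gram_sum /DP /Pk !mulmxA mulmxKV //; exact: gram_unit.
Qed.

Let P0_Theta : P0 *m Theta c L = Theta c L.
Proof.
apply/matrixP => i j; rewrite !mxE.
rewrite (bigID (fun l => c l == c i)) /= [X in _ + X]big1 ?addr0; last first.
  by move=> l li; rewrite !mxE eq_sym (negbTE li) mul0r.
have rE l : L l (c j) = (row l L *m delta_mx (c j) (0 : 'I_1)) 0 0 :> R.
  by rewrite -colE !mxE.
under eq_bigr => l /eqP li do rewrite !mxE li eqxx rE mulrA.
rewrite -mulr_suml gram_sum /Pk mulmxKV; last exact: gram_unit.
by rewrite -rE.
Qed.

Let P0_trace : \tr P0 = (K ^ 2)%:R.
Proof.
rewrite /mxtrace; under eq_bigr => i _ do rewrite mxE eqxx.
rewrite (partition_big c xpredT) //=.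
have -> : (K ^ 2)%:R = \sum_(k : 'I_K) K%:R :> R.
  by rewrite sumr_const card_ord -[RHS]mulr_natl natrX expr2.
apply: eq_bigr => k _.
have -> : K%:R = \tr (Pk c L k *m gramk c L k) :> R.
  by rewrite /Pk mulVmx ?mxtrace1.
rewrite /gramk mulmx_sumr linear_sum /=; apply: eq_bigr => i /eqP ->.
by rewrite mulmxA mxtrace_mulC mulmxA /DP [RHS]/mxtrace big_ord1.
Qed.

Variables (X : 'M[R]_(n, K ^ 2)) (d : 'I_(K ^ 2) -> R).
Hypothesis eX : eigdecomp (Theta c L) X d.
Hypothesis d_neq0 : forall j, d j != 0.

(* Both sides are orthogonal projections of trace K^2 and the range of
   [proj X] is contained in that of [P0]. *)
Lemma proj_popularity : proj X = P0.
Proof.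
have [XX TX] := eX.
have P0X : P0 *m X = X.
  pose D' := diag_mx (\row_j (d j)^-1).
  have XE : X = Theta c L *m X *m D'.
    rewrite TX -mulmxA mulmx_diag.
    have -> : (\row_j ((\row_j d j) 0 j * (\row_j (d j)^-1) 0 j)) = const_mx 1 :> 'rV[R]_(K ^ 2).
      by apply/rowP => j; rewrite !mxE divff.
    by rewrite diag_const_mx mulmx1.
  by rewrite {1}XE !mulmxA P0_Theta -XE.
have sX : fnorm2 X = (K ^ 2)%:R by rewrite /fnorm2 fdot_tr XX mxtrace1.
apply/eqP; rewrite -subr_eq0; apply/eqP/fnorm2_eq0.
rewrite /fnorm2 !(fdotDl, fdotDr, fdotNl, fdotNr) -/(fnorm2 _) -/(fnorm2 _) (fdotC P0).
have -> : fnorm2 (proj X) = (K ^ 2)%:R by rewrite -fnorm_sqr fnorm_isor // fnorm_sqr.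
have -> : fnorm2 P0 = (K ^ 2)%:R by rewrite /fnorm2 fdot_tr P0_tr P0_idem P0_trace.
have -> : fdot (proj X) P0 = (K ^ 2)%:R.
  by rewrite fdot_mulr -/(fdot _ _) fdotC /= trmxK P0X -sX.
ring.
Qed.

Lemma Theta_tr : (Theta c L)^T = Theta c L.
Proof. by apply/matrixP => i j; rewrite !mxE mulrC. Qed.

Lemma Theta_proj : Theta c L *m proj X = Theta c L.
Proof.
by rewrite proj_popularity -[LHS]trmxK trmx_mul P0_tr Theta_tr P0_Theta Theta_tr.
Qed.

Lemma fdot_row_popularity i j :
  fdot (row i X) (row j X) = if c i == c j then DP c L (c i) (row i L) (row j L) else 0.
Proof. by rewrite -proj_entry proj_popularity mxE. Qed.

Lemma fnorm_row_popularity i : fnorm (row i X) = Num.sqrt (DP c L (c i) (row i L) (row i L)).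
Proof. by rewrite /fnorm /fnorm2 fdot_row_popularity eqxx. Qed.

End Popularity.

(** * Bernoulli random graphs *)

Section BernoulliGraph.
Variables (R : realType) (n : nat) (T : 'M[R]_n).
Local Notation graph := {ffun 'I_n * 'I_n -> bool}.
Hypothesis T01 : forall i j, 0 <= T i j <= 1.

Definition up (p : 'I_n * 'I_n) : bool := (p.1 < p.2)%N.

Definition Ex (f : graph -> R) : R := \sum_A weight T A * f A.

Lemma admissibleP (A : graph) :
  reflect ((forall i j, A (i, j) = A (j, i)) /\ forall i, A (i, i) = false) (admissible A).
Proof.
apply: (iffP andP) => [[/forallP h1 /forallP h2]|[h1 h2]]; split.
- by move=> i j; apply/eqP; have /forallP := h1 i; apply.
- by move=> i; apply/negbTE.
- by apply/forallP => i; apply/forallP => j; apply/eqP.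
- by apply/forallP => i; rewrite h2.
Qed.

Lemma weightE (A : graph) : weight T A =
  (admissible A)%:R * \prod_(p | up p) (if A p then T p.1 p.2 else 1 - T p.1 p.2).
Proof.
rewrite /weight; congr (_ * _).
rewrite (pair_big_dep xpredT (fun i j : 'I_n => (i < j)%N)
  (fun i j => if A (i, j) then T i j else 1 - T i j)) /=.
by apply: eq_big => -[i j].
Qed.

Lemma weight_ge0 (A : graph) : 0 <= weight T A.
Proof.
rewrite weightE mulr_ge0 ?ler0n // prodr_ge0 // => p _.
by have /andP[? ?] := T01 p.1 p.2; case: ifP => // _; rewrite subr_ge0.
Qed.

Lemma Ex_le f g : (forall A, admissible A -> f A <= g A) -> Ex f <= Ex g.
Proof.
move=> h; apply: ler_sum => A _; have [aA|/negbTE aA] := boolP (admissible A).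
  by rewrite ler_wpM2l ?weight_ge0 ?h.
by rewrite !weightE aA !mul0r.
Qed.

Lemma eq_Ex f g : (forall A, admissible A -> f A = g A) -> Ex f = Ex g.
Proof.
move=> h; apply: eq_bigr => A _; have [aA|/negbTE aA] := boolP (admissible A).
  by rewrite h.
by rewrite !weightE aA !mul0r.
Qed.

Lemma ExD f g : Ex (fun A => f A + g A) = Ex f + Ex g.
Proof. by rewrite -big_split; apply: eq_bigr => A _; rewrite mulrDr. Qed.

Lemma ExZ c f : Ex (fun A => c * f A) = c * Ex f.
Proof. by rewrite mulr_sumr; apply: eq_bigr => A _; rewrite mulrCA. Qed.

Lemma Ex_sum (I : finType) (F : I -> graph -> R) :
  Ex (fun A => \sum_i F i A) = \sum_i Ex (F i).
Proof.
rewrite exchange_big; apply: eq_bigr => A _; by rewrite mulr_sumr.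
Qed.

(** Admissible graphs correspond to the functions that are [false] off the pairs satisfying [up];
    [symm] and [upper] are the two directions. Over such functions a product of sums expands into a
    sum of products, which is the independence of the edges. *)
Let symm (f : graph) : graph := [ffun p => f p || f (p.2, p.1)].
Let upper (A : graph) : graph := [ffun p => up p && A p].

Lemma Ex_prod (g : 'I_n * 'I_n -> bool -> R) :
  Ex (fun A => \prod_(p | up p) g p (A p)) =
  \prod_(p | up p) (T p.1 p.2 * g p true + (1 - T p.1 p.2) * g p false).
Proof.
pose F p (b : bool) := (if b then T p.1 p.2 else 1 - T p.1 p.2) * g p b.
transitivity (\sum_(A | admissible A) \prod_(p | up p) F p (A p)).
  rewrite [RHS]big_mkcond; apply: eq_bigr => A _; rewrite weightE.
  by case: ifP => _; rewrite ?mul0r // mul1r -big_split.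
transitivity (\prod_(p | up p) \sum_(b | predT b) F p b); last first.
  by apply: eq_bigr => p _; rewrite big_bool.
rewrite (big_distr_big_dep false) (reindex_onto symm upper) /=; last first.
  move=> A /admissibleP[sA dA]; apply/ffunP => -[i j]; rewrite !ffunE /up /=.
  rewrite (sA j i); case: ltngtP => // ij; rewrite ?orbF //.
  by rewrite (val_inj ij) dA.
have PE f : (admissible (symm f) && (upper (symm f) == f)) = (f \in pfamily false up (fun=> predT)).
  apply/idP/idP => [/andP[_ /eqP <-]|].
    apply/pfamilyP; split => //; apply/supportP => p; rewrite !ffunE.
    by rewrite -[p \in up]/(up p) => /negbTE ->.
  case/pfamilyP => /supportP h _.
  have hf p : ~~ up p -> f p = false by move=> ?; apply: h.
  apply/andP; split.
    apply/admissibleP; split => i *; rewrite !ffunE /=; first by rewrite orbC.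
    by rewrite hf // /up ltnn.
  apply/eqP/ffunP => -[i j]; rewrite !ffunE.
  have [u|/hf -> //] := boolP (up (i, j)).
  by rewrite (hf (j, i)) ?orbF //= /up /= -leqNgt ltnW.
rewrite (eq_bigl _ _ PE); apply: eq_bigr => f /pfamilyP[/supportP h _].
apply: eq_bigr => -[i j] u; rewrite !ffunE /= (h (j, i)) ?orbF //.
by rewrite unfold_in /up /= -leqNgt ltnW.
Qed.

Lemma Ex_cst c : Ex (fun=> c) = c.
Proof.
have e : Ex (fun=> 1) = 1.
  transitivity (Ex (fun A => \prod_(p | up p) 1)).
    by apply: eq_Ex => A _; rewrite big1.
  rewrite (Ex_prod (fun _ _ => 1)) big1 // => p _.
  by rewrite !mulr1 addrC subrK.
transitivity (c * Ex (fun=> 1)); last by rewrite e mulr1.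
by rewrite -ExZ; apply: eq_Ex => A _; rewrite mulr1.
Qed.

Definition mix (i : 'I_n) (A B : graph) : graph :=
  [ffun p => if (p.1 == i) || (p.2 == i) then A p else B p].

Lemma mixK i A B : mix i (mix i A B) (mix i B A) = A.
Proof. by apply/ffunP => p; rewrite !ffunE; case: (_ || _). Qed.

Let mix_adm i A B : admissible A -> admissible B -> admissible (mix i A B).
Proof.
move=> /admissibleP[sA dA] /admissibleP[sB dB]; apply/admissibleP.
by split=> [k l|k]; rewrite !ffunE /= ?dA ?dB ?if_same // orbC sA sB.
Qed.

(** Exchanging the edges at [i] between two independent copies preserves the product measure. *)
Let weight_mix i A B :
  weight T (mix i A B) * weight T (mix i B A) = weight T A * weight T B.
Proof.
rewrite !weightE mulrACA [RHS]mulrACA -!big_split /=; congr (_ * _); last first.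
  by apply: eq_bigr => p _; rewrite !ffunE; case: (_ || _) => //; rewrite mulrC.
rewrite -!natrM !mulnb; congr (_%:R); congr (nat_of_bool _).
apply/andP/andP => [[h1 h2]|[h1 h2]]; last by split; apply: mix_adm.
have hA : admissible (mix i (mix i A B) (mix i B A)) by apply: mix_adm.
have hB : admissible (mix i (mix i B A) (mix i A B)) by apply: mix_adm.
by rewrite !mixK in hA hB.
Qed.

(* Fubini for the edges at vertex [i] against the remaining edges. *)
Lemma Ex_resample i (f : graph -> R) :
  Ex f = Ex (fun B => Ex (fun A => f (mix i A B))).
Proof.
transitivity (\sum_(q : graph * graph) weight T q.1 * weight T q.2 * f q.1).
  rewrite -(pair_big xpredT xpredT (fun A B => weight T A * weight T B * f A)) /=.
  apply: eq_bigr => A _.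
  rewrite (eq_bigr (fun B => (weight T A * f A) * (weight T B * 1))); last first.
    by move=> B _; rewrite mulr1 mulrAC.
  by rewrite -mulr_sumr -/(Ex (fun=> 1)) Ex_cst mulr1.
rewrite (reindex (fun q => (mix i q.1 q.2, mix i q.2 q.1))); last first.
  by exists (fun q => (mix i q.1 q.2, mix i q.2 q.1)) => -[A B] _; rewrite /= !mixK.
under eq_bigr => q _ do rewrite weight_mix.
rewrite -(pair_big xpredT xpredT (fun A B => weight T A * weight T B * f (mix i A B))) /=.
rewrite exchange_big; apply: eq_bigr => B _.
by rewrite mulr_sumr; apply: eq_bigr => A _; rewrite mulrA (mulrC (weight T A)).
Qed.

(** Each bad event is encoded by a nonnegative function that is at least 1 on it, so that Markov's
    inequality and the union bound reduce to the linearity of [Ex]. *)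
Lemma Prob_ge (E : graph -> Prop) (g : graph -> R) dl :
  (forall A, admissible A -> 0 <= g A) -> (forall A, admissible A -> g A < 1 -> E A) ->
  Ex g <= dl -> 1 - dl <= Prob T E.
Proof.
move=> g0 gE gd.
have -> : Prob T E = Ex (fun A => (`[< E A >])%:R) by [].
rewrite lerBlDr; apply: le_trans (lerD (lexx _) gd).
rewrite -ExD -{1}(Ex_cst 1); apply: Ex_le => A aA.
have [EA|EA] := boolP (`[< E A >]); first by rewrite lerDl g0.
rewrite add0r leNgt; apply: contra EA => /(gE A aA) EA.
exact/asboolP.
Qed.

End BernoulliGraph.

(** * Exponential moments of the edges at a vertex *)

Section Bernstein.
Variables (R : realType).

(** From exp(-u) >= 1 - u and (1 + u + 2u^2)(1 - u) = 1 + u^2 (1 - 2u) >= 1. *)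
Lemma expR_le_quad (u : R) : `|u| <= 1 / 2 -> expR u <= 1 + u + 2 * u ^+ 2.
Proof.
rewrite ler_norml => /andP[u1 u2].
have h1 : 1 - u <= expR (- u) := expR_ge1Dx _.
have p : 0 < expR u := expR_gt0 u.
have h : expR u * (1 - u) <= 1.
  by rewrite -[leRHS](mulfV (lt0r_neq0 p)) -expRN ler_pM2l.
have h3 : 1 <= (1 + u + 2 * u ^+ 2) * (1 - u).
  have : 0 <= u ^+ 2 * (1 - 2 * u) by rewrite mulr_ge0 ?sqr_ge0 //; lra.
  by rewrite !expr2; lra.
by rewrite -(@ler_pM2r _ (1 - u)); [exact: le_trans h h3 | lra].
Qed.

Lemma bernoulli_mgf (th r2 y : R) : 0 <= th <= 1 -> th <= r2 -> `|y| <= 1 / 2 ->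
  th * expR (y * (1 - th)) + (1 - th) * expR (y * (0 - th)) <= expR (2 * r2 * y ^+ 2).
Proof.
move=> /andP[t0 t1] tr yh.
have b (c : R) : `|c| <= 1 -> `|y * c| <= 1 / 2.
  by move=> c1; rewrite normrM -[leRHS]mulr1 ler_pM.
have e1 : expR (y * (1 - th)) <= 1 + y * (1 - th) + 2 * (y * (1 - th)) ^+ 2.
  by apply/expR_le_quad/b; rewrite ger0_norm; lra.
have e2 : expR (y * (0 - th)) <= 1 + y * (0 - th) + 2 * (y * (0 - th)) ^+ 2.
  by apply/expR_le_quad/b; rewrite sub0r normrN ger0_norm; lra.
have f1 := ler_wpM2l t0 e1.
have t1' : 0 <= 1 - th by lra.
have f2 := ler_wpM2l t1' e2.
apply: (le_trans (lerD f1 f2)); apply: le_trans (expR_ge1Dx _).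
have -> : th * (1 + y * (1 - th) + 2 * (y * (1 - th)) ^+ 2) +
  (1 - th) * (1 + y * (0 - th) + 2 * (y * (0 - th)) ^+ 2) =
  1 + 2 * (th * (1 - th)) * y ^+ 2 by ring.
rewrite lerD2l ler_wpM2r ?sqr_ge0 //.
have : th * (1 - th) <= r2; last lra.
by apply: le_trans tr; rewrite ler_piMr //; lra.
Qed.

Variables (n : nat) (T : 'M[R]_n) (r2 : R).
Local Notation graph := {ffun 'I_n * 'I_n -> bool}.
Hypothesis T01 : forall i j, 0 <= T i j <= 1.
Hypothesis T_le : forall i j, T i j <= r2.
Hypothesis symT : T^T = T.

Lemma sum_up (G : 'I_n -> 'I_n -> R) :
  \sum_(p | up p) (G p.1 p.2 + G p.2 p.1) = \sum_k \sum_(l | l != k) G k l.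
Proof.
rewrite (pair_big_dep xpredT (fun k l : 'I_n => l != k)) /=.
rewrite [RHS](bigID (@up n)) big_split /=; congr (_ + _).
  apply: eq_bigl => -[k l] /=; rewrite /up /= andbC.
  by case: ltngtP => //= kl; rewrite ?andbT; apply/esym/eqP => lk; rewrite lk ltnn in kl.
rewrite [RHS](reindex (fun p => (p.2, p.1))) /=; last first.
  by exists (fun p => (p.2, p.1)) => -[].
apply: eq_bigl => -[k l] /=; rewrite /up /= -leqNgt ltn_neqAle.
by rewrite -(inj_eq val_inj).
Qed.

Definition edge_sum (i : 'I_n) (x : 'cV[R]_n) (A : graph) : R :=
  \sum_(j | j != i) ((A (i, j))%:R - T i j) * x j 0.

(** The weight of an unordered pair in [edge_sum]: the value of [x] at the other end if the pair
    touches [i], and 0 otherwise. *)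
Let coef i (x : 'cV[R]_n) (p : 'I_n * 'I_n) : R :=
  (p.1 == i)%:R * x p.2 0 + (p.2 == i)%:R * x p.1 0.

Lemma sum_star i (F : 'I_n -> R) :
  \sum_k \sum_(l | l != k) (k == i)%:R * F l = \sum_(l | l != i) F l.
Proof.
rewrite (bigD1 i) //= [X in _ + X]big1 ?addr0 => [|k ki].
  by apply: eq_bigr => l _; rewrite eqxx mul1r.
by apply: big1 => l _; rewrite (negbTE ki) mul0r.
Qed.

Let edge_sumE i x A : admissible A ->
  edge_sum i x A = \sum_(p | up p) coef i x p * ((A p)%:R - T p.1 p.2).
Proof.
move=> /admissibleP[sA _].
have -> : edge_sum i x A =
    \sum_k \sum_(l | l != k) (k == i)%:R * (((A (k, l))%:R - T k l) * x l 0).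
  rewrite (bigD1 i) //= [X in _ + X]big1 ?addr0 => [|k ki].
    by apply: eq_bigr => l _; rewrite eqxx mul1r.
  by apply: big1 => l _; rewrite (negbTE ki) mul0r.
rewrite -sum_up; apply: eq_bigr => -[k l] _ /=.
rewrite (sA l k); have -> : T l k = T k l by rewrite -[in RHS]symT mxE.
rewrite /coef /=; ring.
Qed.

Let coef_sqr i x : \sum_(p | up p) coef i x p ^+ 2 <= fnorm2 x.
Proof.
have -> : \sum_(p | up p) coef i x p ^+ 2 = \sum_(l | l != i) x l 0 ^+ 2.
  rewrite -(sum_star i) -sum_up; apply: eq_bigr => -[k l]; rewrite /up /coef /= => kl.
  case: (eqVneq k i) => [ki|_]; case: (eqVneq l i) => [li|_]; rewrite /= !(mul0r, mul1r, addr0, add0r, expr0n) //.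
  by rewrite ki li ltnn in kl.
rewrite /fnorm2 /fdot [leRHS](bigD1 i) //= -[leLHS]add0r; apply: lerD.
  by rewrite big_ord1 -expr2 sqr_ge0.
by apply: ler_sum => l _; rewrite big_ord1 expr2.
Qed.

Lemma Ex_exp_edge_sum (i : 'I_n) (x : 'cV[R]_n) (s : R) : (forall j, `|s * x j 0| <= 1 / 2) -> fnorm2 x <= 1 ->
  Ex T (fun A => expR (s * edge_sum i x A)) <= expR (2 * r2 * s ^+ 2).
Proof.
move=> sx x1.
have r20 : 0 <= r2 by have /andP[t0 _] := T01 i i; apply: le_trans t0 (T_le i i).
pose g p (b : bool) := expR (s * coef i x p * (b%:R - T p.1 p.2)).
rewrite (@eq_Ex _ _ T _ (fun A => \prod_(p | up p) g p (A p))); last first.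
  move=> A aA; rewrite edge_sumE // mulr_sumr expR_sum; apply: eq_bigr => p _.
  by rewrite mulrA.
rewrite Ex_prod.
apply: (@le_trans _ _ (\prod_(p | up p) expR (2 * r2 * (s * coef i x p) ^+ 2))).
  apply: ler_prod => -[k l] kl; apply/andP; split.
    have /andP[t0 t1] := T01 k l.
    by rewrite addr_ge0 // mulr_ge0 ?expR_ge0 //= subr_ge0.
  apply: bernoulli_mgf => //.
  rewrite /coef /=; move: kl; rewrite /up /=.
  case: (eqVneq k i) => [ki|_]; case: (eqVneq l i) => [li|_]; rewrite /= !(mul0r, mul1r, addr0, add0r) //.
  - by move=> kl; exfalso; move: kl; rewrite ki li ltnn.
  - by move=> _; have := sx l; rewrite mul1r.
  - by move=> _; have := sx k; rewrite mul1r.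
  - by move=> _; rewrite mulr0 normr0 invr_ge0.
rewrite -expR_sum ler_expR -mulr_sumr ler_wpM2l ?mulr_ge0 //.
under eq_bigr do rewrite exprMn.
rewrite -mulr_sumr -[leRHS]mulr1 ler_wpM2l ?sqr_ge0 //.
exact: le_trans (coef_sqr i x) x1.
Qed.

Lemma loo_mix i (A B : graph) : loo i (adjm (mix i A B) - T) = loo i (adjm B - T).
Proof.
by apply/matrixP => k l; rewrite !mxE ffunE /=; case: (_ || _).
Qed.

Lemma edge_sum_mix i (x : 'cV[R]_n) (A B : graph) : edge_sum i x (mix i A B) = edge_sum i x A.
Proof. by apply: eq_bigr => j _; rewrite ffunE /= eqxx. Qed.

Lemma adj_tr (A : graph) : admissible A -> (adjm A : 'M[R]_n)^T = adjm A.
Proof. by move=> /admissibleP[sA _]; apply/matrixP => i j; rewrite !mxE sA. Qed.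

Lemma noise_tr (A : graph) : admissible A -> (adjm A - T)^T = adjm A - T.
Proof. by move=> aA; rewrite linearB /= adj_tr // symT. Qed.

(* The direction [x] and the rate [s] may depend on the edges away from [i]. *)
Lemma Ex_exp_edge_sum_loo i (x : 'M[R]_n -> 'cV[R]_n) (s : 'M[R]_n -> R) c :
  (forall B, B^T = B -> [/\ forall j, `|s B * x B j 0| <= 1 / 2, fnorm2 (x B) <= 1 &
     2 * r2 * s B ^+ 2 <= c]) ->
  Ex T (fun A => let B := loo i (adjm A - T) in expR (s B * edge_sum i (x B) A))
    <= expR c.
Proof.
move=> h; rewrite (Ex_resample T i) -[leRHS](Ex_cst T); apply: Ex_le => // B aB /=.
rewrite (@eq_Ex _ _ T _ (fun A => expR (s (loo i (adjm B - T)) *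
    edge_sum i (x (loo i (adjm B - T))) A))); last first.
  by move=> A aA; rewrite loo_mix edge_sum_mix.
have [h1 h2 h3] := h (loo i (adjm B - T)) (loo_tr i (noise_tr aB)).
by apply: (le_trans (Ex_exp_edge_sum i h1 h2)); rewrite ler_expR.
Qed.

End Bernstein.

(** * Moments of the noise matrix *)

Section Walks.
Variables (R : realType) (n : nat).

(** Sums over all sequences of length [L], defined by recursion on their head to follow the
    induction on walks. *)
Fixpoint wsum (L : nat) (F : seq 'I_n -> R) : R :=
  if L is L'.+1 then \sum_j wsum L' (fun s => F (j :: s)) else F [::].

Fixpoint wprod (M : 'M[R]_n) (i : 'I_n) (s : seq 'I_n) : R :=
  if s is j :: s' then M i j * wprod M j s' else 1.

Definition mpow (M : 'M[R]_n) L : 'M[R]_n := iter L (mulmx M) 1%:M.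

Lemma wsumZ L c F : wsum L (fun s => c * F s) = c * wsum L F.
Proof.
elim: L F => [//|L IH] F /=; rewrite mulr_sumr; apply: eq_bigr => j _; exact: IH.
Qed.

Lemma wsum_le L F G : (forall s, size s = L -> F s <= G s) -> wsum L F <= wsum L G.
Proof.
elim: L F G => [|L IH] F G h /=; first exact: h.
by apply: ler_sum => j _; apply: IH => s sL; apply: h; rewrite /= sL.
Qed.

Lemma eq_wsum L F G : F =1 G -> wsum L F = wsum L G.
Proof. by move=> h; congr wsum; apply/funext. Qed.

Lemma mpow_walk M L i k :
  mpow M L i k = wsum L (fun s => wprod M i s * (last i s == k)%:R).
Proof.
elim: L i => [|L IH] i /=; first by rewrite mxE mul1r.
rewrite mxE; apply: eq_bigr => j _; rewrite IH -wsumZ.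
by apply: eq_wsum => s; rewrite mulrA.
Qed.

Lemma mpowD M a b : mpow M (a + b) = mpow M a *m mpow M b.
Proof.
elim: a => [|a IH]; first by rewrite mul1mx.
by rewrite addSn /= IH mulmxA.
Qed.

Lemma mpow_tr M L : M^T = M -> (mpow M L)^T = mpow M L.
Proof.
move=> sM; elim: L => [|L IH]; first by rewrite trmx1.
have m1 : mpow M 1 = M by rewrite /mpow /= mulmx1.
by rewrite -{1}addn1 mpowD trmx_mul IH m1 sM.
Qed.

Lemma opnorm_sqr_le (M : 'M[R]_n) : M^T = M -> opnorm M ^+ 2 <= opnorm (M *m M).
Proof.
move=> sM; rewrite -[leRHS]sqr_sqrtr ?opnorm_ge0 // ler_pXn2r ?nnegrE ?sqrtr_ge0 ?opnorm_ge0 //.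
apply: opnorm_le => [|v]; first exact: sqrtr_ge0.
rewrite fnorm_le ?sqrtr_ge0 // sqr_sqrtr ?opnorm_ge0 // /fnorm2 fdot_mull sM mulmxA.
apply: (le_trans (fdot_le _ _)); rewrite -/(fnorm2 v) -fnorm_sqr expr2 mulrA mulrC.
by rewrite ler_wpM2r ?fnorm_ge0 // opnormM.
Qed.

(** Repeated squaring with [opnorm_sqr_le] bounds the norm of [M] by that of M^q, whose squared
    Frobenius norm is the trace of M^(2q); this is why the exponents are powers of two. *)
Lemma opnorm_pow_trace (M : 'M[R]_n) k : M^T = M ->
  opnorm M ^+ (2 * 2 ^ k) <= \tr (mpow M (2 * 2 ^ k)).
Proof.
move=> sM; have h : opnorm M ^+ (2 ^ k) <= opnorm (mpow M (2 ^ k)).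
  elim: k => [|k IH]; first by rewrite expr1 /= mulmx1.
  rewrite expnSr exprM; apply: (@le_trans _ _ (opnorm (mpow M (2 ^ k)) ^+ 2)).
    by rewrite ler_pXn2r ?nnegrE ?exprn_ge0 ?opnorm_ge0.
  by rewrite muln2 -addnn mpowD opnorm_sqr_le // mpow_tr.
rewrite mulnC exprM.
apply: (@le_trans _ _ (fnorm (mpow M (2 ^ k)) ^+ 2)).
  rewrite ler_pXn2r ?nnegrE ?exprn_ge0 ?opnorm_ge0 ?fnorm_ge0 //.
  exact: le_trans h (opnorm_le_nf _).
by rewrite fnorm_sqr /fnorm2 fdot_tr mpow_tr // -mpowD muln2 addnn.
Qed.

(* Weighting a walk by [a ^ #visited vertices], a step either revisits one of
   the at most [L + size t] known vertices or costs a factor [a]. *)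
Lemma wsum_visited L (t : seq 'I_n) (a : R) : 0 <= a ->
  wsum L (fun s => a ^+ size (undup (s ++ t))) <=
    a ^+ size (undup t) * (n%:R * a + (L + size t)%:R) ^+ L.
Proof.
move=> a0; elim: L t => [|L IH] t /=; first by rewrite mulr1.
have perm j s : size (undup ((j :: s) ++ t)) = size (undup (s ++ j :: t)).
  by apply/perm_size/perm_undup => k; rewrite !(mem_cat, inE); case: (k == j); rewrite ?orbT.
set B := n%:R * a + (L.+1 + size t)%:R.
have B0 : 0 <= B by rewrite addr_ge0 ?ler0n // mulr_ge0 ?ler0n.
apply: (@le_trans _ _ (\sum_j a ^+ size (undup (j :: t)) * B ^+ L)).
  apply: ler_sum => j _; rewrite (@eq_wsum _ _ (fun s => a ^+ size (undup (s ++ j :: t)))).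
    by apply: (le_trans (IH _)); rewrite /B /= addnS addSn.
  by move=> s; rewrite perm.
rewrite -mulr_suml exprS mulrA ler_wpM2r ?exprn_ge0 //.
set v := size (undup t).
apply: (@le_trans _ _ (\sum_(j : 'I_n) ((j \in t)%:R * a ^+ v + a * a ^+ v))).
  apply: ler_sum => j _ /=; case: (j \in t); rewrite /= ?mul1r ?mul0r ?add0r ?exprS //.
  by rewrite lerDl mulr_ge0 ?exprn_ge0.
rewrite big_split /= -mulr_suml sumr_const card_ord -[X in _ + X]mulr_natl.
rewrite mulrA -mulrDl mulrC ler_wpM2l ?exprn_ge0 // /B addrC lerD2l.
rewrite -natr_sum ler_nat.
have -> : (\sum_(j : 'I_n) (j \in t) = #|t|)%N.
  by rewrite -sum1_card [RHS]big_mkcond; apply: eq_bigr => j _; case: (j \in t).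
by apply: (leq_trans (card_size t)); rewrite leq_addl.
Qed.

Definition isstep (i j : 'I_n) (p : 'I_n * 'I_n) : bool := ((i, j) == p) || ((j, i) == p).

Fixpoint mult (i : 'I_n) (s : seq 'I_n) (p : 'I_n * 'I_n) : nat :=
  if s is j :: s' then (isstep i j p + mult j s' p)%N else 0%N.

(** Other walks contribute nothing, the matrix [noise0] having zero diagonal. *)
Definition noloop (i j : 'I_n) := i != j.

Lemma isstep_up i j : i != j -> exists2 p0, up p0 &
  ((p0 = (i, j) \/ p0 = (j, i)) /\ forall p, up p -> isstep i j p = (p == p0)).
Proof.
move=> ij; case: (ltngtP i j) => [lt|lt|/val_inj e]; last by rewrite e eqxx in ij.
- exists (i, j) => //; split; first by left.
  move=> p up_p; rewrite /isstep eq_sym; case: eqP => //= pij.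
  by apply/negbTE/eqP => e; move: up_p; rewrite -e /up /= ltnNge ltnW.
- exists (j, i) => //; split; first by right.
  move=> p up_p; rewrite /isstep orbC eq_sym; case: eqP => //= pij.
  by apply/negbTE/eqP => e; move: up_p; rewrite -e /up /= ltnNge ltnW.
Qed.

Lemma sum_mult i s : path noloop i s -> (\sum_(p | up p) mult i s p = size s)%N.
Proof.
elim: s i => [|j s IH] i /=; first by rewrite big1.
case/andP => ij /IH; rewrite big_split /= => ->.
have [p0 up0 [_ h]] := isstep_up ij.
rewrite (bigD1 p0) //= h // eqxx big1 // => p /andP[u pp0].
by rewrite h // (negbTE pp0).
Qed.

Lemma mult_mem i s p : (0 < mult i s p)%N -> (p.1 \in i :: s) && (p.2 \in i :: s).
Proof.
elim: s i => [//|j s IH] i /=; rewrite addn_gt0 => /orP[|/IH/andP[h1 h2]].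
  rewrite lt0b => /orP[] /eqP <- /=; rewrite !inE !eqxx ?orbT //.
by rewrite inE h1 orbT inE h2 orbT.
Qed.

Definition edges i s := [set p | up p && (0 < mult i s p)%N].

(* The walk connects its vertices. *)
Lemma edges_ge i s : path noloop i s -> (size (undup (i :: s)) <= #|edges i s|.+1)%N.
Proof.
elim: s i => [//|j s IH] i; rewrite [path _ _ _]/= => /andP[ij /IH h].
have sub : edges j s \subset edges i (j :: s).
  apply/fintype.subsetP => p; rewrite !inE => /andP[-> m0].
  by rewrite /= addn_gt0 m0 orbT.
have -> : undup [:: i, j & s] = if i \in j :: s then undup (j :: s) else i :: undup (j :: s).
  by [].
have [_|inot] := boolP (i \in j :: s).
  by apply: leq_trans h _; rewrite ltnS subset_leq_card.
have [p0 up0 [p0E hp]] := isstep_up ij.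
rewrite ltnS; apply: leq_trans h _; apply: proper_card.
apply/properP; split => //; exists p0; rewrite !inE up0 /=.
  by rewrite hp // eqxx.
rewrite -leqNgt leqn0; apply/negPn; rewrite -lt0n; apply/negP => /mult_mem/andP[h1 h2].
by case: p0E inot => e; rewrite e /= in h1 h2; rewrite ?h1 ?h2.
Qed.

End Walks.

(** * The expected trace of an even power of the noise *)

Section NoiseMoment.
Variables (R : realType) (n : nat) (T : 'M[R]_n) (r2 : R).
Local Notation graph := {ffun 'I_n * 'I_n -> bool}.
Hypothesis T01 : forall i j, 0 <= T i j <= 1.
Hypothesis T_le : forall i j, T i j <= r2.
Hypothesis symT : T^T = T.
Hypothesis r2_gt0 : 0 < r2.
Hypothesis r2_le1 : r2 <= 1.

(** The diagonal of [adjm A - T] is the deterministic [- T i i], since graphs have no loops while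
    [T] may have a nonzero diagonal. It is set aside here so that all entries are centred, and added
    back in [good_event]. *)
Definition noise0 (A : graph) : 'M[R]_n :=
  \matrix_(i, j) if i == j then 0 else (A (i, j))%:R - T i j.

Lemma noise0_tr A : admissible A -> (noise0 A)^T = noise0 A.
Proof.
move=> /admissibleP[sA _]; apply/matrixP => i j; rewrite !mxE eq_sym sA.
by rewrite -[in RHS]symT mxE.
Qed.

(** Grouping the factors by undirected edge makes them independent, as [Ex_prod] requires. *)
Lemma wprod_noise A i s : admissible A -> wprod (noise0 A) i s =
  (path (@noloop n) i s)%:R * \prod_(p | up p) ((A p)%:R - T p.1 p.2) ^+ mult i s p.
Proof.
move=> aA; have [sA _] := admissibleP _ aA.
elim: s i => [|j s IH] i /=; first by rewrite big1 ?mulr1.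
rewrite mxE IH /noloop; have [_|ij] := eqVneq i j; first by rewrite !mul0r.
rewrite andTb mulrCA; congr (_ * _).
under [RHS]eq_bigr do rewrite exprD.
rewrite big_split /=; congr (_ * _).
have [p0 up0 [p0E h]] := isstep_up ij.
rewrite (bigD1 p0) //= h // eqxx expr1 big1 ?mulr1 => [|p /andP[u pp0]]; last first.
  by rewrite h // (negbTE pp0).
by case: p0E => -> //=; rewrite sA -[in LHS]symT mxE.
Qed.

Let kappa (p : 'I_n * 'I_n) m : R :=
  T p.1 p.2 * (1 - T p.1 p.2) ^+ m + (1 - T p.1 p.2) * (0 - T p.1 p.2) ^+ m.

(** Deviations are at most 1 in absolute value, so from order two on the moments are bounded by the
    variance t(1 - t). *)
Let kappa_le p m : (0 < m)%N -> m != 1%N -> `|kappa p m| <= r2.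
Proof.
move=> m0 m1; have /andP[t0 t1] := T01 p.1 p.2; have tr := T_le p.1 p.2.
rewrite /kappa; set t := T p.1 p.2 in t0 t1 tr *.
have t1' : 0 <= 1 - t by rewrite subr_ge0.
case: m m0 m1 => [//|[//|m]] _ _.
have h (x : R) : 0 <= x -> x <= 1 -> x ^+ m.+2 <= x ^+ 2.
  by move=> x0 x1; rewrite ler_wiXn2l.
apply: (le_trans (ler_normD _ _)).
rewrite (normrM t ((1 - t) ^+ m.+2)) (normrM (1 - t) ((0 - t) ^+ m.+2)) !normrX sub0r normrN !ger0_norm //.
have h1 := ler_wpM2l t0 (h _ t1' _); have h2 := ler_wpM2l t1' (h _ t0 t1).
apply: (@le_trans _ _ (t * (1 - t) ^+ 2 + (1 - t) * t ^+ 2)).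
  by apply: lerD => //; apply: h1; rewrite lerBlDr lerDl.
have -> : t * (1 - t) ^+ 2 + (1 - t) * t ^+ 2 = t * (1 - t) by ring.
by apply: le_trans tr; rewrite ler_piMr // lerBlDr lerDl.
Qed.

(* An edge used exactly once makes the expectation vanish. *)
Lemma Ex_wprod i s z q : 0 < z <= 1 -> size s = (2 * q)%N ->
  Ex T (fun A => wprod (noise0 A) i s) <=
    (z * r2 * z ^+ q)^-1 * (z * r2) ^+ size (undup (i :: s)).
Proof.
move=> /andP[z0 z1] sq; set a := z * r2.
have a0 : 0 < a by rewrite mulr_gt0.
have a1 : a <= 1 by rewrite /a -[leRHS]mulr1 ler_pM // ltW.
have rhs0 : 0 <= (a * z ^+ q)^-1 * a ^+ size (undup (i :: s)).
  by rewrite mulr_ge0 ?invr_ge0 ?mulr_ge0 ?exprn_ge0 // ltW.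
rewrite (@eq_Ex _ _ T _ (fun A => (path (@noloop n) i s)%:R *
    \prod_(p | up p) ((A p)%:R - T p.1 p.2) ^+ mult i s p)); last first.
  by move=> A aA; rewrite wprod_noise.
rewrite ExZ; have [pth|_] := boolP (path _ i s); last by rewrite mul0r.
rewrite mul1r (Ex_prod T (fun p (b : bool) => (b%:R - T p.1 p.2) ^+ mult i s p)) /=.
have [/existsP[p /andP[u m1]]|nm1] := boolP [exists p, up p && (mult i s p == 1%N)].
  rewrite (bigD1 p) //= (eqP m1) !expr1.
  by have -> : T p.1 p.2 * (1 - T p.1 p.2) + (1 - T p.1 p.2) * (0 - T p.1 p.2) = 0;
    [ring | rewrite mul0r].
have nm p : up p -> mult i s p != 1%N.
  by move=> u; apply: contra nm1 => m1; apply/existsP; exists p; rewrite u.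
set e := #|edges i s|.
have le_r2 : \prod_(p | up p) kappa p (mult i s p) <= r2 ^+ e.
  apply: (le_trans (ler_norm _)); rewrite normr_prod.
  apply: (@le_trans _ _ (\prod_(p | up p) (if (0 < mult i s p)%N then r2 else 1))).
    apply: ler_prod => p u; rewrite normr_ge0 /=.
    case: ltnP => [m0|]; first exact: kappa_le (nm p u).
    rewrite leqn0 => /eqP ->; rewrite /kappa !expr0 !mulr1 addrC subrK normr1 //.
  rewrite -big_mkcondr /= (eq_bigl (mem (edges i s))); last by move=> p; rewrite !inE.
  by rewrite prodr_const.
apply: (le_trans le_r2).
(* Each edge of the walk carries at least two of its [2 * q] steps. *)
have eq_ : (e <= q)%N.
  rewrite -(leq_pmul2l (ltn0Sn 1)) -sq -(sum_mult pth) mulnC -sum_nat_const.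
  rewrite [leqRHS](bigID (fun p => p \in edges i s)) /=.
  apply: leq_trans (leq_addr _ _).
  rewrite [leqRHS](eq_bigl (mem (edges i s))); last first.
    by move=> p; rewrite !inE; case: (up p).
  apply: leq_sum => p; rewrite inE => /andP[u m0].
  by case: (mult i s p) m0 (nm p u) => [|[|]].
have ve := edges_ge pth; rewrite -/e in ve.
set v := size _ in ve rhs0 *.
have v0 : (0 < v)%N.
  have iu : i \in undup (i :: s) by rewrite mem_undup mem_head.
  by rewrite /v; case: (undup (i :: s)) iu.
(* The free parameter [z] trades edges for vertices: [e <= q] bounds the power of 1 / z, and
   [v <= e + 1] the power of [a]. The result depends on the walk only through its number of
   vertices, as [wsum_visited] demands. *)
have -> : r2 ^+ e = (z ^+ e)^-1 * a ^+ e.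
  by rewrite /a exprMn mulKf // expf_neq0 // gt_eqF.
have -> : (a * z ^+ q)^-1 * a ^+ v = (z ^+ q)^-1 * a ^+ v.-1.
  by rewrite -{1}(prednK v0) exprS invfM mulrACA mulVf ?gt_eqF // mul1r.
apply: ler_pM.
- by rewrite invr_ge0 exprn_ge0 // ltW.
- by rewrite exprn_ge0 // ltW.
- by rewrite lef_pV2 ?posrE ?exprn_gt0 // ler_wiXn2l // ltW.
- by rewrite ler_wiXn2l ?(ltW a0) // -ltnS prednK.
Qed.

Lemma Ex_wsum (f : seq 'I_n -> graph -> R) L :
  Ex T (fun A => wsum L (fun s => f s A)) = wsum L (fun s => Ex T (f s)).
Proof.
elim: L f => [//|L IH] f /=; rewrite Ex_sum; apply: eq_bigr => j _.
exact: (IH (fun s => f (j :: s))).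
Qed.

(** Closedness of the walks is dropped in the bound: it is summed over all walks from [i], and the
    weight of the starting vertex cancels the factor [z * r2] in the denominator. *)
Lemma Ex_trace q z : 0 < z <= 1 ->
  Ex T (fun A => \tr (mpow (noise0 A) (2 * q))) <=
  n%:R * ((z ^+ q)^-1 * (n%:R * (z * r2) + (2 * q + 1)%:R) ^+ (2 * q)).
Proof.
move=> z01; have /andP[z0 _] := z01.
rewrite [X in Ex T X](_ : _ = (fun A => \sum_i wsum (2 * q) (fun s =>
    wprod (noise0 A) i s * (last i s == i)%:R))); last first.
  by apply/funext => A; apply: eq_bigr => i _; rewrite mpow_walk.
rewrite Ex_sum; set b := (z ^+ q)^-1 * _.
have -> : n%:R * b = \sum_(i < n) b by rewrite sumr_const card_ord mulr_natl.
apply: ler_sum => i _; rewrite /b.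
rewrite (Ex_wsum (fun s A => wprod (noise0 A) i s * (last i s == i)%:R)).
have za0 : 0 < z * r2 by rewrite mulr_gt0.
apply: (@le_trans _ _ (wsum (2 * q) (fun s => (z * r2 * z ^+ q)^-1 *
    (z * r2) ^+ size (undup (s ++ [:: i]))))).
  apply: wsum_le => s sq.
  have -> : size (undup (s ++ [:: i])) = size (undup (i :: s)).
    by apply/perm_size/perm_undup => k; rewrite mem_cat !inE orbC.
  case: eqP => _.
    rewrite (_ : (fun A => _) = (fun A => wprod (noise0 A) i s)); first exact: Ex_wprod.
    by apply/funext => A; rewrite mulr1.
  rewrite (_ : (fun A => _) = (fun=> 0)); last by apply/funext => A; rewrite mulr0.
  rewrite Ex_cst mulr_ge0 ?invr_ge0 ?exprn_ge0 ?mulr_ge0 ?exprn_ge0 ?ltW //.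
rewrite wsumZ.
have c0 : 0 <= (z * r2 * z ^+ q)^-1 by rewrite invr_ge0 ?mulr_ge0 ?exprn_ge0 ?ltW.
apply: (le_trans (ler_wpM2l c0 (wsum_visited _ _ (ltW za0)))).
rewrite [size (undup [:: i])]/= expr1 [leLHS]mulrA.
have -> // : (z * r2 * z ^+ q)^-1 * (z * r2) = (z ^+ q)^-1.
by rewrite invfM mulrAC mulVf ?gt_eqF // mul1r.
Qed.

Lemma Ex_opn k : let q := (2 ^ k)%N in (2 * q)%:R <= n%:R * r2 ->
  Ex T (fun A => opnorm (noise0 A) ^+ (2 * q)) <= n%:R * (18 * q%:R * (n%:R * r2)) ^+ q.
Proof.
move=> q qn; have q0 : (0 < q)%N by rewrite expn_gt0.
apply: (@le_trans _ _ (Ex T (fun A => \tr (mpow (noise0 A) (2 * q))))).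
  by apply: Ex_le => // A aA; apply: opnorm_pow_trace; rewrite noise0_tr.
(* Balances the two terms in the base of [Ex_trace]: both are then about [2 * q], with sum 4q + 1 <=
   6q, and (6q)^2 / z = 18 q n r2. The hypothesis [qn] says that [z <= 1]. *)
pose z := (2 * q)%:R / (n%:R * r2) : R.
have q0R : 0 < (2 * q)%:R :> R by rewrite ltr0n muln_gt0.
have nr0 : 0 < n%:R * r2 := lt_le_trans q0R qn.
have z01 : 0 < z <= 1 by rewrite divr_gt0 //= ler_pdivrMr // mul1r.
apply: (le_trans (Ex_trace q z01)); rewrite ler_wpM2l ?ler0n //.
have -> : n%:R * (z * r2) = (2 * q)%:R.
  by rewrite mulrCA /z mulrVK ?unitfE ?gt_eqF.
have -> : 18 * q%:R * (n%:R * r2) = z^-1 * (6 * q%:R) ^+ 2.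
  rewrite /z invf_div natrM; field.
  by rewrite pnatr_eq0 -lt0n.
rewrite (exprMn _ z^-1) exprVn -exprM ler_wpM2l ?invr_ge0 //.
  by case/andP: z01 => z0 _; rewrite exprn_ge0 // ltW.
rewrite -natrD -natrM ler_pXn2r ?nnegrE ?ler0n // ?muln_gt0 // ler_nat.
by move: q0; rewrite /q; move: (2 ^ k)%N => q'; lia.
Qed.

End NoiseMoment.

(** * The high-probability event *)

Section GoodEvent.
Variables (R : realType) (n m : nat) (T : 'M[R]_n) (rho : R).
Local Notation graph := {ffun 'I_n * 'I_n -> bool}.
Local Notation l := (ln (n%:R : R)).
Hypothesis T_ge0 : forall i j, 0 <= T i j.
Hypothesis T_le : forall i j, T i j <= rho ^+ 2.
Hypothesis symT : T^T = T.
Hypothesis rho_gt0 : 0 < rho.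
Hypothesis rho_le1 : rho <= 1.
Hypothesis l_ge1 : 1 <= l.
Hypothesis l_small : 4 * l <= n%:R * rho ^+ 2.
Hypothesis m_le : (m <= n)%N.

Let r2_le1 : rho ^+ 2 <= 1.
Proof. by rewrite expr_le1 // ltW. Qed.

Let r2_gt0 : 0 < rho ^+ 2.
Proof. exact: exprn_gt0. Qed.

Let T01 i j : 0 <= T i j <= 1.
Proof. by rewrite T_ge0 (le_trans (T_le i j)). Qed.

Let n_gt0 : 0 < n%:R :> R.
Proof.
rewrite ltr0n lt0n; apply: contraTneq l_ge1 => ->.
by rewrite -ltNge ln0 // ltr01.
Qed.

Let l_gt0 : 0 < l := lt_le_trans ltr01 l_ge1.

Lemma dyadic_between (x : R) : 1 <= x -> exists k, x <= (2 ^ k)%:R <= 2 * x.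
Proof.
move=> x1; have ex : exists k, x <= (2 ^ k)%:R.
  exists (Num.bound x); apply: (@le_trans _ _ (Num.bound x)%:R).
    by rewrite ltW // archi_boundP // (le_trans ler01).
  by rewrite ler_nat ltnW // ltn_expl.
exists (ex_minn ex); case: ex_minnP => k xk mink; rewrite xk /=.
case: k xk mink => [|k] xk mink; first by rewrite expn0; lra.
have : ~~ (x <= (2 ^ k)%:R) by apply/negP => /mink; rewrite ltnn.
by rewrite -ltNge expnS natrM => h; rewrite ler_pM2l // ltW.
Qed.

(** With [q] between [l] and [2 * l], the base 18 q n rho^2 is at most 36 l n rho^2. The extra
    factor e^5 makes Markov's inequality yield n e^(-5q) <= n^-4. *)
Definition opnorm_bound : R := Num.sqrt (36 * expR 5 * l * (n%:R * rho ^+ 2)).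

Let opnorm_event : exists (g : graph -> R), [/\ forall A, 0 <= g A,
   Ex T g <= n%:R ^- 4 & forall A, g A < 1 -> opnorm (noise0 T A) <= opnorm_bound].
Proof.
have [k /andP[k1 k2]] := dyadic_between l_ge1.
set q := (2 ^ k)%N in k1 k2.
pose b := 18 * q%:R * (n%:R * rho ^+ 2).
have q0 : 0 < q%:R :> R by rewrite ltr0n expn_gt0.
have b0 : 0 < b by rewrite !mulr_gt0.
have eb0 : 0 < expR 5 * b by rewrite mulr_gt0 ?expR_gt0.
have bq0 : 0 < (expR 5 * b) ^+ q by rewrite exprn_gt0.
exists (fun A => ((expR 5 * b) ^+ q)^-1 * opnorm (noise0 T A) ^+ (2 * q)); split.
- by move=> A; rewrite mulr_ge0 ?invr_ge0 ?(ltW bq0) // exprn_ge0 // opnorm_ge0.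
- rewrite ExZ ler_pdivrMl //.
  apply: (le_trans (Ex_opn T01 T_le symT r2_gt0 r2_le1 (k := k) _)).
    by rewrite natrM -/q; apply: le_trans l_small; move: k2; lra.
  rewrite -/q -/b (exprMn _ (expR 5) b) [leRHS]mulrAC ler_wpM2r ?exprn_ge0 ?(ltW b0) //.
  rewrite ler_pdivlMr ?exprn_gt0 // -exprS.
  have -> : n%:R ^+ 5 = expR (5%:R * l) :> R by rewrite expRM_natl lnK ?posrE.
  by rewrite -expRM_natl ler_expR [leRHS]mulrC; move: k1; lra.
- move=> A; rewrite ltr_pdivrMl // mulr1 exprM => h.
  have h2 : opnorm (noise0 T A) ^+ 2 < expR 5 * b.
    rewrite -(@ltr_pXn2r _ q) ?nnegrE ?(ltW eb0) ?exprn_ge0 ?opnorm_ge0 ?expn_gt0 //.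
  rewrite -(@ler_pXn2r _ 2) ?nnegrE ?sqrtr_ge0 ?opnorm_ge0 // sqr_sqrtr; last first.
    by rewrite !mulr_ge0 ?expR_ge0 ?ler0n // ltW.
  apply: (le_trans (ltW h2)); rewrite /b.
  have -> : expR 5 * (18 * q%:R * (n%:R * rho ^+ 2)) =
    (18 * expR 5) * q%:R * (n%:R * rho ^+ 2) by ring.
  rewrite ler_wpM2r //; first by rewrite mulr_ge0 ?ler0n ?ltW.
  have -> : 36 * expR 5 * l = (18 * expR 5) * (2 * l) by ring.
  by rewrite ler_wpM2l // mulr_ge0 ?expR_ge0.
Qed.

Variable (selX : 'M[R]_n -> 'M[R]_(n, m)).
Hypothesis selXX : forall B, B^T = B -> (selX B)^T *m selX B = 1%:M.

(** The term [maxrow] in the rate below keeps |s x_j| at most 1/2; [slack] caps the rate so that the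
    variance term 2 rho^2 s^2 is at most l / 2. *)
Let slack := rho / Num.sqrt l.
Let rate (B : 'M[R]_n) : R := (2 * (maxrow (selX B) + slack))^-1.
Let looA i (A : graph) := loo i (adjm A - T).

Let sl_gt0 : 0 < Num.sqrt l. Proof. by rewrite sqrtr_gt0. Qed.
Let slack_gt0 : 0 < slack. Proof. by rewrite divr_gt0. Qed.
Let den_gt0 B : 0 < 2 * (maxrow (selX B) + slack).
Proof. by rewrite mulr_gt0 // ltr_wpDl // maxrow_ge0. Qed.

Let rate_ok (sgn : R) (k : 'I_m) (B : 'M[R]_n) : `|sgn| = 1 -> B^T = B ->
  [/\ forall j, `|sgn * rate B * (col k (selX B)) j 0| <= 1 / 2,
      fnorm2 (col k (selX B)) <= 1 & 2 * rho ^+ 2 * (sgn * rate B) ^+ 2 <= l / 2].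
Proof.
move=> s1 sB; have d0 := den_gt0 B; split.
- move=> j; rewrite !normrM s1 !mul1r (ger0_norm (_ : 0 <= rate B)) ?invr_ge0 ?(ltW d0) // /rate.
  rewrite ler_pdivrMl // mxE.
  have := fnorm_entry_le (row j (selX B)) 0 k; rewrite mxE.
  have := maxrow_ge (selX B) j; have := slack_gt0; lra.
- have -> : fnorm2 (col k (selX B)) = ((selX B)^T *m selX B) k k.
    rewrite mxE /fnorm2 /fdot; apply: eq_bigr => j _.
    by rewrite big_ord1 !mxE.
  by rewrite selXX // mxE eqxx.
- rewrite exprMn -(real_normK (num_real sgn)) s1 expr1n mul1r.
  have h : rate B <= (2 * slack)^-1.
    have s0 := slack_gt0; have M0 := maxrow_ge0 (selX B).
    by rewrite /rate lef_pV2 ?posrE //; lra.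
  have h2 : rate B ^+ 2 <= (2 * slack)^-1 ^+ 2.
    have rate0 : 0 <= rate B by rewrite invr_ge0 ltW.
    by rewrite ler_pXn2r ?nnegrE // (le_trans rate0 h).
  apply: (@le_trans _ _ (2 * rho ^+ 2 * (2 * slack)^-1 ^+ 2)).
    by rewrite ler_wpM2l // mulr_ge0 // ltW.
  have -> : (2 * slack)^-1 ^+ 2 = l / (4 * rho ^+ 2).
    rewrite /slack -[in RHS](sqr_sqrtr (ltW l_gt0)); field.
    by rewrite !gt_eqF.
  by rewrite le_eqVlt; apply/orP; left; apply/eqP; field; rewrite gt_eqF.
Qed.

(** The shift 13/2 l leaves l/2 - 13/2 l = -6 l in the exponent, hence probability n^-6, small
    enough for a union over at most n^2 entries. Divided by the rate, it gives the deviation 13 l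
    (maxrow + slack). *)
Let tail (sgn : R) i k (A : graph) : R :=
  expR (sgn * rate (looA i A) * edge_sum T i (col k (selX (looA i A))) A - 13 / 2 * l).

Let tail_Ex sgn i k : `|sgn| = 1 -> Ex T (tail sgn i k) <= n%:R ^- 6.
Proof.
move=> s1; rewrite /tail.
have -> : Ex T (fun A => expR (sgn * rate (looA i A) *
     edge_sum T i (col k (selX (looA i A))) A - 13 / 2 * l)) =
   expR (- (13 / 2 * l)) * Ex T (fun A => let B := loo i (adjm A - T) in
    expR (sgn * rate B * edge_sum T i (col k (selX B)) A)).
  by rewrite -ExZ; apply: eq_Ex => A _; rewrite expRD mulrC.
have h := @Ex_exp_edge_sum_loo _ _ _ _ T01 T_le symT i (fun B => col k (selX B))
  (fun B => sgn * rate B) (l / 2) (fun B sB => rate_ok k s1 sB).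
apply: (le_trans (ler_wpM2l (expR_ge0 _) h)); rewrite -expRD.
have -> : n%:R ^- 6 = expR (- (6%:R * l)) :> R.
  by rewrite expRN expRM_natl lnK ?posrE.
by rewrite ler_expR; lra.
Qed.

Let tail_lt1 sgn i k A : tail sgn i k A < 1 ->
  sgn * edge_sum T i (col k (selX (looA i A))) A <=
    13 * (l * maxrow (selX (looA i A)) + rho * Num.sqrt l).
Proof.
rewrite /tail expR_lt1 subr_lt0 => /ltW.
set x := edge_sum _ _ _ _; set B := looA i A.
have d0 := den_gt0 B; rewrite {1}/rate mulrAC mulrC ler_pdivrMl //.
move=> h; apply: (le_trans h); rewrite le_eqVlt; apply/orP; left; apply/eqP.
have -> : rho * Num.sqrt l = slack * l.
  rewrite /slack -[X in _ = _ * X](sqr_sqrtr (ltW l_gt0)); field.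
  by rewrite gt_eqF.
by field.
Qed.

Let row_event (A : graph) i : admissible A ->
  (forall k, tail 1 i k A < 1) -> (forall k, tail (-1) i k A < 1) ->
  fnorm (row i (adjm A - T) *m selX (looA i A)) <=
    Num.sqrt m%:R * (14 * (l * maxrow (selX (looA i A))) + 13 * (rho * Num.sqrt l)).
Proof.
move=> aA hp hm; set X := selX _; set M := maxrow X.
have M0 : 0 <= M := maxrow_ge0 X.
set b := 14 * _ + _.
have entry k : `|(row i (adjm A - T) *m X) 0 k| <= b.
  have -> : (row i (adjm A - T) *m X) 0 k =
      edge_sum T i (col k X) A + (- T i i) * X i k.
    rewrite mxE (bigD1 i) //= addrC; congr (_ + _).
      by apply: eq_bigr => j _; rewrite !mxE.
    have [_ dA] := admissibleP _ aA.
    by rewrite !mxE dA sub0r.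
  apply: (le_trans (ler_normD _ _)).
  have h1 : `|edge_sum T i (col k X) A| <= 13 * (l * M + rho * Num.sqrt l).
    have := tail_lt1 (hp k); have := tail_lt1 (hm k).
    rewrite -/X -/M mul1r mulN1r ler_norml; move=> ? ?; apply/andP; split; lra.
  (* The deterministic diagonal entry contributes at most [M], hence at most [l * M], which turns 13
     into 14. *)
  have h2 : `|- T i i * X i k| <= l * M.
    rewrite normrM normrN; apply: ler_pM => //.
      by have /andP[t0 t1] := T01 i i; rewrite ger0_norm // (le_trans t1).
    apply: le_trans (maxrow_ge X i).
    by have := fnorm_entry_le (row i X) 0 k; rewrite mxE.
  by rewrite /b; move: h1 h2; lra.
have b0 : 0 <= b.
  by rewrite /b addr_ge0 // mulr_ge0 // mulr_ge0 // ?sqrtr_ge0 // ltW.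
rewrite -{1}(ger0_norm b0) -[X in _ * X]sqrtr_sqr -sqrtrM ?ler0n //.
rewrite ler_sqrt ?mulr_ge0 ?ler0n ?sqr_ge0 // /fnorm2 /fdot big_ord1.
apply: (@le_trans _ _ (\sum_(k < m) b ^+ 2)); last first.
  by rewrite sumr_const card_ord mulr_natl.
apply: ler_sum => k _; rewrite -expr2 -[leLHS](real_normK (num_real _)).
by rewrite ler_pXn2r ?nnegrE.
Qed.

(** [selX] is a function of the matrix, so its value at [loo i] ignores the edges at [i]. The
    failure probability is n^-4 for the operator norm plus 2 n m n^-6 <= 2 n^-4 for both signs of
    all entries. *)
Theorem good_event (E : graph -> Prop) :
  (forall A, admissible A -> opnorm (adjm A - T) <= opnorm_bound + rho ^+ 2 ->
     (forall i, fnorm (row i (adjm A - T) *m selX (loo i (adjm A - T))) <=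
        Num.sqrt m%:R * (14 * (l * maxrow (selX (loo i (adjm A - T)))) +
                         13 * (rho * Num.sqrt l))) -> E A) ->
  1 - 3 * n%:R ^- 4 <= Prob T E.
Proof.
move=> hE; have [g1 [g10 g1E g1b]] := opnorm_event.
pose g A := g1 A + \sum_i \sum_k (tail 1 i k A + tail (-1) i k A).
have tail0 sgn i k A : 0 <= tail sgn i k A by exact: expR_ge0.
have inner0 A i : 0 <= \sum_k (tail 1 i k A + tail (-1) i k A).
  by apply: sumr_ge0 => k _; rewrite addr_ge0.
apply: (Prob_ge T01 (g := g)) => [A aA|A aA gA|].
- by rewrite addr_ge0 // sumr_ge0.
- have g1lt : g1 A < 1.
    by apply: le_lt_trans gA; rewrite lerDl sumr_ge0.
  have both i k : tail 1 i k A + tail (-1) i k A < 1.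
    apply: le_lt_trans gA; rewrite /g (bigD1 i) //= (bigD1 k) //=.
    have aux (a b c e : R) : 0 <= a -> 0 <= c -> 0 <= e -> b <= a + (b + c + e) by lra.
    by apply: aux => //; apply: sumr_ge0 => // k' _; rewrite addr_ge0.
  apply: hE => // [|i].
    have -> : adjm A - T = noise0 T A - diag_mx (\row_i T i i).
      apply/matrixP => i j; rewrite !mxE; case: eqP => [->|_]; last by rewrite mulr0n subr0.
      by have [_ ->] := admissibleP _ aA; rewrite mulr1n.
    apply: le_trans (opnormD _ _) _; rewrite opnormN; apply: lerD; first exact: g1b.
    apply: opnorm_le => [|v]; first exact: ltW.
    by apply: fnorm_diag_le => [|j]; rewrite ?(ltW r2_gt0) // mxE ger0_norm.
  apply: row_event => // k; apply: le_lt_trans (both i k); first by rewrite lerDl.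
  by rewrite lerDr.
- rewrite /g ExD Ex_sum.
  under eq_bigr => i _.
    rewrite Ex_sum; under eq_bigr do rewrite ExD.
    over.
  apply: (@le_trans _ _ (n%:R ^- 4 + \sum_(i < n) \sum_(k < m) 2 * n%:R ^- 6)).
    apply: lerD => //; apply: ler_sum => i _; apply: ler_sum => k _.
    have h1 := @tail_Ex 1 i k (normr1 _); have h2 := @tail_Ex (-1) i k (normrN1 _).
    by move: h1 h2; lra.
  have -> : \sum_(i < n) \sum_(k < m) 2 * n%:R ^- 6 = n%:R * (m%:R * (2 * n%:R ^- 6)) :> R.
    by rewrite !(sumr_const, card_ord) !mulr_natl.
  have : m%:R * (2 * n%:R ^- 6) <= n%:R * (2 * n%:R ^- 6) :> R.
    by rewrite ler_wpM2r ?ler_nat // mulr_ge0 // invr_ge0 exprn_ge0 // ltW.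
  move/(ler_wpM2l (ltW n_gt0)).
  have -> : n%:R * (n%:R * (2 * n%:R ^- 6)) = 2 * n%:R ^- 4 :> R.
    by field; rewrite gt_eqF.
  lra.
Qed.

End GoodEvent.

(** * Recovery *)

Section Thresholding.
Variables (R : realType) (n K : nat) (c : 'I_n -> 'I_K) (L : 'M[R]_(n, K)).
Hypothesis gram_unit : forall k, gramk c L k \in unitmx.
Variables (X : 'M[R]_(n, K ^ 2)) (d : 'I_(K ^ 2) -> R).
Hypothesis eX : eigdecomp (Theta c L) X d.
Hypothesis d_neq0 : forall j, d j != 0.
Variables (phi1 phi2 : R).
Hypothesis phi1_gt0 : 0 < phi1.
Hypothesis phi1_le1 : phi1 <= 1.
Hypothesis phi2_gt0 : 0 < phi2.
Variable Xh : 'M[R]_(n, K ^ 2).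
Hypothesis XXh : Xh^T *m Xh = 1%:M.
Hypothesis close : forall i, fnorm (row i (proj Xh - proj X)) <= phi1 * phi2 / 16.

(** Rows of norm at least [phi2] have relative error at most [phi1 / 16], and [cosr_perturb]
    multiplies it by 4. *)
Lemma tauX_stable i j : phi2 <= fnorm (row i X) -> phi2 <= fnorm (row j X) ->
  `|tauX Xh i j - tauX X i j| <= phi1 / 4.
Proof.
have [XX _] := eX => hi hj.
have near k : phi2 <= fnorm (row k X) -> row k (proj X) != 0 /\
    fnorm (row k (proj Xh) - row k (proj X)) <= phi1 / 16 * fnorm (row k (proj X)).
  move=> hk; have nk : fnorm (row k (proj X)) = fnorm (row k X) by rewrite fnorm_row_proj.
  split; first by apply/eqP => k0; move: hk; rewrite -nk k0 fnorm0 leNgt phi2_gt0.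
  rewrite -rowB nk; apply: (le_trans (close k)).
  have := ler_wpM2l (ltW phi1_gt0) hk; lra.
have [i0 di] := near i hi; have [j0 dj] := near j hj.
have e1 : phi1 / 16 < 1 by move: phi1_le1; lra.
have h := cosr_perturb i0 j0 e1 di dj.
rewrite /tauX -(cosr_proj i j XXh) -(cosr_proj i j XX).
by apply: (le_trans (ler_dist_dist _ _)); apply: (le_trans h); lra.
Qed.

(** The threshold [phi1 / 2] separates the values at least 3/4 phi1 inside a community from those at
    most [phi1 / 4] across, where the exact cosine is 0. *)
Lemma ttau_correct i j : phi2 <= fnorm (row i X) -> phi2 <= fnorm (row j X) ->
  (c j == c i -> phi1 <= tauX X i j) ->
  ttau Xh (phi1 / 2) i 0 j = (c j == c i)%:R.
Proof.
move=> hi hj same; have := tauX_stable hi hj; rewrite ler_norml => /andP[h1 h2].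
rewrite mxE; move: h1 h2; case: eqP => [cji|cji].
  have := same (introT eqP cji) => s1 h1 _.
  have -> // : phi1 / 2 <= tauX Xh i j by move: phi1_gt0; lra.
have -> : tauX X i j = 0.
  rewrite /tauX cosrE (fdot_row_popularity gram_unit eX d_neq0).
  by rewrite eq_sym; case: eqP => // _; rewrite mul0r normr0.
move=> _ h2; case: ifP => // h3; exfalso; move: h2 h3 phi1_gt0; lra.
Qed.

(** For [i] in both [I] and [H], a wrong entry [j] lies outside [I], or in the community of [i] but
    outside [G i]. Each of the other rows has at most [n] wrong entries. *)
Lemma ttau_mismatch (I H : {set 'I_n}) (G : 'I_n -> {set 'I_n}) (b : R) : 0 <= b ->
  (forall i, i \in I -> phi2 <= fnorm (row i X)) ->
  (forall i j, j \in G i -> phi1 <= tauX X i j) ->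
  (forall i, i \in H -> #|[set j | c j == c i] :\: G i|%:R <= b) ->
  \sum_i fnorm2 (ttau Xh (phi1 / 2) i - comm_row R c i) <=
    n%:R * (#|~: I|%:R + b) + (#|~: I| + #|~: H|)%:R * n%:R.
Proof.
move=> b0 hI hG hH; set V := ttau _ _.
have sE i : fnorm2 (V i - comm_row R c i) = \sum_j (V i 0 j - (c j == c i)%:R) ^+ 2.
  by rewrite fnorm2_subE; apply: eq_bigr => j _; rewrite [comm_row _ _ _ _ _]mxE.
have le1 i j : (V i 0 j - (c j == c i)%:R) ^+ 2 <= 1.
  by rewrite mxE; case: (c j == c i); case: ifP => _ /=;
    rewrite ?subrr ?subr0 ?sub0r ?sqrrN ?expr1n ?expr0n.
have good i : i \in I -> i \in H -> fnorm2 (V i - comm_row R c i) <= #|~: I|%:R + b.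
  move=> iI iH; rewrite sE.
  apply: (@le_trans _ _ (\sum_j ((j \in ~: I)%:R +
      (j \in [set j | c j == c i] :\: G i)%:R))).
    apply: ler_sum => j _; have [jI|jI] := boolP (j \in I); last first.
      by rewrite inE jI; apply: (le_trans (le1 i j)); rewrite lerDl.
    rewrite !inE jI add0r andbC; have [cji|cji] /= := boolP (c j == c i); last first.
      have := ttau_correct (hI _ iI) (hI _ jI); rewrite (negbTE cji) => e.
      by rewrite /V e // subrr expr0n.
    have [jG|jG] /= := boolP (j \in G i); last by have := le1 i j; rewrite cji.
    have := ttau_correct (hI _ iI) (hI _ jI); rewrite cji => e.
    by rewrite /V e ?subrr ?expr0n // => _; exact: hG.
  have card (S : {set 'I_n}) : \sum_j (j \in S)%:R = #|S|%:R :> R.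
    by rewrite -sum1_card natr_sum [RHS]big_mkcond; apply: eq_bigr => j _; case: (j \in S).
  by rewrite big_split /= !card lerD2l hH.
have bad i : fnorm2 (V i - comm_row R c i) <= n%:R.
  rewrite sE; apply: (@le_trans _ _ (\sum_(j < n) 1)); first exact: ler_sum.
  by rewrite sumr_const card_ord.
rewrite (bigID (fun i => (i \in I) && (i \in H))) /=; apply: lerD.
  apply: (@le_trans _ _ (\sum_(i < n) (#|~: I|%:R + b))).
    rewrite [leRHS](bigID (fun i => (i \in I) && (i \in H))) /= -[leLHS]addr0.
    apply: lerD; last by apply: sumr_ge0 => i _; rewrite addr_ge0.
    by apply: ler_sum => i /andP[]; apply: good.
  by rewrite sumr_const card_ord mulr_natl.
apply: (@le_trans _ _ (\sum_(i in ~: I :|: ~: H) n%:R)).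
  rewrite [leRHS](eq_bigl (fun i => ~~ ((i \in I) && (i \in H)))); last first.
    by move=> i; rewrite !inE negb_and.
  exact: ler_sum.
rewrite sumr_const -[leLHS]mulr_natl ler_wpM2r // ler_nat.
by rewrite cardsU leq_subr.
Qed.

End Thresholding.

(** The leave-one-out bases must be functions of the perturbation for the independence argument; the
    basis used by the algorithm remains arbitrary. *)
Lemma top_eig_select (R : realType) n m (Th : 'M[R]_n) : Th^T = Th -> (m <= n)%N ->
  exists sel : 'M[R]_n -> 'M[R]_(n, m),
    forall B, B^T = B -> exists mu, top_eig (Th + B) (sel B) mu.
Proof.
move=> sTh mn.
have ex B : exists X : 'M[R]_(n, m), B^T = B -> exists mu, top_eig (Th + B) X mu.
  have [sB|nsB] := eqVneq B^T B; last by exists 0 => /eqP; rewrite (negbTE nsB).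
  have [|X [mu h]] := @top_eig_exists R n (Th + B) m _ mn.
    by rewrite linearD /= sTh sB.
  by exists X => _; exists mu.
by have [sel h] := choice ex; exists sel.
Qed.

Lemma smin_le (R : realType) m (d : 'I_m -> R) j : smin d <= `|d j|.
Proof. exact: bigmin_le_cond. Qed.

Lemma smin_gt0 (R : realType) m (d : 'I_m -> R) : (0 < m)%N ->
  (forall j, d j != 0) -> 0 < smin d.
Proof.
move=> m0 d0; apply: lt_bigmin => [|j _]; last by rewrite normr_gt0.
apply: (@lt_le_trans _ _ `|d (Ordinal m0)|); first by rewrite normr_gt0.
exact: le_bigmax.
Qed.

(* [c_opn] bounds the operator norm of [adjm A - Theta c L] in units of
   [rho * sqrt (n * ln n)], and [c_row] the row norms of the difference of the two
   projections in units of [rho * K * sqrt (ln n) / smin d]. *)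
Definition c_opn (R : realType) : R := 6 * Num.sqrt (expR 5) + 1.
Definition c_row (R : realType) (Cmax : R) : R := 4 * (c_opn R * Num.sqrt Cmax + 13).

Section Recovery.
Variables (R : realType) (eps CA1 Cmax Cphi CA2 C2 : R) (n K : nat).
Variables (c : 'I_n -> 'I_K) (L0 : 'M[R]_(n, K)) (rho phi1 phi2 eta0 eta1 eta2 : R).
Variables (X : 'M[R]_(n, K ^ 2)) (d : 'I_(K ^ 2) -> R).
Local Notation l := (ln (n%:R : R)).
Local Notation L := (rho *: L0).
Local Notation C0 := (c_opn R).
Local Notation C3 := (c_row Cmax).
Hypothesis eps_gt0 : 0 < eps.
Hypothesis CA1_ge1 : 1 <= CA1.
Hypothesis Cmax_gt0 : 0 < Cmax.
Hypothesis Cphi_gt0 : 0 < Cphi.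
Hypothesis CA2_ge : 196 <= CA2.
Hypothesis C2_ge : 16 * C3 + 100 * C0 * Cphi <= C2.
Hypothesis K_ge2 : (2 <= K)%N.
Hypothesis L0_01 : forall i k, 0 < L0 i k < 1.
Hypothesis rho_01 : 0 < rho <= 1.
Hypothesis l_ge1 : 1 <= l.
Hypothesis eX : eigdecomp (Theta c L) X d.
Hypothesis d_neq0 : forall j, d j != 0.
Hypothesis gram_unit : forall k, gramk c L k \in unitmx.
Hypothesis A1 : forall k, n%:R / (CA1 * K%:R) <= (nk c k)%:R <= CA1 * n%:R / K%:R.
Hypothesis A2 : CA2 * l ^+ 2 <= n%:R * rho ^+ 2 / K%:R ^+ 2.
Hypothesis phi1_01 : 0 < phi1 <= 1.
Let G i := [set j | (c j == c i) && (phi1 <= `|tauX X i j|)].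
Let H := [set i | (nk c (c i))%:R * (1 - eta0) <= #|G i|%:R].
Hypothesis A3 : #|~: H|%:R <= eta1 * n%:R.
Let dp i := DP c L (c i) (row i L) (row i L).
Let I := [set i | phi2 <= Num.sqrt (dp i)].
Hypothesis A4 : n%:R * (1 - eta2) < #|I|%:R.
Hypothesis A4' : forall i, dp i <= Cmax * K%:R ^+ 2 / n%:R.
Hypothesis phi_le : phi1 * phi2 <= Cphi * K%:R / Num.sqrt n%:R.
Hypothesis phi_ge : C2 * rho * K%:R * Num.sqrt l / smin d <= phi1 * phi2.

(** The bound of [kmeans_loss] for [sep = 2 n / (CA1 K)] and the mismatch count of [ttau_mismatch].
    Absolute values appear because the sequences may be negative. *)
Definition error_rate : R :=
  4 * (2 + eps) * CA1 * (K%:R * (2 * `|eta2| + `|eta1|) + CA1 * `|eta0|).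
Hypothesis rate_small : CA1 * (K%:R * error_rate) < 1.

Let rho0 : 0 < rho. Proof. by case/andP: rho_01. Qed.
Let rho1 : rho <= 1. Proof. by case/andP: rho_01. Qed.
Let l_gt0 : 0 < l := lt_le_trans ltr01 l_ge1.
Let n_gt0 : 0 < n%:R :> R.
Proof.
rewrite ltr0n lt0n; apply: contraTneq l_ge1 => ->.
by rewrite -ltNge ln0 // ltr01.
Qed.
Let K_gt0 : 0 < K%:R :> R. Proof. by rewrite ltr0n (leq_trans _ K_ge2). Qed.
Let sn := Num.sqrt (n%:R : R).
Let sl := Num.sqrt l.
Let sn0 : 0 < sn. Proof. by rewrite sqrtr_gt0. Qed.
Let sl0 : 0 < sl. Proof. by rewrite sqrtr_gt0. Qed.
Let sl1 : 1 <= sl. Proof. by rewrite -sqrtr1 ler_sqrt // ltW. Qed.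
Let sn1 : 1 <= sn.
Proof. by rewrite -sqrtr1 ler_sqrt ?(ltW n_gt0) // ler1n -(ltr0n R). Qed.
Let snn : sn ^+ 2 = n%:R. Proof. by rewrite sqr_sqrtr // ltW. Qed.
Let sll : sl ^+ 2 = l. Proof. by rewrite sqr_sqrtr // ltW. Qed.
Let C0_ge1 : 1 <= C0. Proof. by rewrite lerDr mulr_ge0 // sqrtr_ge0. Qed.
Let C3_ge0 : 0 <= C3.
Proof.
by rewrite mulr_ge0 // addr_ge0 // mulr_ge0 ?sqrtr_ge0 // (le_trans ler01).
Qed.

Let sg := smin d.
Let sg0 : 0 < sg.
Proof. by apply: smin_gt0 => //; rewrite expn_gt0 (leq_trans _ K_ge2). Qed.

(** The constant 196 is 14^2: the resulting bound 14 K l <= rho sqrt n absorbs the linear term of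
    the row bound in [good_event] into [t * maxrow], and also yields [Kn] and [l_small]. *)
Let A2K : (14 * K%:R * l) ^+ 2 <= (rho * sn) ^+ 2.
Proof.
rewrite [leRHS]exprMn snn [leRHS]mulrC.
have -> : (14 * K%:R * l) ^+ 2 = 196 * l ^+ 2 * K%:R ^+ 2 by ring.
rewrite -ler_pdivlMr ?exprn_gt0 //; apply: le_trans A2.
by rewrite ler_wpM2r // sqr_ge0.
Qed.

Let A2l : 14 * K%:R * l <= rho * sn.
Proof.
move: A2K; rewrite ler_pXn2r // nnegrE ?mulr_ge0 ?ler0n // ltW //.
Qed.

Let t := C0 * rho * sn * sl.
Let t0 : 0 <= t.
Proof. by rewrite !mulr_ge0 ?(ltW sn0) ?(ltW sl0) ?(ltW rho0) // (le_trans ler01). Qed.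

Let opnorm_bound_le : opnorm_bound n rho + rho ^+ 2 <= t.
Proof.
have -> : opnorm_bound n rho = 6 * Num.sqrt (expR 5) * (rho * sn * sl).
  rewrite /opnorm_bound -sll -snn.
  have -> : 36 * expR 5 * sl ^+ 2 * (sn ^+ 2 * rho ^+ 2) =
    (6 * Num.sqrt (expR 5) * (rho * sn * sl)) ^+ 2 :> R.
    by rewrite -[in LHS](sqr_sqrtr (expR_ge0 5)); ring.
  rewrite sqrtr_sqr ger0_norm // !mulr_ge0 ?sqrtr_ge0 // ltW //.
have -> : t = 6 * Num.sqrt (expR 5) * (rho * sn * sl) + rho * (sn * sl).
  by rewrite /t /c_opn; ring.
rewrite lerD2l expr2.
rewrite ler_wpM2l ?(ltW rho0) //; apply: le_trans rho1 _.
by rewrite -[leLHS]mulr1 ler_pM.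
Qed.

Let phi1_gt0 : 0 < phi1. Proof. by case/andP: phi1_01. Qed.

Let C2_pos : 0 < C2.
Proof.
have : 0 < C0 * Cphi by rewrite mulr_gt0 // (lt_le_trans ltr01 C0_ge1).
move: C3_ge0 C2_ge; rewrite -[100 * C0 * Cphi]mulrA; lra.
Qed.

Let phi12_gt0 : 0 < phi1 * phi2.
Proof. by apply: lt_le_trans phi_ge; rewrite divr_gt0 // !mulr_gt0. Qed.

Let phi2_gt0 : 0 < phi2.
Proof. by move: phi12_gt0; rewrite pmulr_rgt0. Qed.

(** Chaining the two bounds on [phi1 * phi2] cancels [K] and leaves C2 rho sqrt(n l) <= Cphi sg;
    then [C2 >= 100 * C0 * Cphi] suffices. *)
Let t_small : t <= sg / 100.
Proof.
have h := le_trans phi_ge phi_le; rewrite -/sl -/sn -/sg in h.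
have h1 : C2 * (rho * sl * sn) <= Cphi * sg.
  move: h; rewrite ler_pdivrMr // [leRHS]mulrAC ler_pdivlMr //.
  have -> : C2 * rho * K%:R * sl * sn = K%:R * (C2 * (rho * sl * sn)) by ring.
  have -> : Cphi * K%:R * sg = K%:R * (Cphi * sg) by ring.
  by rewrite ler_pM2l.
have h2 : 100 * C0 * Cphi * (rho * sl * sn) <= C2 * (rho * sl * sn).
  rewrite ler_wpM2r ?mulr_ge0 ?(ltW rho0) ?(ltW sl0) ?(ltW sn0) //.
  by apply: le_trans C2_ge; rewrite lerDr mulr_ge0.
have := le_trans h2 h1.
have -> : 100 * C0 * Cphi * (rho * sl * sn) = Cphi * (100 * t) by rewrite /t; ring.
by rewrite ler_pM2l //; lra.
Qed.

Let Th_ge0 i j : 0 <= Theta c L i j.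
Proof.
have h k j' : 0 <= L k j'.
  by rewrite mxE mulr_ge0 ?(ltW rho0) //; case/andP: (L0_01 k j') => /ltW.
by rewrite mxE mulr_ge0.
Qed.

Let Th_le i j : Theta c L i j <= rho ^+ 2.
Proof.
have h k j' : 0 <= L k j' <= rho.
  rewrite mxE; have /andP[p q] := L0_01 k j'.
  by rewrite mulr_ge0 ?(ltW rho0) ?(ltW p) //= ler_piMr ?(ltW rho0) // ltW.
have /andP[? ?] := h i (c j); have /andP[? ?] := h j (c i).
by rewrite mxE expr2 ler_pM.
Qed.

Let Kn : (K ^ 2 <= n)%N.
Proof.
rewrite -(ler_nat R) natrX.
have : K%:R ^+ 2 <= (rho * sn) ^+ 2.
  apply: le_trans A2K; rewrite ler_pXn2r ?nnegrE ?mulr_ge0 ?ler0n ?(ltW l_gt0) //.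
  have -> : 14 * K%:R * l = K%:R * (14 * l) by ring.
  by rewrite ler_peMr ?ler0n //; move: l_ge1; lra.
move=> h; apply: (le_trans h); rewrite exprMn snn ler_piMl ?ler0n //.
by rewrite expr_le1 // ltW.
Qed.

Let l_small : 4 * l <= n%:R * rho ^+ 2.
Proof.
have e : n%:R * rho ^+ 2 = (rho * sn) ^+ 2 by rewrite exprMn snn mulrC.
rewrite e; apply: le_trans A2K.
have K1 : 1 <= K%:R :> R by rewrite ler1n (leq_trans _ K_ge2).
have h1 : 4 * l <= 14 * K%:R * l.
  by rewrite ler_wpM2r ?(ltW l_gt0) //; move: K1; lra.
apply: (le_trans h1); rewrite expr2 ler_peMr //.
  by rewrite !mulr_ge0 ?ler0n ?(ltW l_gt0).
have : 1 * 1 <= K%:R * l by rewrite ler_pM.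
rewrite -mulrA; lra.
Qed.

Let row_le i : fnorm (row i X) <= Num.sqrt Cmax * K%:R / sn.
Proof.
rewrite (fnorm_row_popularity gram_unit eX d_neq0).
have -> : Num.sqrt Cmax * K%:R / sn = Num.sqrt (Cmax * K%:R ^+ 2 / n%:R).
  rewrite sqrtrM ?mulr_ge0 ?sqr_ge0 ?(ltW Cmax_gt0) // sqrtrM ?(ltW Cmax_gt0) //.
  by rewrite sqrtr_sqr ger0_norm ?ler0n // sqrtrV // ltW.
rewrite ler_sqrt ?A4' //.
by rewrite mulr_ge0 ?invr_ge0 ?ler0n // mulr_ge0 ?sqr_ge0 // ltW.
Qed.

Let card_I : #|~: I|%:R <= n%:R * `|eta2|.
Proof.
have : #|I|%:R + #|~: I|%:R = n%:R :> R by rewrite -natrD cardsC card_ord.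
have : n%:R * eta2 <= n%:R * `|eta2| by rewrite ler_wpM2l ?ler0n // ler_norm.
by move: A4; rewrite mulrBr mulr1; lra.
Qed.

Let card_H : #|~: H|%:R <= n%:R * `|eta1|.
Proof.
by apply: (le_trans A3); rewrite mulrC ler_wpM2l ?ler0n // ler_norm.
Qed.

Let card_G i : i \in H ->
  #|[set j | c j == c i] :\: G i|%:R <= CA1 * n%:R / K%:R * `|eta0|.
Proof.
rewrite inE => h; have sub : G i \subset [set j | c j == c i].
  by apply/fintype.subsetP => j; rewrite !inE => /andP[].
rewrite cardsD (finset.setIidPr sub) natrB ?subset_leq_card // -/(nk c (c i)).
apply: (@le_trans _ _ ((nk c (c i))%:R * `|eta0|)).
  have : (nk c (c i))%:R * eta0 <= (nk c (c i))%:R * `|eta0| :> R.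
    by rewrite ler_wpM2l ?ler0n // ler_norm.
  by move: h; rewrite mulrBr mulr1; lra.
by rewrite ler_wpM2r //; case/andP: (A1 (c i)).
Qed.

Let loss_of_close (Xh : 'M[R]_(n, K ^ 2)) (ch : 'I_n -> 'I_K) :
  Xh^T *m Xh = 1%:M ->
  (forall i, fnorm (row i (proj Xh - proj X)) <= phi1 * phi2 / 16) ->
  kmeans_approx eps (ttau Xh (phi1 / 2)) ch -> loss c ch <= error_rate.
Proof.
move=> XXh close hk; have phi1_le1 : phi1 <= 1 by case/andP: phi1_01.
have b0 : 0 <= CA1 * n%:R / K%:R * `|eta0|.
  by rewrite mulr_ge0 // divr_ge0 ?ler0n // mulr_ge0 ?ler0n // (le_trans ler01).
have hI i : i \in I -> phi2 <= fnorm (row i X).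
  by rewrite inE (fnorm_row_popularity gram_unit eX d_neq0).
have hG i j : j \in G i -> phi1 <= tauX X i j.
  by rewrite inE => /andP[_]; rewrite ger0_norm // normr_ge0.
have := ttau_mismatch gram_unit eX d_neq0 phi1_gt0 phi1_le1 phi2_gt0 XXh close
  b0 hI hG card_G.
set S := \sum_i _ => hS.
pose D := n%:R ^+ 2 * (2 * `|eta2| + `|eta1| + CA1 * `|eta0| / K%:R).
have hD : S <= D.
  apply: (le_trans hS); rewrite natrD.
  have h1 := ler_wpM2l (ltW n_gt0) card_I.
  have h2 := ler_wpM2l (ltW n_gt0) card_H.
  have -> : D = 2 * (n%:R * (n%:R * `|eta2|)) + n%:R * (n%:R * `|eta1|) +
     n%:R * (CA1 * n%:R / K%:R * `|eta0|) by rewrite /D; field; rewrite gt_eqF.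
  by move: h1 h2; rewrite mulrDr mulrDl !(mulrC _ n%:R); lra.
pose sep := 2 * (n%:R / (CA1 * K%:R)).
have CA10 : 0 < CA1 := lt_le_trans ltr01 CA1_ge1.
have sep0 : 0 < sep by rewrite !mulr_gt0 ?invr_gt0 ?mulr_gt0.
have e0 : 0 <= eps := ltW eps_gt0.
have errE : 8 * (2 + eps) * D / sep = error_rate * n%:R.
  by rewrite /D /sep /error_rate; field; rewrite !gt_eqF.
have := kmeans_loss e0 sep0 hk hD _ _; rewrite errE mulfK ?gt_eqF //; apply.
- by move=> k; rewrite ler_pM2l //; case/andP: (A1 k).
- move=> k; case/andP: (A1 k) => h _; apply: lt_le_trans h.
  rewrite ltr_pdivlMr ?mulr_gt0 // mulrAC -ltr_pdivlMr // divff ?gt_eqF //.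
  by rewrite mulrC -mulrA.
Qed.

Theorem recovery :
  1 - 3 * n%:R ^- 4 <= Prob (Theta c L)
    (fun A => forall (Xh : 'M[R]_(n, K ^ 2)) (mu : 'I_(K ^ 2) -> R),
       top_eig (adjm A) Xh mu -> forall ch : 'I_n -> 'I_K,
       kmeans_approx eps (ttau Xh (phi1 / 2)) ch -> loss c ch <= error_rate).
Proof.
have symT := Theta_tr c L.
have [sel hsel] := top_eig_select symT Kn.
have selXX B : B^T = B -> (sel B)^T *m sel B = 1%:M.
  by move=> /hsel[mu [[]]].
apply: (good_event Th_ge0 Th_le symT rho0 rho1 l_ge1 l_small Kn selXX).
move=> A aA hop hrow Xh mu top ch hk; have XXh : Xh^T *m Xh = 1%:M by case: top => -[].
apply: loss_of_close hk => // i.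
set E := adjm A - Theta c L in hop hrow.
have symE : E^T = E := noise_tr symT aA.
have topA : top_eig (Theta c L + E) Xh mu by rewrite /E addrC subrK.
have selB k : exists mu, top_eig (Theta c L + loo k E) (sel (loo k E)) mu.
  exact: hsel (loo_tr k symE).
have [mub hmub] := choice selB.
have sqK : Num.sqrt (K ^ 2)%:R = K%:R :> R by rewrite natrX sqrtr_sqr ger0_norm ?ler0n.
pose a := 13 * (rho * K%:R * sl).
have a0 : 0 <= a by rewrite !mulr_ge0 ?ler0n ?(ltW sl0) ?(ltW rho0).
have noise k : fnorm (row k E *m sel (loo k E)) <= a + t * maxrow (sel (loo k E)).
  apply: (le_trans (hrow k)); rewrite sqK -/sl; set M := maxrow _.
  have M0 : 0 <= M by exact: maxrow_ge0.
  have h : 14 * K%:R * l * M <= t * M.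
    rewrite ler_wpM2r //; apply: (le_trans A2l); rewrite /t.
    have -> : C0 * rho * sn * sl = rho * sn * (C0 * sl) by ring.
    rewrite ler_peMr ?mulr_ge0 ?(ltW rho0) ?(ltW sn0) //.
    by rewrite -[leLHS]mulr1 ler_pM.
  by move: h; rewrite /a; lra.
have := row_perturbation symT eX (Theta_proj gram_unit eX d_neq0) (smin_le d) sg0 symE
  (le_trans hop opnorm_bound_le) t_small topA hmub a0 row_le noise i.
rewrite -/sg; set r := fnorm _ => hr.
(* The factor [sn] of [t] cancels the one in the row norm bound; this is where [c_row] comes
   from. *)
have e1 : 4 * (t * (Num.sqrt Cmax * K%:R / sn) + a) = C3 * (rho * K%:R * sl).
  by rewrite /t /a /c_row; field; rewrite gt_eqF.
have hr2 : r <= C3 * (rho * K%:R * sl) / sg.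
  by rewrite ler_pdivlMr // mulrC -e1.
apply: (le_trans hr2).
have x0 : 0 <= rho * K%:R * sl / sg.
  by rewrite !mulr_ge0 ?invr_ge0 ?ler0n ?(ltW sl0) ?(ltW rho0) ?(ltW sg0).
have h16 : 16 * C3 * (rho * K%:R * sl / sg) <= C2 * (rho * K%:R * sl / sg).
  rewrite ler_wpM2r //; apply: le_trans C2_ge; rewrite lerDl !mulr_ge0 ?(ltW Cphi_gt0) //.
  exact: le_trans C0_ge1.
have := phi_ge; rewrite -/sl -/sg.
have -> : C2 * rho * K%:R * sl / sg = C2 * (rho * K%:R * sl / sg) by rewrite !mulrA.
have -> : C3 * (rho * K%:R * sl) / sg = C3 * (rho * K%:R * sl / sg) by rewrite !mulrA.
by move: h16; lra.
Qed.

End Recovery.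

(** * The error rate vanishes *)

Section ErrorRate.
Variables (R : realType) (eps CA1 CA2 : R) (n K : nat) (rho eta0 eta1 eta2 e : R).
Local Notation l := (ln (n%:R : R)).

(** By (A2), K l <= sqrt(n rho^2), so the scales of (A3) and (A4) are at most 1 / K for [eta0] and 1
    / K^2 for [eta1] and [eta2]. These are the powers of [K] that multiply them in K times the
    rate. *)
Lemma error_rate_small : 0 < eps -> 1 <= CA1 -> 196 <= CA2 -> (0 < K)%N -> 0 < rho -> 1 <= l ->
  0 <= e -> CA2 * l ^+ 2 <= n%:R * rho ^+ 2 / K%:R ^+ 2 ->
  `|eta0| <= e * `|(Num.sqrt (n%:R * rho ^+ 2))^-1 * l| ->
  `|eta1| <= e * `|(n%:R * rho ^+ 2)^-1 * l ^+ 2| ->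
  `|eta2| <= e * `|l ^+ 2 * (n%:R * rho ^+ 2)^-1| ->
  K%:R * error_rate eps CA1 K eta0 eta1 eta2 <= 4 * (2 + eps) * CA1 * (3 + CA1) * e.
Proof.
move=> eps0 CA11 CA2_ge K0 rho0 l1 e0 A2 h0 h1 h2.
have l0 : 0 < l := lt_le_trans ltr01 l1.
have kp : 0 < K%:R :> R by rewrite ltr0n.
set v := n%:R * rho ^+ 2 in A2 h0 h1 h2.
have v_ge : K%:R ^+ 2 * l ^+ 2 <= v.
  have : CA2 * l ^+ 2 * K%:R ^+ 2 <= v by rewrite -ler_pdivlMr ?exprn_gt0.
  apply: le_trans; rewrite mulrC ler_wpM2r ?sqr_ge0 // ler_peMl ?sqr_ge0 //; lra.
have v0 : 0 < v by apply: lt_le_trans v_ge; rewrite mulr_gt0 ?exprn_gt0.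
have w_ge : K%:R * l <= Num.sqrt v.
  have kl0 : 0 <= K%:R * l by rewrite mulr_ge0 ?ltW.
  by rewrite -[leLHS](ger0_norm kl0) -sqrtr_sqr ler_sqrt ?(ltW v0) // exprMn.
have s0 : 0 < Num.sqrt v by rewrite sqrtr_gt0.
have q2 (x : R) : `|x| <= e * (v^-1 * l ^+ 2) -> K%:R ^+ 2 * `|x| <= e.
  move=> hx; apply: (@le_trans _ _ (K%:R ^+ 2 * (e * (v^-1 * l ^+ 2)))).
    by rewrite ler_wpM2l // sqr_ge0.
  have -> : K%:R ^+ 2 * (e * (v^-1 * l ^+ 2)) = e * (K%:R ^+ 2 * l ^+ 2 / v) by ring.
  by rewrite ler_piMr // ler_pdivrMr // mul1r.
have p2 : 0 <= v^-1 * l ^+ 2 by rewrite mulr_ge0 ?invr_ge0 ?sqr_ge0 // ltW.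
rewrite (ger0_norm p2) in h1; rewrite [_ * v^-1]mulrC (ger0_norm p2) in h2.
have p1 : 0 <= (Num.sqrt v)^-1 * l by rewrite mulr_ge0 ?invr_ge0 // ltW.
rewrite (ger0_norm p1) in h0.
have k0 : K%:R * `|eta0| <= e.
  apply: (@le_trans _ _ (K%:R * (e * ((Num.sqrt v)^-1 * l)))).
    by rewrite ler_wpM2l // ltW.
  have -> : K%:R * (e * ((Num.sqrt v)^-1 * l)) = e * (K%:R * l / Num.sqrt v) by ring.
  by rewrite ler_piMr // ler_pdivrMr // mul1r.
have k1 := q2 _ h1; have k2 := q2 _ h2.
have -> : K%:R * error_rate eps CA1 K eta0 eta1 eta2 = 4 * (2 + eps) * CA1 *
    (2 * (K%:R ^+ 2 * `|eta2|) + K%:R ^+ 2 * `|eta1| + CA1 * (K%:R * `|eta0|)).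
  by rewrite /error_rate; ring.
have CA10 : 0 <= CA1 := le_trans ler01 CA11.
rewrite -[leRHS]mulrA ler_wpM2l //; first by rewrite !mulr_ge0 //; lra.
have := ler_wpM2l CA10 k0; rewrite mulrDl; lra.
Qed.

End ErrorRate.

Lemma error_rate_ge0 (R : realType) (eps CA1 : R) K (eta0 eta1 eta2 : R) :
  0 < eps -> 0 < CA1 -> 0 <= error_rate eps CA1 K eta0 eta1 eta2.
Proof.
move=> e0 c0; rewrite !mulr_ge0 ?addr_ge0 ?mulr_ge0 ?addr_ge0 ?mulr_ge0 ?normr_ge0 ?ler0n ?ltW //.
Qed.

Lemma ln_ge1_near (R : realType) : \forall n \near \oo%classic, 1 <= ln (n%:R : R).
Proof.
near=> n; rewrite -[leLHS]expRK ler_ln ?posrE ?expR_gt0 //.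
  apply: (@le_trans _ _ (Num.bound (expR (1 : R)))%:R).
    by rewrite ltW // archi_boundP // expR_ge0.
  by rewrite ler_nat; near: n; exact: nbhs_infty_ge.
rewrite ltr0n; near: n; exact: nbhs_infty_gt.
Unshelve. all: by end_near. Qed.


Unset Implicit Arguments.
Set Strict Implicit.
Set Printing Implicit Defensive.

Theorem theorem1 (R : realType) (eps : R) (Heps : 0 < eps)
    (CA1 C1 Cmax Cphi : R)
    (HCA1 : 1 <= CA1) (HC1 : 0 < C1) (HCmax : 0 < Cmax) (HCphi : 0 < Cphi) :
  exists CA2star C2star : R,
  forall CA2 C2 : R, CA2star <= CA2 -> C2star <= C2 ->
  forall (K : nat -> nat)
         (cstar : forall n, 'I_n -> 'I_(K n))
         (Lambda0 : forall n, 'M[R]_(n, K n))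
         (rho : nat -> R)
         (Xi : forall n, 'M[R]_(n, (K n ^ 2)%N))
         (d : forall n, 'I_((K n ^ 2)%N) -> R)
         (phi1 phi2 eta0 eta1 eta2 : nat -> R),
  (* model *)
  (forall n, (2 <= K n)%N) ->
  (forall n i k, 0 < Lambda0 n i k < 1) ->
  (forall n, 0 < rho n <= 1) ->
  (* Xi: orthonormal eigenvectors of Theta for its K^2 nonzero eigenvalues d;
     Theta has exactly K^2 nonzero singular values *)
  (\forall n \near \oo%classic,
     eigdecomp (Theta (cstar n) (rho n *: Lambda0 n)) (Xi n) (d n) /\
     (forall j, d n j != 0) /\
     \rank (Theta (cstar n) (rho n *: Lambda0 n)) = (K n ^ 2)%N) ->
  (* P_k is well defined *)
  (\forall n \near \oo%classic, forall k,
     gramk (cstar n) (rho n *: Lambda0 n) k \in unitmx) ->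
  (* sigma_1 / sigma_{K^2} <= C1 sqrt(log n) *)
  (\forall n \near \oo%classic,
     smax (d n) / smin (d n) <= C1 * Num.sqrt (ln n%:R)) ->
  (* (A1) *)
  (\forall n \near \oo%classic, forall k : 'I_(K n),
     n%:R / (CA1 * (K n)%:R) <= (nk (cstar n) k)%:R <= CA1 * n%:R / (K n)%:R) ->
  (* (A2) *)
  (\forall n \near \oo%classic,
     n%:R * rho n ^+ 2 / (K n)%:R ^+ 2 >= CA2 * (ln n%:R) ^+ 2) ->
  (* (A3) *)
  (forall n, 0 < phi1 n <= 1) ->
  littleo eta1 (fun n => (n%:R * rho n ^+ 2)^-1 * (ln n%:R) ^+ 2) ->
  littleo eta0 (fun n => (Num.sqrt (n%:R * rho n ^+ 2))^-1 * ln n%:R) ->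
  (\forall n \near \oo%classic,
     let G i := [set j | (cstar n j == cstar n i) &&
                         (phi1 n <= `|tauX (Xi n) i j|)] in
     let H := [set i | (nk (cstar n) (cstar n i))%:R * (1 - eta0 n) <= #|G i|%:R] in
     #|~: H|%:R <= eta1 n * n%:R) ->
  (* (A4) *)
  littleo eta2 (fun n => (ln n%:R) ^+ 2 * (n%:R * rho n ^+ 2)^-1) ->
  (\forall n \near \oo%classic,
     let I := [set i | phi2 n <=
                 Num.sqrt (DP (cstar n) (rho n *: Lambda0 n) (cstar n i)
                             (row i (rho n *: Lambda0 n)) (row i (rho n *: Lambda0 n)))] in
     #|I|%:R > n%:R * (1 - eta2 n)) ->
  (\forall n \near \oo%classic, forall i : 'I_n,
     DP (cstar n) (rho n *: Lambda0 n) (cstar n i)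
        (row i (rho n *: Lambda0 n)) (row i (rho n *: Lambda0 n))
     <= Cmax * (K n)%:R ^+ 2 / n%:R) ->
  (* K / sqrt n >~ phi1 phi2 >= C2 rho K sqrt(log n) / sigma_{K^2} *)
  (\forall n \near \oo%classic,
     phi1 n * phi2 n <= Cphi * (K n)%:R / Num.sqrt n%:R) ->
  (\forall n \near \oo%classic,
     phi1 n * phi2 n >= C2 * rho n * (K n)%:R * Num.sqrt (ln n%:R) / smin (d n)) ->
  (* conclusion: TCSC with d_n = phi1/2, for every admissible run *)
  exists (C : R) (eta : nat -> R),
    littleo eta (fun _ => 1) /\
    \forall n \near \oo%classic,
      Prob (Theta (cstar n) (rho n *: Lambda0 n))
        (fun A => forall (Xh : 'M[R]_(n, (K n ^ 2)%N)) (mu : 'I_((K n ^ 2)%N) -> R),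
           top_eig (adjm A) Xh mu ->
           forall ch : 'I_n -> 'I_(K n),
             kmeans_approx eps (ttau Xh (phi1 n / 2)) ch ->
             loss (cstar n) ch <= eta n)
      >= 1 - C * n%:R ^- 4.
Proof.
(* The value 196 serves [A2K]. In the second threshold, the first summand brings the row error below
   [phi1 * phi2 / 16] and the second one brings the noise below [smin d / 100]. *)
exists 196, (16 * c_row Cmax + 100 * c_opn R * Cphi).
move=> CA2 C2 hCA2 hC2 K cstar L0 rho Xi d phi1 phi2 eta0 eta1 eta2.
move=> hK hL hrho near_eig near_gram _ near_A1 near_A2 hphi1 o1 o0 near_A3 o2.
move=> near_A4 near_A4' near_le near_ge.
have CA10 : 0 < CA1 := lt_le_trans ltr01 HCA1.
pose cst := 4 * (2 + eps) * CA1 * (3 + CA1).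
have cst0 : 0 < cst by rewrite !mulr_gt0 // addr_gt0.
pose rate n := error_rate eps CA1 (K n) (eta0 n) (eta1 n) (eta2 n).
have rate0 n : 0 <= rate n by exact: error_rate_ge0.
have rate_near e : 0 < e -> \forall n \near \oo%classic, (K n)%:R * rate n <= e.
  move=> e0; have e1 : 0 < e / cst by rewrite divr_gt0.
  near=> n.
  rewrite (_ : e = cst * (e / cst)); last by rewrite mulrC mulfVK // gt_eqF.
  apply: (@error_rate_small _ _ _ CA2 n _ (rho n)) => //.
  - exact: leq_trans (hK n).
  - by case/andP: (hrho n).
  - by near: n; exact: ln_ge1_near.
  - exact: ltW.
  - by near: n.
  - by near: n; exact: o0.
  - by near: n; exact: o1.
  - by near: n; exact: o2.
exists 3, rate; split.
  move=> e e0; near=> n; rewrite normr1 mulr1 ger0_norm ?rate0 //.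
  apply: (@le_trans _ _ ((K n)%:R * rate n)).
    rewrite ler_peMl ?rate0 // ler1n; exact: leq_trans (hK n).
  by near: n; exact: rate_near.
(* With K times the rate at most this number, the condition [rate_small] holds with 1/2 in place of
   1. *)
have half0 : 0 < (2 * CA1)^-1 by rewrite invr_gt0 mulr_gt0.
near=> n.
have [eX [d0 _]] : eigdecomp (Theta (cstar n) (rho n *: L0 n)) (Xi n) (d n) /\
     (forall j, d n j != 0) /\
     \rank (Theta (cstar n) (rho n *: L0 n)) = (K n ^ 2)%N by near: n.
apply: (@recovery R eps CA1 Cmax Cphi CA2 C2 n (K n) (cstar n) (L0 n) (rho n)
  (phi1 n) (phi2 n) (eta0 n) (eta1 n) (eta2 n) (Xi n) (d n)) => //.
- by near: n; exact: ln_ge1_near.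
- by near: n.
- by near: n.
- by near: n.
- by near: n.
- by near: n.
- by near: n.
- by near: n.
- by near: n.
apply: (@le_lt_trans _ _ (CA1 * (2 * CA1)^-1)).
  by rewrite ler_wpM2l ?(ltW CA10) //; near: n; exact: rate_near.
by rewrite invfM mulrCA divff ?gt_eqF // mulr1 invf_lt1 // ltr1n.
Unshelve. all: by end_near. Qed.
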